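(* Let $K$ be algebraically closed with $\operatorname{char}(K)\neq 2$ and $\Lambda=P(\mathbb{L}_n)$. Then $\dim_K HH^0(\Lambda)=\dim_K HH_0(\Lambda)=2n$ and $\dim_K HH^i(\Lambda)=\dim_K HH_i(\Lambda)=n$ for all $i>0$.
   Context: Let $K$ be an algebraically closed field and $n\ge 1$. The preprojective algebra of type $\mathbb{L}_n$ is $\Lambda=P(\mathbb{L}_n)=KQ/I$, where the quiver $Q$ has vertices $1,\dots,n$, a loop $\epsilon$ at vertex $1$, and arrows $a_i:i\to i+1$ and $\bar a_i:i+1\to i$ for $1\le i\le n-1$. Paths are written from left to right. The ideal $I$ is generated by $\epsilon^2+a_1\bar a_1$, by $\bar a_{i-1}a_{i-1}+a_i\bar a_i$ for $2\le i\le n-1$, and by $\bar a_{n-1}a_{n-1}$ (when $n=1$ the only relation is $\epsilon^2$). $HH^i(\Lambda)=\operatorname{Ext}^i_{\Lambda^e}(\Lambda,\Lambda)$ and $HH_i(\Lambda)=\operatorname{Tor}_i^{\Lambda^e}(\Lambda,\Lambda)$ are the Hochschild cohomology and homology spaces, $\Lambda^e=\Lambda\otimes_K\Lambda^{op}$. *)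

(* Defs.v *)
From HB Require Import structures.
From mathcomp Require Import all_boot all_order all_algebra all_field.
Set Implicit Arguments. Unset Strict Implicit. Unset Printing Implicit Defensive.
Import GRing.Theory.
Local Open Scope ring_scope.

(* The preprojective algebra P(L_n) = KQ/I, characterised as a finite- *)
(* dimensional K-algebra A together with elements e_i (vertices),      *)
(* eps (the loop), a_i, ab_i (the arrows and their "bars") satisfying  *)
(* the universal property of the quotient KQ/I of the path algebra.    *)
(* Vertices 1..n are indexed 0..n-1; arrow a_i : i -> i+1 (1<=i<=n-1)   *)
(* is [a (i-1)], ab_i is [ab (i-1)].  Paths are composed left to right, *)
(* so a path alpha from s to t satisfies alpha = e_s * alpha * e_t.     *)

Definition PL_rels (R : pzRingType) (n : nat) (e : nat -> R) (eps : R)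
    (a ab : nat -> R) : Prop :=
  [/\
      \sum_(i < n) e i = 1,
      (forall i j, (i < n)%N -> (j < n)%N ->
          e i * e j = if i == j then e i else 0),
      eps = e 0%N * eps * e 0%N,
      (forall i, (i.+1 < n)%N ->
          a i = e i * a i * e i.+1 /\ ab i = e i.+1 * ab i * e i) &
      [/\ (if n == 1%N then eps * eps = 0 else eps * eps + a 0%N * ab 0%N = 0),
          (forall i, (0 < i)%N -> (i.+1 < n)%N ->
              ab i.-1 * a i.-1 + a i * ab i = 0) &
          ((1 < n)%N -> ab (n - 2)%N * a (n - 2)%N = 0)]].

Definition is_alg_hom (K : fieldType) (A B : falgType K) (f : A -> B) : Prop :=
  [/\ forall (c : K) x y, f (c *: x + y) = c *: f x + f y,
      f 1 = 1 & forall x y, f (x * y) = f x * f y].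

(* A (with the given elements) is KQ/I for the quiver L_n and ideal I:
   the relations hold, and it is initial among K-algebras with elements
   satisfying the same relations. *)
Definition is_PLn (K : fieldType) (n : nat) (A : falgType K)
    (e : nat -> A) (eps : A) (a ab : nat -> A) : Prop :=
  PL_rels n e eps a ab /\
  forall (B : falgType K) (eB : nat -> B) (epsB : B) (aB abB : nat -> B),
    PL_rels n eB epsB aB abB ->
    let maps f := [/\ is_alg_hom f, (forall i, (i < n)%N -> f (e i) = eB i),
                      f eps = epsB &
                      (forall i, (i.+1 < n)%N -> f (a i) = aB i /\ f (ab i) = abB i)]
    in (exists f : A -> B, maps f) /\
       (forall f g : A -> B, maps f -> maps g -> forall x, f x = g x).

(* Hochschild (co)homology of a finite-dimensional algebra A, computed *)
(* by the standard Hochschild complexes, in coordinates w.r.t. a basis  *)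
(* of A (the result does not depend on the basis).                      *)
Section Hochschild.
Variables (K : fieldType) (A : falgType K).

Definition bA := vbasis (fullv : {vspace A}).
Local Notation Ib := 'I_(\dim (fullv : {vspace A})).
Local Notation Ix m := {ffun 'I_m -> Ib}.
(* A^{(x) m} in the basis of tensors of basis elements *)
Local Notation Tn m := {ffun Ix m -> K^o}.

(* the sequence of basis elements indexed by k (0 beyond m) *)
Definition bf m (k : Ix m) : nat -> A :=
  fun t => \sum_(j < m | val j == t) tnth bA (k j).

(* y_0 (x) ... (x) y_(m-1) as an element of Tn m *)
Definition tens m (y : nat -> A) : Tn m :=
  [ffun k : Ix m => \prod_(j < m) coord bA (k j) (y j)].

Definition face (j : nat) (x : nat -> A) : nat -> A :=
  fun t => if (t < j)%N then x t else if t == j then x t * x t.+1 else x t.+1.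
Definition cyc (i : nat) (x : nat -> A) : nat -> A :=
  fun t => if t == 0%N then x i * x 0%N else x t.
Definition shift (x : nat -> A) : nat -> A := fun t => x t.+1.

(* Hochschild boundary b : C_(m+1) = A^{(x)(m+2)} -> C_m = A^{(x)(m+1)} *)
Definition hbd (m : nat) (f : Tn m.+2) : Tn m.+1 :=
  \sum_(k : Ix m.+2) f k *:
    (\sum_(j < m.+1) (-1) ^+ j *: tens m.+1 (face j (bf k))
     + (-1) ^+ m.+1 *: tens m.+1 (cyc m.+1 (bf k))).

(* Hochschild cochains C^i = Hom_K(A^{(x) i}, A), given by values on basis
   tensors; ev is the multilinear extension *)
Local Notation Cn i := {ffun Ix i -> A}.
Definition ev i (f : Cn i) (y : nat -> A) : A :=
  \sum_(k : Ix i) (\prod_(j < i) coord bA (k j) (y j)) *: f k.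

Definition cbd (i : nat) (f : Cn i) : Cn i.+1 :=
  [ffun k : Ix i.+1 => let x := bf k in
     x 0%N * ev f (shift x)
     + \sum_(j < i) (-1) ^+ j.+1 *: ev f (face j x)
     + (-1) ^+ i.+1 *: (ev f x * x i)].

Definition hbdL m : 'Hom(Tn m.+2, Tn m.+1) := linfun (@hbd m).
Definition cbdL i : 'Hom(Cn i, Cn i.+1) := linfun (@cbd i).

Definition dimHH_hom (i : nat) : nat :=
  match i with
  | 0 => (\dim (fullv : {vspace Tn 1}) - \dim (limg (hbdL 0)))%N
  | i'.+1 => (\dim (lker (hbdL i')) - \dim (limg (hbdL i'.+1)))%N
  end.

Definition dimHH_coh (i : nat) : nat :=
  match i with
  | 0 => \dim (lker (cbdL 0))
  | i'.+1 => (\dim (lker (cbdL i'.+1)) - \dim (limg (cbdL i')))%N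
  end.

End Hochschild.

(* Main.v *)
Require Import Defs.
From HB Require Import structures.
From mathcomp Require Import all_boot all_order all_algebra all_field.
From mathcomp Require Import zify ring.
From Stdlib Require Import FunctionalExtensionality.
Set Implicit Arguments. Unset Strict Implicit. Unset Printing Implicit Defensive.
Import GRing.Theory.
Local Open Scope ring_scope.

(* Unfold Lambda = P(L_n) along the double cover A_2n -> L_n: absorbing signs
   into the arrows, the relations say that "up" and "down" arrows commute, so
   the paths T a u v (up u times, then down v times) give a multiplicative
   basis and a symmetrizing form phi, the coefficient sum of the socle.  Since
   Lambda is symmetric, HH_i is dual to HH^i.

   Splicing 0 -> A -> Q0 -> Q1 -> Q2 -> A^sg -> 0, where sg is the automorphism
   eps |-> -eps and the Q's are sums of bimodules Hom_K(A e_i, A e_j), gives a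
   6-periodic coresolution of A by bimodules with trivial higher Hochschild
   cohomology.  Comparing the two edges of the resulting double complex, HH^i
   is the cohomology of the invariants Inv, of dimensions n(n+1), 2n^2 and
   n(n+1).  On these, the kernel of d0 has dimension 2n (n if twisted by sg),
   d1 is adjoint to the d0 of the opposite twist, and d2, given by Casimir sums,
   is 0 untwisted and of rank n twisted; the last two facts and the twisted
   kernel use that 2 is invertible. *)

(** * Ranks, and the edges of a double complex with exact rows and columns *)

(** Hochschild cohomology is given here by the bar complex in coordinates, so the small complex has
    to be compared with that complex itself. Cochains with values in the coresolution form a double
    complex that is exact in both directions away from its edges. Only dimensions of subquotients
    are carried along its antidiagonals, which avoids building chain maps or isomorphisms. The
    bimodules Hom_K(A e_i, A e_j) suit this comparison because evaluation at e_i yields an explicit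
    contracting homotopy.

    The twist comes from the loop: families on the double cover are symmetric or antisymmetric under
    c |-> 2n-1-c, and folding an antisymmetric one back to L_n costs a sign whenever a path ends on
    the other side of the loop. That sign is the effect of sg on the path, so A reappears twisted
    after three steps and untwisted after six.

    That the paths span is read off from a subalgebra, and their independence from an algebra of
    matrices. *)

Section LinearAlgebra.
Variable K : fieldType.

Lemma linfun_lin (U V : vectType K) (f : U -> V) : linear f -> linfun f =1 f.
Proof.
move=> lf x.
pose fM := GRing.isLinear.Build _ _ _ _ f lf.
pose fL : {linear U -> V} := HB.pack f fM.
exact: (lfunE fL).
Qed.

Lemma dim_ffun (I : finType) (V : vectType K) :
  \dim {:{ffun I -> V}} = (#|I| * \dim {:V})%N.
Proof. by rewrite !dimvf. Qed.

(** [N] and [Z] both contain the whole kernel of [f] on [Y], so rank-nullity removes the same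
    dimension from each. *)
Lemma dim_img_sub (U V : vectType K) (f : 'Hom(U, V)) (Y N Z : {vspace U}) :
    (Y :&: lker f <= N)%VS -> (N <= Z)%VS -> (Z <= Y)%VS ->
  (\dim (f @: Z) - \dim (f @: N) = \dim Z - \dim N)%N.
Proof.
move=> kN NZ ZY.
have eqk (A : {vspace U}) : (N <= A)%VS -> (A <= Y)%VS ->
    \dim (A :&: lker f) = \dim (Y :&: lker f).
  move=> NA AY; congr (\dim _); apply/eqP; rewrite eqEsubv capvS //=.
  by rewrite subv_cap capvSr andbT (subv_trans kN).
have eqZ := limg_ker_dim f Z; have eqN := limg_ker_dim f N.
rewrite eqk // in eqZ; rewrite eqk // in eqN; last exact: subv_trans ZY.
lia.
Qed.

(* x |-> (B' x w_t)_t for a basis w_t of the image of g has kernel inside the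
   kernel of f. *)
Lemma rank_adj_le (V V' W W' : vectType K) (f : 'Hom(V, V')) (g : 'Hom(W', W))
    (X : {vspace V}) (Y : {vspace W'})
    (B : V' -> W' -> K) (B' : V -> W -> K) :
    (forall w, scalar (B'^~ w)) ->
    (forall x y, x \in X -> y \in Y -> B (f x) y = B' x (g y)) ->
    (forall x, scalar (B' x)) ->
    (forall x, x \in X -> (forall y, y \in Y -> B (f x) y = 0) -> f x = 0) ->
  (\dim (f @: X) <= \dim (g @: Y))%N.
Proof.
move=> linl adj linr nondeg.
set r := \dim (g @: Y).
pose b := vbasis (g @: Y).
pose P (x : V) : {ffun 'I_r -> K^o} := [ffun t => B' x (tnth b t)].
have linP : linear P.
  by move=> c x y; apply/ffunP => t; rewrite !ffunE linl.
have kP x : x \in X -> P x = 0 -> f x = 0.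
  move=> Xx Px; apply: nondeg => // y Yy; rewrite adj //.
  rewrite (coord_vbasis (memv_img g Yy)).
  pose BM := GRing.isLinear.Build _ _ _ _ (B' x) (linr x).
  pose BL : {scalar W} := HB.pack (B' x) BM.
  rewrite -[LHS]/(BL _) linear_sum big1 // => t _; rewrite linearZ /=.
  have /ffunP/(_ t) := Px; rewrite !ffunE (tnth_nth 0) => ->.
  by rewrite mulr0.
have := limg_ker_dim (linfun P) X; have := limg_ker_dim f X.
have : (\dim (X :&: lker (linfun P)) <= \dim (X :&: lker f))%N.
  apply: dimvS; apply/subvP => x /memv_capP[Xx].
  rewrite memv_ker (linfun_lin linP) => /eqP Px.
  by rewrite memv_cap Xx memv_ker kP ?eqxx.
have : (\dim (linfun P @: X) <= r)%N.
  by rewrite (leq_trans (dimvS (subvf _))) // dim_ffun card_ord dimvf muln1.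
lia.
Qed.

Section DoubleComplex.
Variables (V : nat -> nat -> vectType K) (X : forall m k, {vspace V m k}).
Variables (dv : forall m k, 'Hom(V m k, V m.+1 k)).
Variables (dh : forall m k, 'Hom(V m k, V m k.+1)).
Hypothesis comm : forall m k x, x \in X m k -> dh _ _ (dv _ _ x) = dv _ _ (dh _ _ x).
Hypothesis rows : forall m k,
  (X m k.+1 :&: lker (dh m k.+1) = dh m k @: X m k)%VS.
Hypothesis cols : forall m k,
  (X m.+1 k :&: lker (dv m.+1 k) = dv m k @: X m k)%VS.

(** [Z]/[N] is the intermediate term of a staircase chase: [dh] identifies it with a subquotient at
    (m, k+1) and [dv] with one at (m+1, k), as [diag_h] and [diag_v] state in terms of
    dimensions. *)
Let Z m k : {vspace V m k} := (X m k :&: lker (dv m k.+1 \o dh m k))%VS.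
Let N m k : {vspace V m k} := (X m k :&: lker (dh m k) + X m k :&: lker (dv m k))%VS.

Lemma memZ m k x : (x \in Z m k) = (x \in X m k) && (dv _ _ (dh _ _ x) == 0).
Proof. by rewrite memv_cap memv_ker comp_lfunE. Qed.

Lemma subNZ m k : (N m k <= Z m k)%VS.
Proof.
rewrite subv_add; apply/andP; split; apply/subvP => x /memv_capP[Xx];
  rewrite memv_ker memZ Xx /= => /eqP d0.
  by rewrite d0 linear0.
by rewrite -comm // d0 linear0.
Qed.

Lemma diag_h m k :
  (\dim (Z m k) - \dim (N m k) =
   \dim (X m k.+1 :&: lker (dh m k.+1) :&: lker (dv m k.+1)) -
   \dim (dh m k @: (X m k :&: lker (dv m k))))%N.
Proof.
rewrite -(@dim_img_sub _ _ (dh m k) (X m k) (N m k) (Z m k)) ?capvSl ?addvSl ?subNZ //.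
congr (_ - _)%N; last congr (\dim _); first congr (\dim _).
  apply/vspaceP => y; rewrite memv_cap rows.
  apply/memv_imgP/andP => [[x /[!memZ] /andP[Xx dx] ->]|[/memv_imgP[x Xx ->]]].
    by rewrite memv_img // memv_ker.
  by rewrite memv_ker => dx; exists x => //; rewrite memZ Xx.
rewrite limgD; apply/eqP; rewrite eqEsubv addvSr andbT subv_add subvv andbT.
apply/subvP => y /memv_imgP[x /memv_capP[_]].
by rewrite memv_ker => /eqP -> ->; rewrite mem0v.
Qed.

Lemma diag_v m k :
  (\dim (Z m k) - \dim (N m k) =
   \dim (X m.+1 k :&: lker (dv m.+1 k) :&: lker (dh m.+1 k)) -
   \dim (dv m k @: (X m k :&: lker (dh m k))))%N.
Proof.
rewrite -(@dim_img_sub _ _ (dv m k) (X m k) (N m k) (Z m k)) ?capvSl ?addvSr ?subNZ //.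
congr (_ - _)%N; last congr (\dim _); first congr (\dim _).
  apply/vspaceP => y; rewrite memv_cap cols.
  apply/memv_imgP/andP => [[x /[!memZ] /andP[Xx dx] ->]|[/memv_imgP[x Xx ->]]].
    by rewrite memv_img // memv_ker comm.
  by rewrite memv_ker comm // => dx; exists x => //; rewrite memZ Xx.
rewrite limgD; apply/eqP; rewrite eqEsubv addvSl andbT subv_add subvv /=.
apply/subvP => y /memv_imgP[x /memv_capP[_]].
by rewrite memv_ker => /eqP -> ->; rewrite mem0v.
Qed.

(** Both sides are the joint kernel at (m+1, k+1) modulo the image of [dv] after [dh]: exactness
    turns the kernel of [dh] at (m, k+1) into an image of [dh], that of [dv] at (m+1, k) into an
    image of [dv], and the square commutes. *)
Lemma diag_step m k :
  (\dim (Z m k.+1) - \dim (N m k.+1) = \dim (Z m.+1 k) - \dim (N m.+1 k))%N.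
Proof.
rewrite diag_v diag_h -!capvA [(lker (dv _ _) :&: _)%VS]capvC rows cols.
congr (_ - _)%N; congr (\dim _); rewrite -!limg_comp.
by apply: eq_in_limg => x Xx; rewrite !comp_lfunE comm.
Qed.

(** Slide from (0, i) to (i, 0) along the antidiagonal. At either end the subquotient is the
    cohomology of the edge complex, since the joint kernel and the image involve only edge
    elements. *)
Theorem double_complex_edges i :
  (\dim (X 0 i.+1 :&: lker (dv 0 i.+1) :&: lker (dh 0 i.+1)) -
     \dim (dh 0 i @: (X 0 i :&: lker (dv 0 i))) =
   \dim (X i.+1 0 :&: lker (dh i.+1 0) :&: lker (dv i.+1 0)) -
     \dim (dv i 0 @: (X i 0 :&: lker (dh i 0))))%N.
Proof.
have step m : forall k,
    (\dim (Z m k) - \dim (N m k) = \dim (Z (m + k) 0) - \dim (N (m + k) 0))%N.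
  by move=> k; elim: k m => [|k IH] m; rewrite ?addn0 // diag_step IH addSnnS.
have := step 0 i; rewrite add0n diag_h diag_v.
by rewrite -!capvA [(lker (dh 0 _) :&: _)%VS]capvC [(lker (dv i.+1 _) :&: _)%VS]capvC.
Qed.
End DoubleComplex.
End LinearAlgebra.

(** * Hochschild cochains with values in a bimodule *)

Section AlternatingSum.
Variables (K : fieldType) (W : vectType K).

(** The cancellation behind d d = 0: by the cosimplicial identity the terms with i < j ([lo]) are
    those with j <= i ([hi]), with opposite sign. *)
Lemma alternating_double_sum (G : nat -> nat -> W) n :
    (forall i j, (i < j)%N -> (j < n.+1)%N -> G j i = G i j.-1) ->
  \sum_(j < n.+1) (-1) ^+ j *: (\sum_(i < n) (-1) ^+ i *: G j i) = 0.
Proof.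
move=> GE.
pose lo (j : nat) := \sum_(i < n | (i < j)%N) (-1) ^+ (j + i) *: G j i.
pose hi (j : nat) := \sum_(i < n | (j <= i)%N) (-1) ^+ (j + i) *: G j i.
have -> : \sum_(j < n.+1) (-1) ^+ j *: (\sum_(i < n) (-1) ^+ i *: G j i)
    = \sum_(j < n.+1) lo j + \sum_(j < n.+1) hi j.
  rewrite -big_split; apply: eq_bigr => j _ /=.
  rewrite scaler_sumr (bigID (fun i : 'I_n => (i < j)%N)) /=.
  by congr (_ + _); apply: eq_big => i; rewrite -?leqNgt // => _;
    rewrite scalerA exprD.
rewrite big_ord_recl {1}/lo big_pred0 // add0r.
rewrite [X in _ + X]big_ord_recr /= [hi n]big_pred0 ?addr0; last first.
  by move=> i; rewrite leqNgt ltn_ord.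
have -> : \sum_(j < n) lo (lift ord0 j) =
    \sum_(j < n) \sum_(i < n | (i <= j)%N) - ((-1) ^+ (i + j) *: G i j).
  apply: eq_bigr => j _; rewrite /lo; apply: eq_big => [i|i].
    by rewrite lift0 ltnS.
  move=> ij; rewrite GE //.
  by rewrite lift0 /= addSn exprS mulN1r scaleNr addnC.
rewrite (exchange_big_dep predT) //= -big_split big1 // => i _ /=.
by rewrite /hi -big_split big1 // => j _ /=; rewrite addNr.
Qed.

End AlternatingSum.

Section Cochains.
Variables (K : fieldType) (A : falgType K) (W : vectType K).
Local Notation Ib := 'I_(\dim {:A}).
Local Notation Ix m := {ffun 'I_m -> Ib}.
Local Notation Cn m := {ffun Ix m -> W}.

Definition upd (y : nat -> A) j z : nat -> A := fun t => if t == j then z else y t.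

Definition evW m (f : Cn m) (y : nat -> A) : W :=
  \sum_(k : Ix m) (\prod_(j < m) coord (bA A) (k j) (y j)) *: f k.

(** Arguments are sequences indexed by all of [nat], of which only the first [m] entries count;
    faces and shifts then need no casts between arities. *)
Definition multilin m (F : (nat -> A) -> W) : Prop :=
  (forall y y', (forall t, (t < m)%N -> y t = y' t) -> F y = F y') /\
  (forall y j, (j < m)%N -> linear (fun z => F (upd y j z))).

Lemma bf_ord m (k : Ix m) (j : 'I_m) : bf k j = tnth (bA A) (k j).
Proof. by rewrite /bf (big_pred1 j) // => i; apply/eqP/eqP => [/val_inj|->]. Qed.

Lemma coord_bf m (k : Ix m) i (j : 'I_m) : coord (bA A) i (bf k j) = (i == k j)%:R.
Proof.
by rewrite bf_ord (tnth_nth 0) coord_free ?(basis_free (vbasisP _)) // eq_sym.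
Qed.

Lemma evW_bf m (f : Cn m) k : evW f (bf k) = f k.
Proof.
rewrite /evW (bigD1 k) //= big1 ?scale1r => [|j _]; last by rewrite coord_bf eqxx.
rewrite big1 ?addr0 // => k' /eqP/ffunP nk.
have [j kj] : exists j, k' j != k j.
  apply/existsP; case: (boolP [exists j, _]) => //.
  by rewrite negb_exists => /forallP h; case: nk => j; apply/eqP; rewrite -[_ == _]negbK h.
by rewrite (bigD1 j) //= coord_bf (negbTE kj) mul0r scale0r.
Qed.

Lemma evW_multilin m (f : Cn m) : multilin m (evW f).
Proof.
split=> [y y' yy'|y j jm c z1 z2].
  by apply: eq_bigr => k _; congr (_ *: _); apply: eq_bigr => j _; rewrite yy'.
rewrite /evW scaler_sumr -big_split; apply: eq_bigr => k _ /=.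
rewrite scalerA -scalerDl; congr (_ *: _).
have split_j z : \prod_(i < m) coord (bA A) (k i) (upd y j z i) =
    coord (bA A) (k (Ordinal jm)) z *
      \prod_(i < m | i != Ordinal jm) coord (bA A) (k i) (y i).
  rewrite (bigD1 (Ordinal jm)) //= /upd eqxx; congr (_ * _).
  apply: eq_bigr => i ij; case: eqP => // ijv.
  by case/negP: ij; apply/eqP/val_inj.
by rewrite !split_j linearP /= mulrDl mulrA.
Qed.

Lemma upd_id (y : nat -> A) j : upd y j (y j) = y.
Proof. by apply: functional_extensionality => t; rewrite /upd; case: eqP => [->|]. Qed.

Lemma linear_suml (V : vectType K) (F : V -> W) : linear F ->
  forall I (r : seq I) (c : I -> K) (b : I -> V),
  F (\sum_(i <- r) c i *: b i) = \sum_(i <- r) c i *: F (b i).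
Proof.
move=> lF I r c b; rewrite -(linfun_lin lF) linear_sum.
by apply: eq_bigr => i _; rewrite linearZ /= (linfun_lin lF).
Qed.

Lemma multilin_uniq m F G : multilin m F -> multilin m G ->
  (forall k : Ix m, F (bf k) = G (bf k)) -> F = G.
Proof.
move=> [Fext Flin] [Gext Glin] FG; apply: functional_extensionality => y0.
(* Agreement when the entries from [i] on are basis vectors. Expanding entry [i] in the basis passes
   from [i] to [i.+1], and for i = m the condition is empty. *)
have claim i : (i <= m)%N -> forall y,
    (forall t, (i <= t < m)%N -> exists b, y t == tnth (bA A) b) -> F y = G y.
  elim: i => [_|i IH im] y yb.
    pose k : Ix m := [ffun j : 'I_m => xchoose (yb j (ltn_ord j))].
    have yk t : (t < m)%N -> y t = bf k t.
      move=> tm; rewrite (bf_ord k (Ordinal tm)) ffunE.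
      exact: (eqP (xchooseP (yb (Ordinal tm) (ltn_ord (Ordinal tm))))).
    by rewrite (Fext _ _ yk) (Gext _ _ yk).
  rewrite -(upd_id y i) (coord_vbasis (memvf (y i))).
  rewrite (linear_suml (Flin y i im)) (linear_suml (Glin y i im)).
  apply: eq_bigr => b _; rewrite (IH (ltnW im)) // => t /andP[it tm].
  rewrite /upd; case: eqP => [_|ti]; last by apply: yb; lia.
  by exists b; rewrite (tnth_nth 0) eqxx.
by apply: (claim m) => // t; lia.
Qed.

Lemma multilin_ev m F : multilin m F -> evW [ffun k : Ix m => F (bf k)] = F.
Proof.
move=> mF; apply: (multilin_uniq (evW_multilin _) mF) => k.
by rewrite evW_bf ffunE.
Qed.

Lemma multilin0 m : multilin m (fun=> 0).
Proof. by split=> // y j _ c z1 z2; rewrite scaler0 addr0. Qed.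

Lemma multilinD m F G : multilin m F -> multilin m G -> multilin m (fun y => F y + G y).
Proof.
move=> [Fe Fl] [Ge Gl]; split=> [y y' yy'|y j jm c z1 z2].
  by rewrite (Fe _ _ yy') (Ge _ _ yy').
by rewrite (Fl y j jm) (Gl y j jm) scalerDr addrACA.
Qed.

Lemma multilinZ m F c : multilin m F -> multilin m (fun y => c *: F y).
Proof.
move=> [Fe Fl]; split=> [y y' yy'|y j jm a z1 z2]; first by rewrite (Fe _ _ yy').
by rewrite (Fl y j jm) scalerDr !scalerA [c * a]mulrC.
Qed.

Lemma multilin_sum m I (r : seq I) (F : I -> (nat -> A) -> W) :
  (forall i, multilin m (F i)) -> multilin m (fun y => \sum_(i <- r) F i y).
Proof.
move=> mF; elim: r => [|i r IH].
  have -> : (fun y => \sum_(i <- [::]) F i y) = (fun=> 0 : W); last exact: multilin0.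
  by apply: functional_extensionality => y; rewrite big_nil.
have -> : (fun y => \sum_(i <- i :: r) F i y) = (fun y => F i y + \sum_(i <- r) F i y).
  by apply: functional_extensionality => y; rewrite big_cons.
exact: multilinD.
Qed.

Record bimod (l r : A -> W -> W) : Prop := Bimod {
  bimod_l_lin : forall a, linear (l a);
  bimod_l_linl : forall w, linear (l^~ w);
  bimod_r_lin : forall a, linear (r a);
  bimod_r_linl : forall w, linear (r^~ w);
  bimod_lM : forall a b w, l (a * b) w = l a (l b w);
  bimod_rM : forall a b w, r (a * b) w = r b (r a w);
  bimod_lr : forall a b w, l a (r b w) = r b (l a w) }.

Section Differential.
Variables (l r : A -> W -> W).
Hypothesis bm : bimod l r.
Let l_lin := bimod_l_lin bm.
Let l_linl := bimod_l_linl bm.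
Let r_lin := bimod_r_lin bm.
Let r_linl := bimod_r_linl bm.
Let lM := bimod_lM bm.
Let rM := bimod_rM bm.
Let lr := bimod_lr bm.

Definition coface m j (F : (nat -> A) -> W) (x : nat -> A) : W :=
  if j == 0%N then l (x 0%N) (F (shift x))
  else if j == m.+1 then r (x m) (F x) else F (face j.-1 x).

Definition diffW m (F : (nat -> A) -> W) (x : nat -> A) : W :=
  \sum_(j < m.+2) (-1) ^+ j *: coface m j F x.

Ltac seq_ext := apply: functional_extensionality => t;
  rewrite /shift /face /upd /=; repeat case: ifP => //; intros;
  try (exfalso; lia); try (congr (_ * _)); try (congr (_ _); lia).

Lemma coface_multilin m j F : (j < m.+2)%N -> multilin m F -> multilin m.+1 (coface m j F).
Proof.
move=> jm [Fe Fl]; rewrite /coface; split=> [y y' yy'|y i im].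
  have [j0|j0] := eqVneq j 0%N.
    by rewrite yy' // (Fe _ (shift y')) // => t tm; rewrite /shift yy'.
  have [jm'|jm'] := eqVneq j m.+1.
    by rewrite yy' // (Fe _ y') // => t tm; rewrite yy' // ltnW.
  apply: Fe => t tm; rewrite /face; case: ifP => tj; first by rewrite yy' // ltnW.
  by case: ifP => _; rewrite !yy' // ltnW.
move=> c z1 z2.
have [j0|j0] := eqVneq j 0%N.
  case: i im => [|i] im.
    have E z : shift (upd y 0 z) = shift y by seq_ext.
    by rewrite !E /upd /= l_linl.
  have E z : shift (upd y i.+1 z) = upd (shift y) i z by seq_ext.
  by rewrite !E /upd /= (Fl _ i) // l_lin.
have [jm'|jm'] := eqVneq j m.+1.
  have [->|im'] := eqVneq i m.
    have E z : F (upd y m z) = F y.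
      by apply: Fe => t tm; rewrite /upd; case: eqP tm => // ->; rewrite ltnn.
    by rewrite !E /upd /= eqxx r_linl.
  have im2 : (i < m)%N by lia.
  have E z : upd y i z m = y m by rewrite /upd eq_sym (negbTE im').
  by rewrite !E (Fl y i im2) r_lin.
have [ij|ij|ij] := ltngtP i j.-1.
- have E z : face j.-1 (upd y i z) = upd (face j.-1 y) i z by seq_ext.
  by rewrite !E Fl //; lia.
- have [ij'|ij'] := eqVneq i j.
    have E z : face j.-1 (upd y i z) = upd (face j.-1 y) j.-1 (y j.-1 * z).
      by seq_ext.
    by rewrite !E mulrDr -scalerAr Fl //; lia.
  have E z : face j.-1 (upd y i z) = upd (face j.-1 y) i.-1 z by seq_ext.
  by rewrite !E Fl //; lia.
have E z : face j.-1 (upd y i z) = upd (face j.-1 y) j.-1 (z * y j).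
  by seq_ext.
by rewrite !E mulrDl -scalerAl Fl //; lia.
Qed.

Lemma diffW_multilin m F : multilin m F -> multilin m.+1 (diffW m F).
Proof.
by move=> mF; apply: multilin_sum => j; apply: multilinZ; apply: coface_multilin.
Qed.

(** The cosimplicial identities. The two outer cofaces use the bimodule axioms, and two adjacent
    inner faces reduce to associativity in A. *)
Lemma coface_coface m i j F : multilin m F -> (i < j)%N -> (j < m.+3)%N ->
  coface m.+1 j (coface m i F) = coface m.+1 i (coface m j.-1 F).
Proof.
move=> [Fe _] ij jm; apply: functional_extensionality => x; rewrite /coface.
have -> : (j == 0%N) = false by lia.
have [i0|i0] := eqVneq i 0%N.
  have [jm'|jm'] := eqVneq j m.+2.
    rewrite jm' /= eqxx lr; congr (r _ (l _ _)).
  have [j1|j1] := eqVneq j 1%N.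
    rewrite j1 /= -lM; congr (l _ (F _)); seq_ext.
  have -> : (j.-1 == 0%N) = false by lia.
  have -> : (j.-1 == m.+1) = false by lia.
  rewrite /face /=; have -> : (0 < j.-1)%N by lia.
  by congr (l _ (F _)); seq_ext.
have -> : (j.-1 == 0%N) = false by lia.
have -> : (i == m.+2) = false by lia.
have [jm'|jm'] := eqVneq j m.+2.
  rewrite jm' /= eqxx.
  have [im|im] := eqVneq i m.+1.
    rewrite im /= /face ltnn eqxx rM; congr (r _ (r _ _)).
    by apply: Fe => t tm; rewrite tm.
  congr (r _ _); rewrite /face.
  have -> : (m < i.-1)%N = false by lia.
  by have -> : (m == i.-1) = false by lia.
have -> : (i == m.+1) = false by lia.
have -> : (j.-1 == m.+1) = false by lia.
congr (F _).
have [ij'|ij'] := eqVneq i j.-1.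
  by rewrite ij'; apply: functional_extensionality => t; rewrite /face;
    have [tj|tj|tj] := ltngtP t j.-2; repeat case: ifP => //; intros; try (exfalso; lia);
    rewrite ?mulrA; (repeat congr (_ * _)); congr (x _); lia.
apply: functional_extensionality => t; rewrite /face.
by repeat case: ifP => //; intros; try (exfalso; lia); (try congr (_ * _)); congr (x _); lia.
Qed.

Lemma coface_linear m j c F G x : coface m j (fun y => c *: F y + G y) x =
  c *: coface m j F x + coface m j G x.
Proof. by rewrite /coface; case: ifP => _; last case: ifP => _; rewrite ?l_lin ?r_lin. Qed.

Lemma diffW_linear m c F G x : diffW m (fun y => c *: F y + G y) x =
  c *: diffW m F x + diffW m G x.
Proof.
rewrite /diffW scaler_sumr -big_split; apply: eq_bigr => j _ /=.
by rewrite coface_linear scalerDr !scalerA [c * _]mulrC.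
Qed.

Lemma coface_sum m j I (s : seq I) (c : I -> K) (F : I -> (nat -> A) -> W) x :
  coface m j (fun y => \sum_(i <- s) c i *: F i y) x =
  \sum_(i <- s) c i *: coface m j (F i) x.
Proof.
by rewrite /coface; case: ifP => _; last case: ifP => _ //;
  rewrite linear_suml; [by []|exact: l_lin|by []|exact: r_lin].
Qed.

Lemma diffW_diffW m F x : multilin m F -> diffW m.+1 (diffW m F) x = 0.
Proof.
move=> mF; rewrite -[RHS](alternating_double_sum
  (G := fun j i => coface m.+1 j (coface m i F) x) (n := m.+2)).
  by apply: eq_bigr => j _; rewrite coface_sum.
by move=> i j ij jm /=; rewrite coface_coface.
Qed.

(* A bimodule with such a rho is a retract of Hom_K(A, W), so its higher
   Hochschild cohomology vanishes; contr is the contracting homotopy. *)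
Section Contraction.
Variables (Q : {vspace W}) (rho : (A -> W) -> W).
Hypothesis rho_lin : forall c G1 G2, linear G1 -> linear G2 ->
  rho (fun z => c *: G1 z + G2 z) = c *: rho G1 + rho G2.
Hypothesis rho_l : forall a G, linear G -> rho (fun z => l a (G z)) = l a (rho G).
Hypothesis rho_r : forall a G, linear G -> rho (fun z => G (a * z)) = r a (rho G).
Hypothesis rho_id : forall w, w \in Q -> rho (fun z => r z w) = w.

Definition contr m (F : (nat -> A) -> W) (y : nat -> A) : W :=
  rho (fun z => F (upd y m z)).

Lemma rho0 : rho (fun=> 0) = 0.
Proof.
have lin0 : linear (fun _ : A => 0 : W) by move=> a u v; rewrite scaler0 addr0.
rewrite -[RHS](addNr (rho (fun=> 0))) -scaleN1r -rho_lin //; congr rho.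
by apply: functional_extensionality => z; rewrite scaler0 addr0.
Qed.

Lemma rho_sum I (s : seq I) (c : I -> K) (G : I -> A -> W) :
    (forall i, linear (G i)) ->
  rho (fun z => \sum_(i <- s) c i *: G i z) = \sum_(i <- s) c i *: rho (G i).
Proof.
move=> lG; elim: s => [|i s IH].
  rewrite big_nil -[RHS]rho0; congr rho; apply: functional_extensionality => z.
  by rewrite big_nil.
have linS : linear (fun z => \sum_(i <- s) c i *: G i z).
  move=> a u v; rewrite scaler_sumr -big_split; apply: eq_bigr => k _ /=.
  by rewrite lG scalerDr !scalerA mulrC.
rewrite big_cons -IH -rho_lin //; congr rho; apply: functional_extensionality => z.
by rewrite big_cons.
Qed.

Lemma contr_multilin m F : multilin m.+1 F -> multilin m (contr m F).
Proof.
move=> [Fe Fl]; split=> [y y' yy'|y j jm c z1 z2].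
  congr rho; apply: functional_extensionality => z; apply: Fe => t tm.
  by rewrite /upd; case: eqP => // tm'; apply: yy'; lia.
rewrite -rho_lin; try by apply: Fl.
congr rho; apply: functional_extensionality => z.
have E z' : upd (upd y j z') m z = upd (upd y m z) j z' by seq_ext.
by rewrite !E Fl // ltnW.
Qed.

(** Apply [rho] to the cocycle identity as a function of its last argument. The last coface is z |->
    r z (F y), which [rho] sends back to F y; the remaining cofaces become those of [contr m F]. *)
Lemma contrP m F : multilin m.+1 F -> (forall y, F y \in Q) ->
  (forall y, diffW m.+1 F y = 0) ->
  forall y, F y = (-1) ^+ m.+1 *: diffW m (contr m F) y.
Proof.
move=> mF FQ dF y; have [Fe Fl] := mF.
have lc j : (j < m.+3)%N -> linear (fun z => coface m.+1 j F (upd y m.+1 z)).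
  by move=> jm; have [_ +] := coface_multilin jm mF; apply.
have := rho_sum (index_enum 'I_m.+3) (fun j : 'I_m.+3 => (-1) ^+ j)
  (fun j => lc j (ltn_ord j)).
have -> : (fun z => \sum_(j <- index_enum 'I_m.+3) (-1) ^+ j *:
    coface m.+1 j F (upd y m.+1 z)) = (fun=> 0 : W).
  by apply: functional_extensionality => z; rewrite -[RHS](dF (upd y m.+1 z)).
rewrite rho0 big_ord_recr /=.
have -> : (fun z => coface m.+1 m.+2 F (upd y m.+1 z)) = (fun z => r z (F y)).
  apply: functional_extensionality => z; rewrite /coface /= eqxx.
  rewrite {1}/upd eqxx; congr (r _ _); apply: Fe => t tm.
  by rewrite /upd; case: eqP => // tm'; exfalso; lia.
rewrite rho_id //.
have -> : \sum_(j < m.+2) (-1) ^+ j *: rho (fun z => coface m.+1 j F (upd y m.+1 z))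
    = diffW m (contr m F) y.
  apply: eq_bigr => j _; congr (_ *: _); rewrite /coface /contr.
  have [j0|j0] := eqVneq (j : nat) 0%N.
    by rewrite -rho_l //; apply: Fl.
  have [jm|jm] := eqVneq (j : nat) m.+1.
    rewrite jm eqn_leq ltnn andbF /= -(@rho_r (y m) (fun z => F (upd y m z))).
      congr rho; apply: functional_extensionality => z; apply: Fe => t tm.
      by rewrite /face /upd; repeat case: ifP => //; intros; try (exfalso; lia);
        congr (_ * _); congr (y _); lia.
    exact: Fl.
  have -> : (j == m.+2 :> nat) = false by have := ltn_ord j; lia.
  congr rho; apply: functional_extensionality => z; apply: Fe => t tm.
  have := ltn_ord j; rewrite /face /upd => jm2.
  by repeat case: ifP => //; intros; try (exfalso; lia); (try congr (_ * _)); congr (y _); lia.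
move=> /esym/eqP; rewrite addrC addr_eq0 => /eqP E.
have := congr1 (fun w => (-1) ^+ m.+2 *: w) E.
rewrite scalerA -expr2 -exprM mulnC exprM sqrrN expr1n expr1n scale1r => ->.
by rewrite scalerN exprS mulN1r scaleNr opprK.
Qed.

End Contraction.
End Differential.
End Cochains.

Section FfunSpaces.
Variables (K : fieldType) (I : finType).

(* Behind an opaque proof so that [memv_ker] cannot see through [ffunv]. *)
Fact ffunv_subproof (W : vectType K) (Q : {vspace W}) :
  {X : {vspace {ffun I -> W}} | forall f, (f \in X) = [forall k, f k \in Q]}.
Proof.
have lin : linear (fun f : {ffun I -> W} => [ffun k => f k - projv Q (f k)]).
  move=> c g h; apply/ffunP => k; rewrite !ffunE linearP scalerBr.
  by rewrite opprD addrACA.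
exists (lker (linfun (fun f : {ffun I -> W} => [ffun k => f k - projv Q (f k)]))) => f.
rewrite memv_ker (linfun_lin lin); apply/eqP/forallP => [/ffunP fQ k|fQ].
  by have /eqP := fQ k; rewrite !ffunE subr_eq0 => /eqP ->; apply: memv_proj.
by apply/ffunP => k; rewrite !ffunE projv_id ?subrr.
Qed.

Definition ffunv (W : vectType K) (Q : {vspace W}) := sval (ffunv_subproof Q).

Lemma mem_ffunv (W : vectType K) (Q : {vspace W}) (f : {ffun I -> W}) :
  reflect (forall k, f k \in Q) (f \in ffunv Q).
Proof. by rewrite (svalP (ffunv_subproof Q)); apply: forallP. Qed.

Definition dhW (W W' : vectType K) (phi : 'Hom(W, W')) :
    'Hom({ffun I -> W}, {ffun I -> W'}) :=
  linfun (fun f : {ffun I -> W} => [ffun k => phi (f k)]).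

Lemma dhWE (W W' : vectType K) (phi : 'Hom(W, W')) (f : {ffun I -> W}) :
  dhW phi f = [ffun k => phi (f k)].
Proof.
rewrite linfun_lin // => c g h; apply/ffunP => k.
by rewrite !ffunE linearP.
Qed.

Lemma dhW_img (W W' : vectType K) (phi : 'Hom(W, W')) (Q : {vspace W}) (Q' : {vspace W'}) :
  (phi @: Q = Q')%VS -> (dhW phi @: ffunv Q = ffunv Q')%VS.
Proof.
move=> <-; apply/vspaceP => f; apply/memv_imgP/mem_ffunv => [[g /mem_ffunv gQ ->] k|fQ].
  by rewrite dhWE ffunE memv_img.
have fQ' k : exists w, (w \in Q) && (f k == phi w).
  by have /memv_imgP[w wQ ->] := fQ k; exists w; rewrite wQ eqxx.
exists [ffun k => xchoose (fQ' k)].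
  by apply/mem_ffunv => k; rewrite ffunE; have /andP[] := xchooseP (fQ' k).
by rewrite dhWE; apply/ffunP => k; rewrite !ffunE; have /andP[_ /eqP] := xchooseP (fQ' k).
Qed.

Lemma dhW_ker (W W' : vectType K) (phi : 'Hom(W, W')) (Q : {vspace W}) :
  (ffunv Q :&: lker (dhW phi) = ffunv (Q :&: lker phi))%VS.
Proof.
apply/vspaceP => f; rewrite memv_cap memv_ker dhWE.
apply/andP/mem_ffunv => [[/mem_ffunv fQ /eqP/ffunP f0] k|fQ].
  by rewrite memv_cap fQ memv_ker; have := f0 k; rewrite !ffunE => ->; rewrite eqxx.
split; first by apply/mem_ffunv => k; have /memv_capP[] := fQ k.
apply/eqP/ffunP => k; have /memv_capP[_] := fQ k.
by rewrite memv_ker !ffunE => /eqP.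
Qed.

End FfunSpaces.

(** * Hochschild cohomology from a coresolution by acyclic bimodules *)

Section CochainSpaces.
Variables (K : fieldType) (A : falgType K).
Local Notation Ib := 'I_(\dim {:A}).
Local Notation Ix m := {ffun 'I_m -> Ib}.
Local Notation Cn W m := {ffun Ix m -> W}.

Definition dvW (W : vectType K) (l r : A -> W -> W) m : 'Hom(Cn W m, Cn W m.+1) :=
  linfun (fun f : Cn W m => [ffun k : Ix m.+1 => diffW l r m (evW f) (bf k)]).

Lemma evW_linear (W : vectType K) m c (f g : Cn W m) :
  evW (c *: f + g) = fun y => c *: evW f y + evW g y.
Proof.
apply: functional_extensionality => y; rewrite /evW scaler_sumr -big_split.
apply: eq_bigr => k _ /=; rewrite !ffunE scalerDr !scalerA; congr (_ *: _ + _).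
by rewrite mulrC.
Qed.

Lemma evW_mem (W : vectType K) m (Q : {vspace W}) (f : Cn W m) y :
  f \in ffunv _ Q -> evW f y \in Q.
Proof. by move=> /mem_ffunv fQ; apply: memv_suml => k _; apply: memvZ. Qed.

Lemma evW_dhW (W W' : vectType K) m (phi : 'Hom(W, W')) (f : Cn W m) y :
  evW (dhW _ phi f) y = phi (evW f y).
Proof.
rewrite /evW linear_sum; apply: eq_bigr => k _.
by rewrite linearZ dhWE ffunE.
Qed.

Section Bimodule.
Variables (W : vectType K) (l r : A -> W -> W).
Hypothesis bm : bimod l r.

Lemma dvWE m (f : Cn W m) : dvW l r m f = [ffun k => diffW l r m (evW f) (bf k)].
Proof.
rewrite linfun_lin // => c g h; apply/ffunP => k.
by rewrite !ffunE evW_linear (diffW_linear bm).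
Qed.

Lemma evW_dvW m (f : Cn W m) : evW (dvW l r m f) = diffW l r m (evW f).
Proof. by rewrite dvWE multilin_ev //; apply: (diffW_multilin bm); apply: evW_multilin. Qed.

Lemma dvW_eq0 m (f : Cn W m) : dvW l r m f = 0 <-> forall y, diffW l r m (evW f) y = 0.
Proof.
split=> [f0 y|f0]; last by rewrite dvWE; apply/ffunP => k; rewrite !ffunE f0.
by rewrite -evW_dvW f0 /evW big1 // => k _; rewrite ffunE scaler0.
Qed.

Lemma dvW_dvW m (f : Cn W m) : dvW l r m.+1 (dvW l r m f) = 0.
Proof.
by apply/dvW_eq0 => y; rewrite evW_dvW (diffW_diffW bm) //; apply: evW_multilin.
Qed.

Lemma diffW_mem m (Q : {vspace W}) F y :
    (forall a w, w \in Q -> l a w \in Q) -> (forall a w, w \in Q -> r a w \in Q) ->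
  (forall x, F x \in Q) -> diffW l r m F y \in Q.
Proof.
move=> lQ rQ FQ; apply: memv_suml => j _; apply: memvZ.
by rewrite /coface; case: ifP => _; [apply: lQ|case: ifP => _; [apply: rQ|]].
Qed.

Lemma dvW_exact (Q : {vspace W}) (rho : (A -> W) -> W) m :
    (forall a w, w \in Q -> l a w \in Q) -> (forall a w, w \in Q -> r a w \in Q) ->
    (forall c G1 G2, linear G1 -> linear G2 ->
       rho (fun z => c *: G1 z + G2 z) = c *: rho G1 + rho G2) ->
    (forall a G, linear G -> rho (fun z => l a (G z)) = l a (rho G)) ->
    (forall a G, linear G -> rho (fun z => G (a * z)) = r a (rho G)) ->
    (forall w, w \in Q -> rho (fun z => r z w) = w) ->
    (forall G, linear G -> (forall z, G z \in Q) -> rho G \in Q) ->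
  (ffunv (Ix m.+1) Q :&: lker (dvW l r m.+1) = dvW l r m @: ffunv (Ix m) Q)%VS.
Proof.
move=> lQ rQ rho_lin rho_l rho_r rho_id rho_Q.
apply/vspaceP => f; rewrite memv_cap memv_ker.
apply/andP/memv_imgP => [[fQ /eqP/dvW_eq0 df]|[g gQ ->]].
  have FQ y : evW f y \in Q by apply: evW_mem.
  have mF := evW_multilin f.
  have E := contrP bm rho_lin rho_l rho_r rho_id mF FQ df.
  have mH := contr_multilin rho_lin mF.
  exists ((-1) ^+ m.+1 *: [ffun k => contr rho m (evW f) (bf k)]).
    apply: memvZ; apply/mem_ffunv => k; rewrite ffunE; apply: rho_Q => // c a b.
    by have [_ Fl] := mF; apply: Fl.
  rewrite linearZ /= dvWE (multilin_ev mH); apply/ffunP => k.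
  by rewrite !ffunE -E evW_bf.
rewrite dvW_dvW eqxx; split=> //; apply/mem_ffunv => k; rewrite dvWE ffunE.
by apply: diffW_mem => // x; apply: evW_mem.
Qed.

End Bimodule.

Lemma dhW_dvW (W W' : vectType K) (l r : A -> W -> W) (l' r' : A -> W' -> W')
    (phi : 'Hom(W, W')) (Q : {vspace W}) m f :
    bimod l r -> bimod l' r' ->
    (forall a w, w \in Q -> phi (l a w) = l' a (phi w)) ->
    (forall a w, w \in Q -> phi (r a w) = r' a (phi w)) ->
  f \in ffunv (Ix m) Q -> dhW _ phi (dvW l r m f) = dvW l' r' m (dhW _ phi f).
Proof.
move=> bm bm' phil phir fQ; rewrite dhWE !dvWE //; apply/ffunP => k.
rewrite !ffunE linear_sum; apply: eq_bigr => j _; rewrite linearZ; congr (_ *: _).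
rewrite /coface; case: ifP => _; first by rewrite /= phil ?evW_mem // evW_dhW.
by case: ifP => _; rewrite /= ?phir ?evW_mem // evW_dhW.
Qed.

Lemma bimod_reg : bimod (fun a x : A => a * x) (fun a x => x * a).
Proof.
split=> [a c u v|w c u v|a c u v|w c u v|a b w|a b w|a b w] /=.
- by rewrite mulrDr scalerAr.
- by rewrite mulrDl scalerAl.
- by rewrite mulrDl scalerAl.
- by rewrite mulrDr scalerAr.
- by rewrite mulrA.
- by rewrite mulrA.
- by rewrite mulrA.
Qed.

Lemma cbdE m : cbd (A := A) (i := m) =1 dvW (fun a x : A => a * x) (fun a x => x * a) m.
Proof.
move=> f; rewrite (dvWE bimod_reg); apply/ffunP => k; rewrite !ffunE /diffW.
rewrite big_ord_recl big_ord_recr /= expr0 scale1r addrA; congr (_ + _ + _).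
  by apply: eq_bigr => j _; rewrite /coface /bump /= add1n eqSS (ltn_eqF (ltn_ord j)).
by rewrite /coface /bump /= add1n eqxx.
Qed.

Lemma cbdLE m : cbdL A m = dvW (fun a x : A => a * x) (fun a x => x * a) m.
Proof.
apply/lfunP => f; rewrite linfun_lin ?cbdE // => c g h.
by rewrite !cbdE linearP.
Qed.

Section Coresolution.
Variables (W : vectType K) (l : A -> W -> W) (r : nat -> A -> W -> W).
Variables (Q Inv : nat -> {vspace W}) (phi : nat -> 'End(W)) (iota : 'Hom(A, W)).
Variable rho : nat -> (A -> W) -> W.
Hypothesis bm : forall k, bimod l (r k).
Hypothesis lQ : forall k a w, w \in Q k -> l a w \in Q k.
Hypothesis rQ : forall k a w, w \in Q k -> r k a w \in Q k.
Hypothesis phi_l : forall k a w, w \in Q k -> phi k (l a w) = l a (phi k w).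
Hypothesis phi_r : forall k a w, w \in Q k -> phi k (r k a w) = r k.+1 a (phi k w).
Hypothesis exactQ : forall k, (Q k.+1 :&: lker (phi k.+1) = phi k @: Q k)%VS.
Hypothesis iota_inj : injective iota.
Hypothesis iota_l : forall a x, iota (a * x) = l a (iota x).
Hypothesis iota_r : forall a x, iota (x * a) = r 0 a (iota x).
Hypothesis exact0 : (Q 0 :&: lker (phi 0) = limg iota)%VS.
Hypothesis rho_lin : forall k c G1 G2, linear G1 -> linear G2 ->
  rho k (fun z => c *: G1 z + G2 z) = c *: rho k G1 + rho k G2.
Hypothesis rho_l : forall k a G, linear G -> rho k (fun z => l a (G z)) = l a (rho k G).
Hypothesis rho_r : forall k a G, linear G -> rho k (fun z => G (a * z)) = r k a (rho k G).
Hypothesis rho_id : forall k w, w \in Q k -> rho k (fun z => r k z w) = w.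
Hypothesis rho_Q : forall k G, linear G -> (forall z, G z \in Q k) -> rho k G \in Q k.
Hypothesis InvP : forall k w,
  reflect (w \in Q k /\ forall a, l a w = r k a w) (w \in Inv k).

Let X m k := ffunv (Ix m) (Q k).
Let dv m k := dvW l (r k) m.
Let dh m k := dhW (Ix m) (phi k).

Let k0 : Ix 0 := ffun0 (card_ord 0).

Lemma ev0_linear : linear (fun f : Cn W 0 => f k0).
Proof. by move=> c f g; rewrite !ffunE. Qed.
Let ev0 : 'Hom(Cn W 0, W) := linfun (fun f : Cn W 0 => f k0).

Lemma ev0E f : ev0 f = f k0.
Proof. exact: linfun_lin ev0_linear f. Qed.

Lemma Ix0E (k : Ix 0) : k = k0.
Proof. by apply/ffunP => -[]. Qed.

Lemma evW0 (f : Cn W 0) y : evW f y = f k0.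
Proof.
rewrite /evW (bigD1 k0) //= big_ord0 scale1r big1 ?addr0 // => k.
by rewrite [k]Ix0E eqxx.
Qed.

Lemma ev0_ker : lker ev0 == 0%VS.
Proof.
by apply/lker0P => f g; rewrite !ev0E => fg; apply/ffunP => k; rewrite [k]Ix0E.
Qed.

Lemma ev0_inv k : (ev0 @: (X 0 k :&: lker (dv 0 k)) = Inv k)%VS.
Proof.
have kerP f : (dv 0 k f == 0) <-> forall a, l a (f k0) = r k a (f k0).
  split=> [/eqP/(dvW_eq0 (bm k)) df a|fa].
    have := df (fun=> a); rewrite /diffW 2!big_ord_recl big_ord0 addr0 /coface /=.
    by rewrite !evW0 expr0 scale1r expr1 scaleN1r => /eqP; rewrite subr_eq0 => /eqP.
  apply/eqP/(dvW_eq0 (bm k)) => y; rewrite /diffW 2!big_ord_recl big_ord0 addr0.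
  by rewrite /coface /= !evW0 expr0 scale1r expr1 scaleN1r fa subrr.
apply/vspaceP => w; apply/memv_imgP/InvP => [[f /memv_capP[/mem_ffunv fQ]]|[wQ wa]].
  by rewrite memv_ker => /kerP fa ->; rewrite ev0E.
exists [ffun=> w]; last by rewrite ev0E ffunE.
rewrite memv_cap memv_ker; apply/andP; split.
  by apply/mem_ffunv => i; rewrite ffunE.
by apply/kerP => a; rewrite ffunE.
Qed.

(** The double complex of m-cochains with values in [Q k]: [rho] makes the columns exact, [exactQ]
    the rows. At m = 0 the kernel of [dv] is [Inv k]. All the [Q k] lie in one space with one left
    action; only the right action varies with k, to allow for a twist. *)
Lemma dimHH_coh_coresolution :
  dimHH_coh A 0 = \dim (Inv 0 :&: lker (phi 0)) /\
  forall i, dimHH_coh A i.+1 =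
    (\dim (Inv i.+1 :&: lker (phi i.+1)) - \dim (phi i @: Inv i))%N.
Proof.
have commX m k f : f \in X m k -> dh m.+1 k (dv m k f) = dv m k.+1 (dh m k f).
  by move=> fX; apply: (dhW_dvW (bm k) (bm k.+1) (phi_l (k := k)) (phi_r (k := k))).
have rowsX m k : (X m k.+1 :&: lker (dh m k.+1) = dh m k @: X m k)%VS.
  by rewrite dhW_ker; apply/esym/dhW_img; rewrite exactQ.
have colsX m k : (X m.+1 k :&: lker (dv m.+1 k) = dv m k @: X m k)%VS.
  exact: (dvW_exact (bm k) m (lQ (k := k)) (rQ (k := k)) (rho_lin k) (rho_l k) (rho_r k)
    (rho_id (k := k)) (rho_Q (k := k))).
have dims0 k : \dim (X 0 k :&: lker (dv 0 k) :&: lker (dh 0 k)) =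
    \dim (Inv k :&: lker (phi k)).
  rewrite -[LHS](@limg_dim_eq _ _ _ ev0) ?(eqP ev0_ker) ?capv0 //; congr (\dim _).
  apply/vspaceP => w; rewrite memv_cap memv_ker -ev0_inv; apply/memv_imgP/andP.
    move=> [f /memv_capP[fX]]; rewrite memv_ker dhWE => /eqP/ffunP/(_ k0).
    by rewrite !ffunE => f0 ->; rewrite memv_img // ev0E f0 eqxx.
  move=> [/memv_imgP[f fX ->]] /eqP f0; exists f => //.
  rewrite memv_cap fX memv_ker dhWE; apply/eqP/ffunP => i.
  by rewrite !ffunE [i]Ix0E -ev0E.
have dims1 k : \dim (dh 0 k @: (X 0 k :&: lker (dv 0 k))) = \dim (phi k @: Inv k).
  rewrite -[LHS](@limg_dim_eq _ _ _ ev0) ?(eqP ev0_ker) ?capv0 //; congr (\dim _).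
  rewrite -limg_comp -ev0_inv -limg_comp; apply: eq_in_limg => f _.
  by rewrite !comp_lfunE !ev0E dhWE ffunE.
(* The other edge: [iota] carries the Hochschild complex of A onto the kernel of [dh] at k = 0. *)
have I_ker m : lker (dhW (Ix m) iota) == 0%VS.
  apply/lker0P => f g; rewrite !dhWE => /ffunP fg; apply/ffunP => k.
  by apply: iota_inj; have := fg k; rewrite !ffunE.
have I_img m : (X m 0 :&: lker (dh m 0) = limg (dhW (Ix m) iota))%VS.
  rewrite dhW_ker exact0 -(dhW_img (Ix m) (erefl (limg iota))); congr (_ @: _)%VS.
  by apply/vspaceP => f; rewrite memvf; apply/mem_ffunv => k; apply: memvf.
have I_comm m f : dhW (Ix m.+1) iota (cbdL A m f) = dv m 0 (dhW (Ix m) iota f).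
  rewrite cbdLE; apply: (dhW_dvW (Q := fullv)) => //; first exact: bimod_reg.
  by apply/mem_ffunv => k; apply: memvf.
have dimsF m : \dim (X m 0 :&: lker (dh m 0) :&: lker (dv m 0)) = \dim (lker (cbdL A m)).
  rewrite I_img -[RHS](@limg_dim_eq _ _ _ (dhW (Ix m) iota)) ?(eqP (I_ker _)) ?capv0 //.
  congr (\dim _); apply/vspaceP => f; rewrite memv_cap memv_ker; apply/andP/memv_imgP.
    move=> [/memv_imgP[g _ ->]]; rewrite -I_comm => g0; exists g => //.
    by rewrite memv_ker -(inj_eq (lker0P (I_ker m.+1))) linear0.
  move=> [g]; rewrite memv_ker => /eqP g0 ->; rewrite memv_img ?memvf //.
  by rewrite -I_comm g0 linear0.
have dimsF' m : \dim (dv m 0 @: (X m 0 :&: lker (dh m 0))) = \dim (limg (cbdL A m)).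
  rewrite I_img -[RHS](@limg_dim_eq _ _ _ (dhW (Ix m.+1) iota)) ?(eqP (I_ker _)) ?capv0 //.
  rewrite -!limg_comp; congr (\dim _); apply: eq_in_limg => f _.
  by rewrite !comp_lfunE I_comm.
split=> [|i].
  rewrite -dims0 [LHS]/= -dimsF -!capvA; congr (\dim (_ :&: _)).
  exact: capvC.
rewrite -dims0 -dims1.
by rewrite (double_complex_edges commX rowsX colsX) dimsF dimsF'.
Qed.

End Coresolution.
End CochainSpaces.

(** * Duality between homology and cohomology of a symmetric algebra *)

Section Duality.
Variables (K : fieldType) (A : falgType K) (phi : A -> K).
Hypothesis phi_lin : scalar phi.
Hypothesis phiC : forall x y, phi (x * y) = phi (y * x).
Hypothesis phi_nd : forall x, (forall y, phi (x * y) = 0) -> x = 0.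
Local Notation Ib := 'I_(\dim {:A}).
Local Notation Ix m := {ffun 'I_m -> Ib}.
Local Notation Tn m := {ffun Ix m -> K^o}.
Local Notation Cn m := {ffun Ix m -> A}.

Let phiL : {scalar A} :=
  HB.pack phi (GRing.isLinear.Build K A K^o *%R phi phi_lin).

(** The form identifies A with its dual, so a_0 (x) ... (x) a_m pairs with a cochain [f] to phi(a_0
    f(a_1, ..., a_m)). *)
Definition hpair m (t : Tn m.+1) (f : Cn m) : K :=
  \sum_(k : Ix m.+1) t k * phi (bf k 0%N * evW f (shift (bf k))).

Lemma hpair_linl m f : scalar (fun t : Tn m.+1 => hpair t f).
Proof.
move=> c t u; rewrite /hpair mulr_sumr -big_split; apply: eq_bigr => k _ /=.
by rewrite !ffunE mulrDl -mulrA.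
Qed.

Lemma hpair_linr m (t : Tn m.+1) : scalar (hpair t).
Proof.
move=> c f g; rewrite /hpair mulr_sumr -big_split; apply: eq_bigr => k _ /=.
by rewrite evW_linear mulrDr -scalerAr phi_lin mulrDr mulrCA.
Qed.

Lemma hpair_tens m (f : Cn m) y : hpair (tens m.+1 y) f = phi (y 0%N * evW f (shift y)).
Proof.
have [ext lin] := coface_multilin (bimod_reg A) (isT : 0 < m.+2)%N (evW_multilin f).
have mF : multilin m.+1 (fun y => phi (y 0%N * evW f (shift y)) : K^o).
  split=> [z z' zz'|z j jm c u v]; first by congr phi; apply: ext.
  rewrite -[RHS]/(c * _ + _) -phi_lin; congr phi; exact: lin.
rewrite -[RHS](congr1 (fun F => F y) (multilin_ev mF)).
by apply: eq_bigr => k _; rewrite !ffunE.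
Qed.

Lemma hbd_linear m : linear (@hbd K A m).
Proof.
move=> c f g; rewrite /hbd scaler_sumr -big_split; apply: eq_bigr => k _ /=.
by rewrite !ffunE scalerDl scalerA.
Qed.

(** Faces match cofaces one by one; the cyclic face matches the last coface, which multiplies on the
    right, because [phi] is a trace form. *)
Lemma hpair_adjoint m (t : Tn m.+2) (f : Cn m) :
  hpair (hbdL A m t) f = hpair t (cbdL A m f).
Proof.
rewrite (linfun_lin (@hbd_linear m)) /hbd.
pose B : {scalar Tn m.+1} :=
  HB.pack (fun t => hpair t f) (GRing.isLinear.Build K (Tn m.+1) K^o *%R _ (hpair_linl f)).
rewrite -[LHS]/(B _) linear_sum; apply: eq_bigr => k _.
rewrite linearZ /=; congr (_ * _); set x := bf k.
rewrite cbdLE (evW_dvW (bimod_reg A)) /diffW mulr_sumr.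
rewrite -[LHS]/(B _) -[RHS]/(phiL _) linearD !linear_sum [RHS]big_ord_recr /=; congr (_ + _).
  apply: eq_bigr => j _; rewrite -scalerAr -[LHS]/(B _) -[RHS]/(phiL _) !linearZ /= hpair_tens.
  congr (_ * phi _); rewrite /coface; have [j0|j0] := eqVneq (j : nat) 0%N.
    rewrite j0 /face /= /shift mulrA; congr (_ * evW _ _).
  rewrite (ltn_eqF (ltn_ord j)) {1}/face lt0n j0; congr (_ * evW _ _).
  apply: functional_extensionality => i; rewrite /shift /face.
  by repeat case: ifP => //; intros; try (exfalso; lia); try congr (_ * _); congr (x _); lia.
rewrite -scalerAr -[LHS]/(B _) -[RHS]/(phiL _) !linearZ /= hpair_tens; congr (_ * _).
rewrite /coface /= eqxx mulrA [RHS]phiC mulrA; congr phi.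
Qed.

Definition fcons m (i : Ib) (k : Ix m) : Ix m.+1 :=
  [ffun j => if unlift ord0 j is Some j' then k j' else i].
Definition fbehead m (k : Ix m.+1) : Ix m := [ffun j => k (lift ord0 j)].

Lemma fconsK m (k : Ix m.+1) : fcons (k ord0) (fbehead k) = k.
Proof. by apply/ffunP => j; rewrite !ffunE; case: unliftP => [j'|] ->; rewrite ?ffunE. Qed.

Lemma fbehead_cons m i (k : Ix m) : fbehead (fcons i k) = k.
Proof. by apply/ffunP => j; rewrite !ffunE liftK. Qed.

Lemma fcons0 m i (k : Ix m) : fcons i k ord0 = i.
Proof. by rewrite ffunE unlift_none. Qed.

Lemma evW_shift m (f : Cn m) (k : Ix m.+1) : evW f (shift (bf k)) = f (fbehead k).
Proof.
rewrite -evW_bf; have [ext _] := evW_multilin f; apply: ext => t tm.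
rewrite (bf_ord (fbehead k) (Ordinal tm)) ffunE /shift.
by rewrite -(bf_ord k (lift ord0 (Ordinal tm))).
Qed.

Lemma bf0 m (k : Ix m.+1) : bf k 0%N = (bA A)`_(k ord0).
Proof. by rewrite (bf_ord k ord0) (tnth_nth 0). Qed.

Lemma hpair_delta m (h : Cn m) k :
  hpair [ffun k' => (k' == k)%:R : K^o] h = phi ((bA A)`_(k ord0) * h (fbehead k)).
Proof.
rewrite /hpair (bigD1 k) //= ffunE eqxx mul1r big1 ?addr0 => [|k' /negbTE nk].
  by rewrite bf0 evW_shift.
by rewrite ffunE nk mul0r.
Qed.

Lemma phi_basis_eq0 (x : A) : (forall i : Ib, phi ((bA A)`_i * x) = 0) -> x = 0.
Proof.
move=> x0; apply: phi_nd => y; rewrite phiC (coord_vbasis (memvf y)) mulr_suml.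
rewrite -[LHS]/(phiL _) linear_sum big1 // => i _.
by rewrite -scalerAl linearZ /= x0 mulr0.
Qed.

(** The map sending x to its pairings with the basis is injective between spaces of equal dimension,
    hence onto. *)
Lemma dual_basis_exists (i : Ib) : exists x, forall j : Ib, phi ((bA A)`_j * x) = (j == i)%:R.
Proof.
pose P (x : A) : {ffun Ib -> K^o} := [ffun j : Ib => phi ((bA A)`_j * x)].
have linP : linear P.
  by move=> c x y; apply/ffunP => j; rewrite !ffunE mulrDr -scalerAr phi_lin.
have kP : lker (linfun P) == 0%VS.
  apply/eqP/vspaceP => x; rewrite memv_ker memv0 (linfun_lin linP).
  apply/eqP/eqP => [/ffunP x0|->].
    by apply: phi_basis_eq0 => j; have := x0 j; rewrite !ffunE.
  by rewrite -(linfun_lin linP) linear0.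
have : limg (linfun P) == fullv.
  rewrite -(geq_leqif (dimv_leqif_eq (subvf _))) limg_dim_eq ?(eqP kP) ?capv0 //.
  by rewrite dim_ffun card_ord [X in (_ * X)%N]dimvf muln1.
move=> /eqP/vspaceP/(_ [ffun j => (j == i)%:R : K^o]); rewrite memvf.
move=> /memv_imgP[x _]; rewrite (linfun_lin linP) => /ffunP Px.
by exists x => j; have := Px j; rewrite !ffunE => <-.
Qed.

Lemma hpair_ndl m (t : Tn m.+1) : (forall f, hpair t f = 0) -> t = 0.
Proof.
move=> t0; apply/ffunP => k; rewrite [RHS]ffunE.
have [x xE] := dual_basis_exists (k ord0).
have := t0 [ffun k' => (k' == fbehead k)%:R *: x].
rewrite /hpair (bigD1 k) //= evW_shift ffunE eqxx scale1r bf0 xE eqxx mulr1.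
rewrite big1 => [|k' nk]; first by rewrite addr0.
rewrite evW_shift ffunE bf0 -scalerAr.
rewrite -[phi _]/(phiL _) linearZ /= xE -natrM mulnb.
suff -> : (fbehead k' == fbehead k) && (k' ord0 == k ord0) = false by rewrite mulr0.
apply/negP => /andP[/eqP kb /eqP k0]; case/eqP: nk.
by rewrite -[k]fconsK -[k']fconsK kb k0.
Qed.

Lemma hpair_ndr m (f : Cn m) : (forall t, hpair t f = 0) -> f = 0.
Proof.
move=> f0; apply/ffunP => k; rewrite [RHS]ffunE; apply: phi_basis_eq0 => i.
by have := f0 [ffun k' => (k' == fcons i k)%:R : K^o];
  rewrite hpair_delta fcons0 fbehead_cons.
Qed.

Lemma rank_hbdL m : \dim (limg (hbdL A m)) = \dim (limg (cbdL A m)).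
Proof.
apply/eqP; rewrite eqn_leq; apply/andP; split.
  apply: (rank_adj_le (B := @hpair m) (B' := @hpair m.+1)).
  - exact: hpair_linl.
  - by move=> x y _ _; apply: hpair_adjoint.
  - exact: hpair_linr.
  by move=> x _ x0; apply: hpair_ndl => f; apply: x0; apply: memvf.
apply: (rank_adj_le (B := fun f t => @hpair m.+1 t f) (B' := fun f t => @hpair m t f)).
- exact: hpair_linr.
- by move=> x y _ _; rewrite hpair_adjoint.
- exact: hpair_linl.
by move=> x _ x0; apply: hpair_ndr => t; apply: x0; apply: memvf.
Qed.

(** [hbdL m] and [cbdL m] have equal ranks and connect spaces of the same two dimensions in opposite
    directions, so kernel minus image agrees in each degree. *)
Theorem dimHH_hom_coh i : dimHH_hom A i = dimHH_coh A i.
Proof.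
have dimC m : \dim {:Tn m.+1} = \dim {:Cn m}.
  by rewrite !dim_ffun !card_ffun !card_ord [\dim {:K^o}]dimvf muln1 expnSr.
case: i => [|i] /=.
  have arith (d k r : nat) : (k + r = d)%N -> (d - r = k)%N by lia.
  have := limg_ker_dim (cbdL A 0) fullv; rewrite capfv -dimC -rank_hbdL.
  exact: arith.
have arith (d k k' r r' : nat) : (k + r = d)%N -> (k' + r' = d)%N -> (k - r' = k' - r)%N by lia.
have kh := limg_ker_dim (hbdL A i) fullv; have kc := limg_ker_dim (cbdL A i.+1) fullv.
rewrite capfv dimC in kh; rewrite capfv -rank_hbdL in kc.
by rewrite -rank_hbdL; exact: arith kh kc.
Qed.

End Duality.

(** * The algebra P(L_n) along its double cover *)

Section Strip.
Variables (R : pzRingType) (n : nat) (E U : nat -> R).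
Local Notation N := (n + n)%N.
Local Notation V c := (U (N.-1 - c)%N).

(* P(L_n) unfolded along the double cover A_2n -> L_n: the vertices
   c < 2n are identified in pairs c ~ 2n-1-c, vertex i+1 of L_n being
   {n+i, n-1-i}; U c goes from c to c+1 and V c = U (2n-1-c) from c to c-1.
   In these terms every relation says that U and V commute. *)
Record strip_rels : Prop := StripRels {
  strip_sum : \sum_(i < n) E (n + i)%N = 1;
  strip_flip : forall c, (c < N)%N -> E (N.-1 - c)%N = E c;
  strip_mul : forall c d, (c < N)%N -> (d < N)%N ->
    E c * E d = if (d == c) || (d == N.-1 - c)%N then E c else 0;
  strip_arrow : forall c, (c.+1 < N)%N -> U c = E c * U c * E c.+1;
  strip_out : forall c, (N.-1 <= c)%N -> U c = 0;
  strip_comm : forall c, (0 < c < N)%N -> U c * V c.+1 = V c * U c.-1 }.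

Definition T c u v : R :=
  E c * (\prod_(k < u) U (c + k)%N) * (\prod_(k < v) V (c + u - k)%N).

Hypothesis sr : strip_rels.

Lemma T00 c : T c 0 0 = E c.
Proof. by rewrite /T !big_ord0 !mulr1. Qed.

Lemma TSv c u v : T c u v.+1 = T c u v * V (c + u - v).
Proof. by rewrite /T big_ord_recr /= mulrA. Qed.

Lemma TSu0 c u : T c u.+1 0 = T c u 0 * U (c + u)%N.
Proof. by rewrite /T !big_ord0 !mulr1 big_ord_recr /= mulrA. Qed.

Lemma T_oob_u c u v : (c < N)%N -> (N <= c + u)%N -> T c u v = 0.
Proof.
move=> cN; elim: v => [|v IH] uN; last by rewrite TSv IH // mul0r.
elim: u uN => [|u IHu] uN; first lia.
have [uN'|uN'] := leqP N (c + u)%N; rewrite TSu0; first by rewrite IHu // mul0r.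
by rewrite (strip_out sr) ?mulr0 //; lia.
Qed.

(** The commutation relation carries the appended up step to the left past all down steps. *)
Lemma TU_le c u v : (c < N)%N -> (v <= c + u)%N -> T c u v * U (c + u - v)%N = T c u.+1 v.
Proof.
move=> cN; elim: v => [|v IH] vu; first by rewrite subn0 TSu0.
have [uN|uN] := leqP N (c + u)%N; first by rewrite !T_oob_u ?mul0r //; lia.
rewrite TSv TSv -mulrA.
have -> : (c + u - v.+1 = (c + u - v).-1)%N by lia.
rewrite -(strip_comm sr); last by lia.
by rewrite mulrA IH 1?ltnW //; congr (_ * U _); lia.
Qed.

Lemma V_zero_out : V 0 = 0.
Proof. by rewrite (strip_out sr) //; lia. Qed.

Lemma UV_zero : (0 < n)%N -> U 0%N * V 1 = 0.
Proof.
move=> n0; have := strip_comm sr (c := N.-1).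
have -> : (N.-1 - N.-1 = 0)%N by lia.
have -> : (N.-1.-1 = N.-1 - 1)%N by lia.
by move=> <-; [rewrite (strip_out sr) ?mul0r|lia].
Qed.

(** The path leaves the strip at the bottom. It suffices to take v = c+1: for u = 0 the path ends
    with [V 0], for u = 1 it contains U_0 V_1, and beyond that it is a vanishing path followed by an
    up step. *)
Lemma T_oob_v c u v : (c < N)%N -> (c < v)%N -> T c u v = 0.
Proof.
move=> cN; elim: v => // v IH cv.
have [vc|vc] := ltnP c v; first by rewrite TSv IH // mul0r.
have {vc cv IH} -> : v = c by lia.
elim: u => [|u IH].
  by rewrite TSv addn0 subnn V_zero_out mulr0.
case: u IH => [|u] IH; last first.
  by rewrite -TU_le //; [rewrite IH mul0r|lia].
rewrite TSv -TU_le //; last by lia.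
by rewrite addn0 addn1 subnn subSnn -mulrA UV_zero ?mulr0 //; lia.
Qed.

Lemma TU c u v : (c < N)%N -> T c u v * U (c + u - v)%N = T c u.+1 v.
Proof.
move=> cN; have [vu|vu] := leqP v (c + u)%N; first exact: TU_le.
by rewrite !T_oob_v ?mul0r //; lia.
Qed.

Lemma T_nz_range c u v : (c < N)%N -> T c u v != 0 -> (c + u < N)%N && (v <= c)%N.
Proof.
move=> cN; apply: contraR; rewrite negb_and -leqNgt -ltnNge => /orP[uN|vc].
  by rewrite T_oob_u.
by rewrite T_oob_v.
Qed.

(** The two lifts of one path of L_n to the strip: c |-> 2n-1-c exchanges up and down steps. *)
Lemma T_flip c u v : (c < N)%N -> (u <= N.-1 - c)%N -> (v <= c)%N ->
  T (N.-1 - c) v u = T c u v.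
Proof.
move=> cN uc vc; elim: u uc => [|u IH] uc.
  rewrite /T !big_ord0 !mulr1 (strip_flip sr) //; congr (_ * _).
  by apply: eq_bigr => k _; congr (U _); have := ltn_ord k; lia.
rewrite TSv IH ?(ltnW uc) // -TU //; congr (_ * U _); lia.
Qed.

Lemma E_idem c : (c < N)%N -> E c * E c = E c.
Proof. by move=> cN; rewrite (strip_mul sr) // eqxx. Qed.

Lemma ET c u v : (c < N)%N -> E c * T c u v = T c u v.
Proof. by move=> cN; rewrite /T !mulrA E_idem. Qed.

Lemma U_El c : (c < N)%N -> E c * U c = U c.
Proof.
move=> cN; have [cN'|cN'] := ltnP c.+1 N.
  by rewrite (strip_arrow sr cN') !mulrA E_idem.
by rewrite (strip_out sr) ?mulr0 //; lia.
Qed.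

Lemma U_Er c : (c.+1 < N)%N -> U c * E c.+1 = U c.
Proof. by move=> cN'; rewrite (strip_arrow sr cN') -!mulrA E_idem. Qed.

Lemma V_Er d : (0 < d < N)%N -> V d * E d.-1 = V d.
Proof.
move=> dN; rewrite -(strip_flip sr); last lia.
have -> : (N.-1 - d.-1 = (N.-1 - d).+1)%N by lia.
by rewrite U_Er //; lia.
Qed.

Lemma TE c u v : (c + u < N)%N -> (v <= c)%N -> T c u v * E (c + u - v)%N = T c u v.
Proof.
move=> uN; elim: v => [|v IH] vc.
  elim: u uN => [|u IHu] uN; first by rewrite T00 !addn0 subn0 E_idem //; lia.
  by rewrite TSu0 -mulrA subn0 addnS U_Er //; lia.
rewrite TSv -mulrA; have -> : (c + u - v.+1 = (c + u - v).-1)%N by lia.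
by rewrite V_Er //; lia.
Qed.

Lemma TE_if c u v d : (c + u < N)%N -> (v <= c)%N -> (d < N)%N ->
  T c u v * E d = if (d == c + u - v)%N || (d == N.-1 - (c + u - v))%N then T c u v else 0.
Proof.
move=> uN vc dN; rewrite -{1}TE // -mulrA (strip_mul sr) //; last lia.
by case: ifP => _; rewrite ?TE // mulr0.
Qed.

Lemma UT c u v : (c.+1 < N)%N -> U c * T c.+1 u v = T c u.+1 v.
Proof.
move=> cN; rewrite /T !mulrA U_Er // big_ord_recl addn0 !mulrA U_El; last lia.
congr (_ * _ * _); first by apply: eq_bigr => k _; rewrite lift0 addSnnS.
by apply: eq_bigr => k _; rewrite addSnnS.
Qed.

Lemma VT c u v : (c.+1 < N)%N -> V c.+1 * T c u v = T c.+1 u v.+1.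
Proof.
move=> cN; have [uc|uc] := leqP N (c + u)%N.
  by rewrite !T_oob_u ?mulr0 //; lia.
have [vc|vc] := ltnP c v; first by rewrite !T_oob_v ?mulr0 //; lia.
rewrite -T_flip //; try lia.
have -> : (N.-1 - c = (N.-1 - c.+1).+1)%N by lia.
rewrite UT; last lia.
have [uc'|uc'] := leqP N (c.+1 + u)%N; last by rewrite T_flip //; lia.
by rewrite [RHS]T_oob_u // T_oob_v //; lia.
Qed.

Lemma T_mul c u v u' v' : (c + u < N)%N -> (v <= c)%N ->
  T c u v * T (c + u - v) u' v' = T c (u + u') (v + v').
Proof.
move=> uN vc; elim: v' => [|v' IH].
  elim: u' => [|u' IHu]; first by rewrite T00 TE // !addn0.
  rewrite TSu0 mulrA IHu !addnS addn0 -TU; last lia.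
  by congr (_ * U _); lia.
by rewrite TSv mulrA IH !addnS TSv; congr (_ * U _); lia.
Qed.

(** The second factor starts at the other name of the endpoint of the first; flipping it, which
    swaps u' and v', reduces to [T_mul]. *)
Lemma T_mul_flip c u v u' v' : (c + u < N)%N -> (v <= c)%N ->
  T c u v * T (N.-1 - (c + u - v)) u' v' = T c (u + v') (v + u').
Proof.
move=> uN vc; set d := (c + u - v)%N.
have [ud|ud] := ltnP d u'.
  by rewrite (@T_oob_v c (u + v')) ?(@T_oob_u (N.-1 - d) u') ?mulr0 //; lia.
have [vd|vd] := ltnP (N.-1 - d)%N v'.
  by rewrite (@T_oob_u c (u + v')) ?(@T_oob_v (N.-1 - d) u') ?mulr0 //; lia.
by rewrite T_flip ?T_mul //; lia.
Qed.

Lemma T_mul0 c u v d u' v' : (c + u < N)%N -> (v <= c)%N -> (d < N)%N ->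
  d != (c + u - v)%N -> d != (N.-1 - (c + u - v))%N -> T c u v * T d u' v' = 0.
Proof.
move=> uN vc dN d1 d2; rewrite -(ET _ _ dN) mulrA TE_if //.
by rewrite (negbTE d1) (negbTE d2) mul0r.
Qed.

End Strip.

(** * Translation between the relations of L_n and commutation on the strip *)

Section PLStrip.
Variables (R : pzRingType) (n : nat).
Local Notation N := (n + n)%N.

Definition strip_vertex (e : nat -> R) c := e (if (c < n)%N then n.-1 - c else c - n)%N.
(* The alternating signs turn the preprojective relations into
   commutativity relations. *)
Definition strip_edge (eps : R) (a ab : nat -> R) c : R :=
  if (N.-1 <= c)%N then 0 else if (n <= c)%N then a (c - n)%N
  else if c == n.-1 then eps else (-1) ^+ (n.-1 - c) * ab (n - 2 - c)%N.

Lemma PL_strip e eps a ab : (0 < n)%N -> PL_rels n e eps a ab ->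
  strip_rels n (strip_vertex e) (strip_edge eps a ab).
Proof.
move=> n0 [e_sum e_mul eps_e a_e [eps_a ab_a top]].
have Eup i : strip_vertex e (n + i)%N = e i.
  by rewrite /strip_vertex ltnNge leq_addr /= addKn.
have flip c : (c < N)%N -> strip_vertex e (N.-1 - c)%N = strip_vertex e c.
  by move=> cN; rewrite /strip_vertex; congr e; case: ifP; case: ifP; lia.
have Eidx c : (c < N)%N -> exists2 i, (i < n)%N & strip_vertex e c = e i /\
    (c = n + i \/ c = n.-1 - i)%N.
  move=> cN; rewrite /strip_vertex; case: ifP => cn.
    by exists (n.-1 - c)%N; [lia|split=> //; right; lia].
  by exists (c - n)%N; [lia|split=> //; left; lia].
(* The relation at 2n-1-c is the one at c read backwards, so the upper half suffices. There c = 2n-1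
   is the last relation, c = n the loop relation (for n = 1 the two coincide), and the others are
   the middle ones. *)
have commU c : (n <= c < N)%N -> strip_edge eps a ab c * strip_edge eps a ab (N.-1 - c.+1) =
    strip_edge eps a ab (N.-1 - c) * strip_edge eps a ab c.-1.
  move=> /andP[nc cN]; have [cN'|cN'] := leqP N.-1 c.
    have -> : c = N.-1 by lia.
    rewrite {1}/strip_edge leqnn mul0r; have [n1|n1] := eqVneq n 1%N.
      by rewrite n1 eqxx in eps_a; rewrite /strip_edge n1 /= eps_a.
    have -> : (N.-1 - N.-1 = 0)%N by lia.
    rewrite /strip_edge.
    have -> : (N.-1 <= 0)%N = false by lia.
    have -> : (n <= 0)%N = false by lia.
    have -> : (0 == n.-1)%N = false by lia.
    have -> : (N.-1 <= N.-1.-1)%N = false by lia.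
    have -> : (n <= N.-1.-1)%N by lia.
    have -> : (N.-1.-1 - n = n - 2)%N by lia.
    by rewrite !subn0 -mulrA top ?mulr0 //; lia.
  have [i ci] : exists i, c = (n + i)%N by exists (c - n)%N; lia.
  subst c; rewrite /strip_edge leqNgt cN' leq_addr /= addKn.
  have -> : (N.-1 <= N.-1 - (n + i).+1)%N = false by lia.
  have -> : (n <= N.-1 - (n + i).+1)%N = false by lia.
  have -> : (N.-1 - (n + i).+1 == n.-1)%N = false by lia.
  have -> : (n.-1 - (N.-1 - (n + i).+1) = i.+1)%N by lia.
  have -> : (n - 2 - (N.-1 - (n + i).+1) = i)%N by lia.
  have -> : (N.-1 <= N.-1 - (n + i))%N = false by lia.
  have -> : (n <= N.-1 - (n + i))%N = false by lia.
  have -> : (N.-1 <= (n + i).-1)%N = false by lia.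
  have [i0|i0] := posnP i.
    rewrite i0 in cN' *; rewrite addn0.
    have -> : (n <= n.-1)%N = false by lia.
    have -> : (N.-1 - n == n.-1)%N by lia.
    rewrite eqxx expr1 mulN1r mulrN; apply/esym/eqP; rewrite -addr_eq0.
    have n1 : (n == 1)%N = false by lia.
    by rewrite n1 in eps_a; rewrite eps_a.
  have -> : (N.-1 - (n + i) == n.-1)%N = false by lia.
  have -> : (n <= (n + i).-1)%N by lia.
  have -> : (n.-1 - (N.-1 - (n + i)) = i)%N by lia.
  have -> : (n - 2 - (N.-1 - (n + i)) = i.-1)%N by lia.
  have -> : ((n + i).-1 - n = i.-1)%N by lia.
  have /eqP := ab_a i i0 (ltac:(lia)); rewrite addr_eq0 => /eqP r.
  rewrite -[RHS]mulrA r exprS mulN1r mulNr !mulrN; congr (- _).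
  by rewrite mulrA (commr_sign (a i) i) mulrA.
split=> //.
- by rewrite -e_sum; apply: eq_bigr => i _; rewrite Eup.
- move=> c d cN dN; have [i iN [-> ci]] := Eidx c cN; have [j jN [-> dj]] := Eidx d dN.
  by rewrite e_mul //; congr (if _ then _ else _); lia.
- move=> c cN; rewrite /strip_edge.
  have -> : (N.-1 <= c)%N = false by lia.
  case: ifP => nc.
    have := a_e (c - n)%N (ltac:(lia)); rewrite /strip_vertex.
    have -> : (c < n)%N = false by lia.
    have -> : (c.+1 < n)%N = false by lia.
    have -> : (c.+1 - n = (c - n).+1)%N by lia.
    by case.
  rewrite /strip_vertex; case: ifP => [/eqP ->|cn].
    have -> : (n.-1 < n)%N by lia.
    have -> : (n.-1.+1 < n)%N = false by lia.
    have -> : (n.-1.+1 - n = 0)%N by lia.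
    by rewrite subnn -eps_e.
  have -> : (c < n)%N by lia.
  have -> : (c.+1 < n)%N by lia.
  have := a_e (n - 2 - c)%N (ltac:(lia)).
  have -> : ((n - 2 - c).+1 = n.-1 - c)%N by lia.
  have -> : (n.-1 - c.+1 = n - 2 - c)%N by lia.
  by case=> _ {1}->; rewrite -mulrA [in RHS]mulrA [e _ * (_ * _)]mulrA commr_sign !mulrA.
- by move=> c cN; rewrite /strip_edge cN.
move=> c cN; have [nc|nc] := leqP n c; first by apply: commU; lia.
have := commU (N.-1 - c)%N (ltac:(lia)).
have -> : (N.-1 - (N.-1 - c).+1 = c.-1)%N by lia.
have -> : (N.-1 - (N.-1 - c) = c)%N by lia.
have -> : ((N.-1 - c).-1 = N.-1 - c.+1)%N by lia.
by [].
Qed.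

(** Converse of [PL_strip]: an algebra given by strip data becomes a target for the universal
    property. *)
Lemma strip_PL (E U : nat -> R) : (0 < n)%N -> strip_rels n E U ->
  PL_rels n (fun i => E (n + i)%N) (U n.-1) (fun i => U (n + i)%N)
    (fun i => (-1) ^+ i.+1 * U (n - 2 - i)%N).
Proof.
move=> n0 sr; split=> [|i j iN jN||i iN|].
- exact: strip_sum sr.
- rewrite (strip_mul sr); try lia.
  by congr (if _ then _ else _); lia.
- rewrite addn0 {1}(strip_arrow sr); last lia.
  rewrite -(strip_flip sr); last lia.
  have -> : (N.-1 - n.-1 = n)%N by lia.
  by rewrite prednK.
- rewrite addnS -(strip_arrow sr); last lia.
  split=> //; rewrite {1}(strip_arrow sr); last lia.
  rewrite -(strip_flip sr); last lia.
  rewrite -[E (n - 2 - i).+1](strip_flip sr); last lia.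
  have -> : (N.-1 - (n - 2 - i) = (n + i).+1)%N by lia.
  have -> : (N.-1 - (n - 2 - i).+1 = n + i)%N by lia.
  by rewrite [E _ * (_ * _)]mulrA commr_sign !mulrA.
split=> [|i i0 iN|n1].
- case: eqP => [n1|n1].
    have := strip_comm sr (c := 1%N); rewrite n1 /= => <- //.
    by rewrite (strip_out sr) ?mul0r // n1.
  have := strip_comm sr (c := n).
  have -> : (N.-1 - n.+1 = n - 2 - 0)%N by lia.
  have -> : (N.-1 - n = n.-1)%N by lia.
  by move=> <-; [rewrite addn0 expr1 mulN1r mulrN subrr|lia].
- have := strip_comm sr (c := (n + i)%N).
  have -> : (N.-1 - (n + i).+1 = n - 2 - i)%N by lia.
  have -> : (N.-1 - (n + i) = n - 2 - i.-1)%N by lia.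
  have -> : ((n + i).-1 = n + i.-1)%N by lia.
  move=> /(_ (ltac:(lia))) r; rewrite prednK // -mulrA -r exprS mulN1r !mulNr mulrN.
  by rewrite [U (n + i)%N * (_ * _)]mulrA (commr_sign (U _) i) -mulrA subrr.
have := strip_comm sr (c := N.-1); have -> : (N.-1 - N.-1 = n - 2 - (n - 2))%N by lia.
have -> : (N.-1.-1 = n + (n - 2))%N by lia.
move=> /(_ (ltac:(lia))) r.
by rewrite -mulrA -r (strip_out sr) ?mul0r ?mulr0.
Qed.

End PLStrip.

(** * Labels of the path basis *)

Section Indices.
Variable n : nat.
Local Notation N := (n + n)%N.

(* A triple (a, u, v) with n <= a < 2n labels the path T a u v, which ends at
   jend; vertices below n are redundant because T (2n-1-a) v u = T a u v. *)
Definition idx : Type := {p : 'I_n * 'I_N * 'I_N |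
  (n + p.1.1 + p.1.2 < N)%N && (p.2 <= n + p.1.1)%N}.
HB.instance Definition _ := Finite.on idx.

Definition ja (p : idx) : nat := (n + (val p).1.1)%N.
Definition ju (p : idx) : nat := (val p).1.2.
Definition jv (p : idx) : nat := (val p).2.
Definition jend (p : idx) : nat := (ja p + ju p - jv p)%N.

Lemma idxP p : [/\ (n <= ja p)%N, (ja p + ju p < N)%N & (jv p <= ja p)%N].
Proof. by have /andP[] := valP p; split=> //; apply: leq_addr. Qed.

Lemma idx_inj p q : ja p = ja q -> ju p = ju q -> jv p = jv q -> p = q.
Proof.
case: p => [[[a u] v] hp]; case: q => [[[a' u'] v'] hq].
rewrite /ja /ju /jv /= => /addnI/val_inj aa' /val_inj uu' /val_inj vv'.
by apply: val_inj; rewrite /= aa' uu' vv'.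
Qed.

Lemma idx_exists a u v : (n <= a)%N -> (a + u < N)%N -> (v <= a)%N ->
  exists p, [/\ ja p = a, ju p = u & jv p = v].
Proof.
move=> na uN va.
have ha : (a - n < n)%N by lia.
have hu : (u < N)%N by lia.
have hv : (v < N)%N by lia.
have hp : (n + Ordinal ha + Ordinal hu < N)%N && (Ordinal hv <= n + Ordinal ha)%N.
  by rewrite /=; lia.
by exists (Sub (Ordinal ha, Ordinal hu, Ordinal hv) hp); rewrite /ja /ju /jv /=; split=> //; lia.
Qed.

Definition jmk (a u v : nat) : option idx :=
  [pick p : idx | [&& ja p == a, ju p == u & jv p == v]].

Lemma jmkE p : jmk (ja p) (ju p) (jv p) = Some p.
Proof.
rewrite /jmk; case: pickP => [q /and3P[/eqP qa /eqP qu /eqP qv]|/(_ p)].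
  by congr Some; apply: idx_inj.
by rewrite !eqxx.
Qed.

Lemma jmk_none a u v : (n <= a)%N -> ~~ ((a + u < N)%N && (v <= a)%N) -> jmk a u v = None.
Proof.
move=> na out; rewrite /jmk; case: pickP => // p /and3P[/eqP pa /eqP pu /eqP pv].
by have [_ up vp] := idxP p; move: out; rewrite -pa -pu -pv up vp.
Qed.

Variant jmk_spec a u v : option idx -> Type :=
  | JmkSome p of ja p = a & ju p = u & jv p = v : jmk_spec a u v (Some p)
  | JmkNone of ~~ ((a + u < N)%N && (v <= a)%N) : jmk_spec a u v None.

Lemma jmkP a u v : (n <= a)%N -> (a < N)%N -> jmk_spec a u v (jmk a u v).
Proof.
move=> na aN; rewrite /jmk; case: pickP => [p /and3P[/eqP pa /eqP pu /eqP pv]|none].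
  exact: JmkSome.
apply: JmkNone; apply/negP => /andP[uN va].
have [p [pa pu pv]] := idx_exists na uN va.
by have := none p; rewrite pa pu pv !eqxx.
Qed.

End Indices.

(* Linear independence of the paths: the relations are realised by the matrices
   of right multiplication on a space with basis idx. *)
Section Model.
Variables (K : fieldType) (n : nat).
Hypothesis n0 : (0 < n)%N.
Local Notation N := (n + n)%N.
Local Notation J := (idx n).

Lemma card_idx_gt0 : (0 < #|{: J}|)%N.
Proof.
have [p _] := @idx_exists n n 0 0 (leqnn n) (ltac:(lia)) (leq0n n).
by apply/card_gt0P; exists p.
Qed.

Let m := #|{: J}|.-1.
Let cardJ : #|{: J}| = m.+1. Proof. by rewrite prednK // card_idx_gt0. Qed.
Let enc (p : J) : 'I_m.+1 := cast_ord cardJ (enum_rank p).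
Let dec (i : 'I_m.+1) : J := enum_val (cast_ord (esym cardJ) i).
Let encK : cancel enc dec.
Proof. by move=> p; rewrite /dec /enc cast_ordK enum_rankK. Qed.
Let decK : cancel dec enc.
Proof. by move=> i; rewrite /dec /enc enum_valK cast_ordKV. Qed.

(** Matrix of a partial map of the basis, acting on row vectors, so that products compose from left
    to right as paths do. *)
Definition pmx (g : J -> option J) : 'M[K]_m.+1 :=
  \matrix_(i, j) (g (dec i) == Some (dec j))%:R.

Lemma pmx_mul g h : pmx g * pmx h = pmx (fun x => obind h (g x)).
Proof.
apply/matrixP => i j; rewrite !mxE; case gi: (g (dec i)) => [p|] /=; last first.
  by rewrite big1 // => k _; rewrite !mxE gi mul0r.
rewrite (bigD1 (enc p)) //= !mxE gi encK eqxx mul1r big1 ?addr0 // => k kp.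
rewrite !mxE gi; case: eqP => [[pk]|]; last by rewrite mul0r.
by case/eqP: kp; rewrite pk decK.
Qed.

Lemma pmx0 g : (forall x, g x = None) -> pmx g = 0.
Proof. by move=> g0; apply/matrixP => i j; rewrite !mxE g0. Qed.

Lemma eq_pmx g h : g =1 h -> pmx g = pmx h.
Proof. by move=> gh; apply/matrixP => i j; rewrite !mxE gh. Qed.

Definition jU (x : J) := jmk n (ja x) (ju x).+1 (jv x).
Definition jV (x : J) := jmk n (ja x) (ju x) (jv x).+1.
Definition actE c (x : J) : option J :=
  if (c == jend x) || (c == N.-1 - jend x)%N then Some x else None.
(** Right multiplication by U_c: an up step on a path ending at c, and a down step on a path ending
    at 2n-1-c, where U_c is the V of the endpoint. *)
Definition actU c (x : J) : option J :=
  if (N.-1 <= c)%N then None else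
  if c == jend x then jU x else if c == (N.-1 - jend x)%N then jV x else None.

Lemma jend_lt (x : J) : (jend x < N)%N.
Proof. by have [] := idxP x; rewrite /jend; lia. Qed.

Variant jU_spec (x : J) : option J -> Type :=
  | JUSome p of ja p = ja x & ju p = (ju x).+1 & jv p = jv x & jend p = (jend x).+1 :
      jU_spec x (Some p)
  | JUNone of (N <= ja x + (ju x).+1)%N : jU_spec x None.

Lemma jUP x : jU_spec x (jU x).
Proof.
have [h1 h2 h3] := idxP x; rewrite /jU; case: jmkP => [||p pa pu pv|out]; try lia.
  by apply: JUSome => //; rewrite /jend pa pu pv; lia.
by apply: JUNone; lia.
Qed.

Variant jV_spec (x : J) : option J -> Type :=
  | JVSome p of ja p = ja x & ju p = ju x & jv p = (jv x).+1 & (jend p).+1 = jend x :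
      jV_spec x (Some p)
  | JVNone of (ja x <= jv x)%N : jV_spec x None.

Lemma jVP x : jV_spec x (jV x).
Proof.
have [h1 h2 h3] := idxP x; rewrite /jV; case: jmkP => [||p pa pu pv|out]; try lia.
  have [_ _ h4] := idxP p; apply: JVSome => //; rewrite pa pv in h4.
  by rewrite /jend pa pu pv; lia.
by apply: JVNone; lia.
Qed.

Lemma jUV x : obind jV (jU x) = obind jU (jV x).
Proof.
have [h1 h2 h3] := idxP x.
case: jUP => [p pa pu pv _|out]; case: jVP => [q qa qu qv _|out'] //=.
- by rewrite /jV /jU pa pu pv qa qu qv.
- by rewrite /jV pa pu pv jmk_none //; lia.
by rewrite /jU qa qu qv jmk_none //; lia.
Qed.

Lemma model_strip : strip_rels n (fun c => pmx (actE c)) (fun c => pmx (actU c)).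
Proof.
split.
- apply/matrixP => i j; rewrite summxE !mxE; set x := dec i.
  have -> : (i == j) = (Some x == Some (dec j)).
    by rewrite /x; apply/eqP/eqP => [->|[/(can_inj decK)]].
  have xN := jend_lt x.
  have [k kE] : exists k : 'I_n, forall k' : 'I_n,
      ((n + k' == jend x) || (n + k' == N.-1 - jend x))%N = (k' == k).
    have [nx|nx] := leqP n (jend x).
      by exists (Ordinal (ltac:(lia) : jend x - n < n)%N) => k'; rewrite -val_eqE /=; lia.
    by exists (Ordinal (ltac:(lia) : n.-1 - jend x < n)%N) => k'; rewrite -val_eqE /=; lia.
  rewrite (bigD1 k) //= !mxE /actE kE eqxx big1 ?addr0 // => k' kk'.
  by rewrite !mxE kE (negbTE kk').
- move=> c cN; apply: eq_pmx => x; rewrite /actE; have := jend_lt x => xN.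
  by congr (if _ then _ else _); lia.
- move=> c d cN dN; rewrite pmx_mul; case: ifP => cd; last first.
    apply: pmx0 => x; rewrite /actE; have := jend_lt x => xN.
    by case: ifP => //= xc; case: ifP => // xd; exfalso; lia.
  apply: eq_pmx => x; rewrite /actE; have := jend_lt x => xN.
  by case: ifP => //= xc; case: ifP => // xd; exfalso; lia.
- move=> c cN; rewrite !pmx_mul; apply: eq_pmx => x; rewrite /actE /actU.
  have xN := jend_lt x; have -> : (N.-1 <= c)%N = false by lia.
  have [xc|xc] := eqVneq c (jend x) => /=.
    rewrite -xc eqxx; case: jUP => //= p _ _ _ pe.
    by rewrite -xc in pe; rewrite -pe eqxx.
  have [xc'|xc'] := eqVneq c (N.-1 - jend x)%N => //=.
  rewrite -xc' eqxx (negbTE xc).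
  case: jVP => //= p _ _ _ pe.
  have -> : (c.+1 == N.-1 - jend p)%N by lia.
  by rewrite orbT.
- by move=> c cN; apply: pmx0 => x; rewrite /actU cN.
move=> c cN; rewrite !pmx_mul; apply: eq_pmx => x.
have xN := jend_lt x; have [h1 h2 h3] := idxP x; rewrite /actU.
have [xc|xc] := eqVneq c (jend x).
  have -> : (N.-1 <= N.-1 - c)%N = false by lia.
  have -> : (N.-1 - c == jend x)%N = false by lia.
  have -> : (N.-1 - c == N.-1 - jend x)%N by lia.
  have -> : obind (fun y : J => if (N.-1 <= c.-1)%N then None else
      if c.-1 == jend y then jU y else if c.-1 == (N.-1 - jend y)%N then jV y else None)
      (jV x) = obind jU (jV x).
    case: jVP => //= p _ _ _ pe; have -> : (N.-1 <= c.-1)%N = false by lia.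
    by have -> : (c.-1 == jend p) by lia.
  rewrite -jUV; case: jUP => [p _ _ _ pe|out] /=; last by case: ifP.
  case: ifP => [cN'|cN'] /=.
    by have := jend_lt p; lia.
  have -> : (N.-1 <= N.-1 - c.+1)%N = false by lia.
  have -> : (N.-1 - c.+1 == jend p)%N = false by lia.
  by have -> : (N.-1 - c.+1 == N.-1 - jend p)%N by lia.
have [xc'|xc'] := eqVneq c (N.-1 - jend x)%N; last first.
  have -> : (N.-1 - c == jend x)%N = false by lia.
  have -> : (N.-1 - c == N.-1 - jend x)%N = false by lia.
  by rewrite !if_same.
have -> : (N.-1 <= N.-1 - c)%N = false by lia.
have -> : (N.-1 - c == jend x)%N by lia.
have -> : obind (fun y : J => if (N.-1 <= c.-1)%N then None else
    if c.-1 == jend y then jU y else if c.-1 == (N.-1 - jend y)%N then jV y else None)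
    (jU x) = obind jV (jU x).
  case: jUP => //= p _ _ _ pe; have -> : (N.-1 <= c.-1)%N = false by lia.
  have -> : (c.-1 == jend p) = false by lia.
  by have -> : (c.-1 == N.-1 - jend p)%N by lia.
rewrite jUV; case: jVP => [p _ _ _ pe|out] /=; last by case: ifP.
case: ifP => [cN'|cN'] /=; first by lia.
have -> : (N.-1 <= N.-1 - c.+1)%N = false by lia.
by have -> : (N.-1 - c.+1 == jend p)%N by lia.
Qed.

Definition rowJ (o : option J) : 'rV[K]_m.+1 :=
  if o is Some p then delta_mx 0 (enc p) else 0.

Lemma rowJ_pmx o g : rowJ o *m pmx g = rowJ (obind g o).
Proof.
case: o => [p|] /=; last by rewrite mul0mx.
rewrite -rowE; apply/rowP => j; rewrite !mxE encK.
case gp: (g p) => [q|] /=; rewrite ?mxE //=.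
by congr (nat_of_bool _)%:R; apply/eqP/eqP => [[->]|->]; rewrite ?decK ?encK.
Qed.

Lemma rowJE o p : rowJ o 0 (enc p) = (o == Some p)%:R.
Proof.
case: o => [q|]; last by rewrite /rowJ mxE.
by rewrite /rowJ mxE eqxx andTb (inj_eq (can_inj encK)) (inj_eq (@Some_inj _)) eq_sym.
Qed.

Local Notation TM := (T n (fun c => pmx (actE c)) (fun c => pmx (actU c))).

Lemma rowJ_T a u v : (n <= a)%N -> (a + u < N)%N -> (v <= a)%N ->
  rowJ (jmk n a 0 0) *m TM a u v = rowJ (jmk n a u v).
Proof.
move=> na uN; elim: v => [_|v IH va].
  elim: u uN => [|u IHu] uN.
    rewrite T00 rowJ_pmx; case: jmkP => [||p pa pu pv|out] //=; try lia.
    by rewrite /actE /jend pa pu pv addn0 subn0 eqxx.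
  rewrite TSu0 -mulmxE mulmxA IHu; last lia.
  rewrite rowJ_pmx; congr rowJ.
  case: (@jmkP n a u 0) => [||p pa pu pv|out] //=; try lia.
  rewrite /actU; have -> : (N.-1 <= a + u)%N = false by lia.
  have -> : (a + u == jend p)%N by rewrite /jend pa pu pv subn0.
  by rewrite /jU pa pu pv.
rewrite TSv -mulmxE mulmxA IH 1?ltnW // rowJ_pmx; congr rowJ.
case: (@jmkP n a u v) => [||p pa pu pv|out] //=; try lia.
rewrite /actU; have -> : (N.-1 <= N.-1 - (a + u - v))%N = false by lia.
have pe : jend p = (a + u - v)%N by rewrite /jend pa pu pv.
have -> : (N.-1 - (a + u - v) == jend p)%N = false by rewrite pe; lia.
by rewrite pe eqxx /jV pa pu pv.
Qed.

Lemma rowJ_T_other a b u v : (n <= a < N)%N -> (n <= b < N)%N -> a != b ->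
  rowJ (jmk n b 0 0) *m TM a u v = 0.
Proof.
move=> /andP[na aN] /andP[nb bN] ab; rewrite -(ET model_strip _ _ aN) -mulmxE mulmxA rowJ_pmx.
case: jmkP => [||p pa pu pv|out] //=; rewrite ?mul0mx //.
rewrite /actE /jend pa pu pv addn0 subn0 (negbTE ab).
have -> : (a == N.-1 - b)%N = false by lia.
by rewrite mul0mx.
Qed.

(* Over any algebra mapping onto the model, these functionals are dual to the
   paths T. *)
Definition model_coord (p : J) (M : 'M[K]_m.+1) : K :=
  (rowJ (jmk n (ja p) 0 0) *m M) 0 (enc p).

Lemma model_coordE p q : model_coord p (TM (ja q) (ju q) (jv q)) = (p == q)%:R.
Proof.
have [qa qu qv] := idxP q; have [pa pu pv] := idxP p; rewrite /model_coord.
have [pq|pq] := eqVneq (ja q) (ja p); last first.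
  rewrite rowJ_T_other // ?mxE; try lia.
  by case: eqP => // e; rewrite e eqxx in pq.
by rewrite -pq rowJ_T // rowJE jmkE (inj_eq (@Some_inj _)) eq_sym.
Qed.

Lemma model_coord_lin p : scalar (model_coord p).
Proof. by move=> c M M'; rewrite /model_coord mulmxDr -scalemxAr !mxE. Qed.

End Model.

(** * Path basis and sign automorphism from the universal property *)

Section Structure.
Variable K : fieldType.

(* jc p is the coordinate on the path p; sg is the automorphism eps |-> -eps,
   where U n.-1 is eps. *)
Record strip_alg (A : falgType K) (n : nat) (E U : nat -> A)
    (jc : idx n -> A -> K) (sg : A -> A) : Prop := StripAlg {
  sa_rels : strip_rels n E U;
  sa_jc_lin : forall p, scalar (jc p);
  sa_jcT : forall p q, jc p (T n E U (ja q) (ju q) (jv q)) = (p == q)%:R;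
  sa_span : forall x, x = \sum_p jc p x *: T n E U (ja p) (ju p) (jv p);
  sa_sg_lin : linear sg;
  sa_sgM : forall x y, sg (x * y) = sg x * sg y;
  sa_sgE : forall c, (c < n + n)%N -> sg (E c) = E c;
  sa_sgU : forall c, (c < n + n)%N -> sg (U c) = if c == n.-1 then - U c else U c;
  sa_sgK : involutive sg }.

(** An injective ring map reflects the relations; in [span_full] it is the inclusion of the span of
    the paths. *)
Lemma PL_rels_lift (R S : pzRingType) (h : R -> S) n e eps a ab e' eps' a' ab' :
    injective h -> {morph h : x y / x + y} -> {morph h : x y / x * y} ->
    h 0 = 0 -> h 1 = 1 ->
    (forall i, (i < n)%N -> h (e' i) = e i) -> h eps' = eps ->
    (forall i, (i.+1 < n)%N -> h (a' i) = a i /\ h (ab' i) = ab i) -> (0 < n)%N ->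
  PL_rels n e eps a ab -> PL_rels n e' eps' a' ab'.
Proof.
move=> hi hD hM h0 h1 he heps ha n0 [e_sum e_mul eps_e a_e [eps_a ab_a top]].
have hS (F : 'I_n -> R) : h (\sum_(i < n) F i) = \sum_(i < n) h (F i).
  exact: (big_morph h hD h0).
split=> [|i j iN jN||i iN|].
- by apply: hi; rewrite h1 -e_sum hS; apply: eq_bigr => i _; rewrite he.
- by apply: hi; rewrite hM !he // e_mul //; case: ifP; rewrite ?he ?h0.
- by apply: hi; rewrite !hM he // heps.
- have [hai habi] := ha i iN; have [ai abi] := a_e i iN.
  by split; apply: hi; rewrite !hM !he ?hai ?habi // ltnW.
split=> [|i i0 iN|n1].
- move: eps_a; case: eqP => n1 eps_a; apply: hi; rewrite ?hD !hM heps h0 //.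
  by have [-> ->] := ha 0%N (ltac:(lia)).
- have [hai habi] := ha i iN; have [ha1 hab1] := ha i.-1 (ltac:(lia)).
  by apply: hi; rewrite hD !hM hai habi ha1 hab1 h0 ab_a.
by have [ha2 hab2] := ha (n - 2)%N (ltac:(lia)); apply: hi; rewrite hM ha2 hab2 h0 top.
Qed.

Section Hom.
Variables (A B : falgType K) (f : A -> B).
Hypothesis fh : is_alg_hom f.

Lemma alg_homM x y : f (x * y) = f x * f y. Proof. by case: fh. Qed.
Lemma alg_hom_lin : linear f. Proof. by case: fh. Qed.
Lemma alg_homN x : f (- x) = - f x.
Proof. by rewrite -!(linfun_lin alg_hom_lin) linearN. Qed.
Lemma alg_hom0 : f 0 = 0.
Proof. by rewrite -!(linfun_lin alg_hom_lin) linear0. Qed.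
Lemma alg_hom_sign k x : f ((-1) ^+ k * x) = (-1) ^+ k * f x.
Proof.
by rewrite -[in LHS]signr_odd -[in RHS]signr_odd !mulr_sign; case: odd => //=; apply: alg_homN.
Qed.

Lemma alg_hom_T n E U E' U' c u v :
    (0 < n)%N -> (c < n + n)%N -> (c + u < n + n)%N -> (v <= c)%N ->
    (forall d, (d < n + n)%N -> f (E d) = E' d) ->
    (forall d, (d < n + n)%N -> f (U d) = U' d) ->
  f (T n E U c u v) = T n E' U' c u v.
Proof.
move=> n0 cN uN + fE fU; elim: v => [_|v IH vc]; last first.
  by rewrite !TSv alg_homM IH ?(ltnW vc) // fU //; lia.
elim: u uN => [|u IH] uN; first by rewrite !T00 fE.
by rewrite !TSu0 alg_homM IH ?fU //; lia.
Qed.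

Lemma alg_hom_strip n (e e' : nat -> B) eps a ab (eA : nat -> A) epsA aA abA :
    (0 < n)%N ->
    (forall i, (i < n)%N -> f (eA i) = e i) -> f epsA = eps ->
    (forall i, (i.+1 < n)%N -> f (aA i) = a i /\ f (abA i) = ab i) ->
  (forall c, (c < n + n)%N -> f (strip_vertex n eA c) = strip_vertex n e c) /\
  (forall c, f (strip_edge n epsA aA abA c) = strip_edge n eps a ab c).
Proof.
move=> n0 fe feps fa; split=> [c cN|c].
  by rewrite /strip_vertex fe //; case: ifP; lia.
rewrite /strip_edge; case: ifP => c1; first exact: alg_hom0.
case: ifP => c2; first by have [] := fa (c - n)%N (ltac:(lia)).
case: eqP => c3; first by [].
by rewrite alg_hom_sign; have [_ ->] := fa (n - 2 - c)%N (ltac:(lia)).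
Qed.

End Hom.

Variables (n : nat) (n0 : (0 < n)%N).
Local Notation N := (n + n)%N.

Lemma strip_vertex_PL (R : pzRingType) (E U : nat -> R) c : strip_rels n E U -> (c < N)%N ->
  strip_vertex n (fun i => E (n + i)%N) c = E c.
Proof.
move=> sr cN; rewrite /strip_vertex; case: ifP => cn.
  by rewrite -(strip_flip sr); [congr E; lia|lia].
by congr E; lia.
Qed.

Lemma strip_edge_PL (R : pzRingType) (E U : nat -> R) c : strip_rels n E U ->
  strip_edge n (U n.-1) (fun i => U (n + i)%N)
    (fun i => (-1) ^+ i.+1 * U (n - 2 - i)%N) c = U c.
Proof.
move=> sr; rewrite /strip_edge; case: ifP => c1; first by rewrite (strip_out sr).
case: ifP => c2; first by congr U; lia.
case: eqP => [-> //|c3].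
have -> : (n.-1 - c = (n - 2 - c).+1)%N by lia.
by rewrite signrMK; congr U; lia.
Qed.

Variables (A : falgType K) (e : nat -> A) (eps : A) (a ab : nat -> A).
Hypothesis hA : is_PLn n e eps a ab.
Let E := strip_vertex n e.
Let U := strip_edge n eps a ab.
Let Tp (p : idx n) := T n E U (ja p) (ju p) (jv p).
Let sr : strip_rels n E U. Proof. by apply: PL_strip => //; case: hA. Qed.

Let X := [seq Tp p | p : idx n].

Lemma T_span c u v : (c < N)%N -> T n E U c u v \in <<X>>%VS.
Proof.
move=> cN; have [T0|/(T_nz_range sr cN)/andP[uN vc]] := eqVneq (T n E U c u v) 0.
  by rewrite T0 mem0v.
have [nc|nc] := leqP n c.
  have [p [pa pu pv]] := idx_exists nc uN vc.
  by apply/memv_span/imageP; exists p => //; rewrite /Tp pa pu pv.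
have [p [pa pu pv]] := @idx_exists n (N.-1 - c) v u (ltac:(lia)) (ltac:(lia)) (ltac:(lia)).
apply/memv_span/imageP; exists p => //; rewrite /Tp pa pu pv (T_flip sr) //; lia.
Qed.

Lemma span_mul x y : x \in <<X>>%VS -> y \in <<X>>%VS -> x * y \in <<X>>%VS.
Proof.
have XX x' y' : x' \in X -> y' \in X -> x' * y' \in <<X>>%VS.
  move=> /imageP[p _ ->] /imageP[q _ ->]; rewrite /Tp.
  have [h1 h2 h3] := idxP p; have [k1 k2 k3] := idxP q.
  have [qe|qe] := eqVneq (ja q) (jend p).
    by rewrite qe (T_mul sr) ?T_span //; lia.
  have [qe'|qe'] := eqVneq (ja q) (N.-1 - jend p)%N.
    by rewrite qe' (T_mul_flip sr) ?T_span //; lia.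
  by rewrite (T_mul0 sr) ?mem0v //; lia.
have Xs x' y' : x' \in X -> y' \in <<X>>%VS -> x' * y' \in <<X>>%VS.
  move=> x'X; have /subvP sub : (<<X>> <= amull x' @^-1: <<X>>)%VS.
    by apply/span_subvP => z zX; rewrite -memv_preim lfunE XX.
  by move=> /sub; rewrite -memv_preim lfunE.
move=> + yX; have /subvP sub : (<<X>> <= amulr y @^-1: <<X>>)%VS.
  by apply/span_subvP => z zX; rewrite -memv_preim lfunE /= Xs.
by move=> /sub; rewrite -memv_preim lfunE.
Qed.

Lemma one_span : 1 \in <<X>>%VS.
Proof.
rewrite -(strip_sum sr); apply: memv_suml => i _.
by rewrite -(T00 n E U) T_span // ltn_add2l.
Qed.

(** The span of the paths is a subalgebra containing the generators. The universal property gives a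
    map from A into it, and followed by the inclusion this map fixes the generators, so by
    uniqueness it is the identity. *)
Lemma span_full x : x \in <<X>>%VS.
Proof.
have asp : is_aspace <<X>>%VS.
  by rewrite /is_aspace has_algid1 ?one_span //=; apply/prodvP => u v; apply: span_mul.
pose C : {aspace A} := ASpace asp.
have Ee i : (i < n)%N -> e i = E (n + i)%N.
  by move=> iN; rewrite /E /strip_vertex ltnNge leq_addr /= addKn.
have Uspan c : (c < N)%N -> U c \in C.
  by move=> cN; rewrite -(U_El sr cN) -[c in U c]addn0 -(T00 n E U) -TSu0 T_span.
have e_in i : (i < n)%N -> e i \in C.
  by move=> iN; rewrite Ee // -(T00 n E U) T_span // ltn_add2l.
have eps_in : eps \in C.
  have -> : eps = U n.-1.
    rewrite /U /strip_edge eqxx.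
    have -> : (N.-1 <= n.-1)%N = false by lia.
    by have -> : (n <= n.-1)%N = false by lia.
  by apply: Uspan; lia.
have a_in i : (i.+1 < n)%N -> a i \in C.
  move=> iN; have -> : a i = U (n + i)%N.
    rewrite /U /strip_edge leq_addr addKn.
    by have -> : (N.-1 <= n + i)%N = false by lia.
  by apply: Uspan; lia.
have ab_in i : (i.+1 < n)%N -> ab i \in C.
  move=> iN; have -> : ab i = (-1) ^+ i.+1 * U (n - 2 - i)%N.
    rewrite /U /strip_edge.
    have -> : (N.-1 <= n - 2 - i)%N = false by lia.
    have -> : (n <= n - 2 - i)%N = false by lia.
    have -> : (n - 2 - i == n.-1)%N = false by lia.
    have -> : (n.-1 - (n - 2 - i) = i.+1)%N by lia.
    have -> : (n - 2 - (n - 2 - i) = i)%N by lia.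
    by rewrite signrMK.
  have Ui : U (n - 2 - i)%N \in C by apply: Uspan; lia.
  by rewrite -signr_odd mulr_sign; case: odd => //=; rewrite memvN.
pose pr := vsproj C.
have one_C : vsval (1 : subvs_of C) = 1.
  by apply: (eqP (_ : algid C == 1)); rewrite algid_eq1; apply: one_span.
have relC : PL_rels n (fun i => pr (e i)) (pr eps) (fun i => pr (a i)) (fun i => pr (ab i)).
  have relA := hA.1.
  apply: (PL_rels_lift (h := vsval) _ _ _ _ _ _ _ _ n0 relA) => //.
  - exact: subvs_inj.
  - by move=> i iN; rewrite vsprojK ?e_in.
  - by rewrite vsprojK.
  by move=> i iN; rewrite !vsprojK ?a_in ?ab_in.
have [+ _] := hA.2 _ _ _ _ _ relC; case=> f [[f_lin f1 fM] fe feps fa].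
have [_ uniq_id] := hA.2 _ _ _ _ _ hA.1.
suff -> : x = vsval (f x) by apply: subvsP.
apply: (uniq_id id (fun x => vsval (f x))).
  by split=> //; split.
split=> [|i iN||i iN].
- split=> [c u v||u v]; first by rewrite f_lin.
    by rewrite f1.
  by rewrite fM.
- by rewrite fe // vsprojK ?e_in.
- by rewrite feps vsprojK.
by have [-> ->] := fa i iN; rewrite !vsprojK ?a_in ?ab_in.
Qed.

(** Coordinates are pulled back from the matrix model, where the paths are independent; they are
    complete since the paths span. *)
Theorem PLn_structure : exists jc sg, strip_alg (n := n) E U jc sg.
Proof.
have srM := model_strip K n0; have relM := strip_PL n0 srM.
have [[f [fh fe feps fa]] _] := hA.2 _ _ _ _ _ relM.
have [fE fU] := alg_hom_strip fh (fun=> 0) n0 fe feps fa.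
have fT q : f (Tp q) = T n (fun c => pmx K n0 (actE c)) (fun c => pmx K n0 (actU c))
    (ja q) (ju q) (jv q).
  have [h1 h2 h3] := idxP q.
  apply: (alg_hom_T fh) => // [|d dN|d dN]; first by lia.
    by rewrite fE // (strip_vertex_PL srM).
  by rewrite fU (strip_edge_PL _ srM).
pose jc p x := model_coord n0 p (f x).
have jc_lin p : scalar (jc p).
  by move=> c x y; rewrite /jc (alg_hom_lin fh) (model_coord_lin n0 p).
have jcT p q : jc p (Tp q) = (p == q)%:R by rewrite /jc fT model_coordE.
(* The loop occurs only squared in the quadratic relations, so they survive its change of sign;
   uniqueness then makes the induced endomorphism an involution. *)
have rel_sg : PL_rels n e (- eps) a ab.
  have [e_sum e_mul eps_e a_e [eps_a ab_a top]] := hA.1.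
  by split=> //; rewrite ?mulrNN // mulrN mulNr -eps_e.
have [[sg [sgh sge sgeps sga]] _] := hA.2 _ _ _ _ _ rel_sg.
have [sgE sgU] := alg_hom_strip sgh (fun=> 0) n0 sge sgeps sga.
have [_ uniq_id] := hA.2 _ _ _ _ _ hA.1.
exists jc, sg; split=> //.
- have lin0 : linear (fun x => x - \sum_p jc p x *: Tp p).
    move=> c x y; rewrite scalerBr scaler_sumr -addrACA -opprD -big_split.
    congr (_ - _); apply: eq_bigr => p _ /=.
    by rewrite jc_lin scalerDl scalerA.
  move=> x; apply/eqP; rewrite -subr_eq0 -[_ - _](linfun_lin lin0).
  rewrite -memv_ker; have : x \in <<X>>%VS := span_full x.
  apply/subvP; apply/span_subvP => y /imageP[q _ ->].
  rewrite memv_ker (linfun_lin lin0) subr_eq0; apply/eqP.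
  rewrite (bigD1 q) //= jcT eqxx scale1r big1 ?addr0 // => p /negbTE pq.
  by rewrite jcT pq scale0r.
- exact: alg_hom_lin sgh.
- exact: alg_homM sgh.
- move=> c cN; rewrite sgU /U /strip_edge; case: (eqVneq c n.-1) => [->|//].
  have -> : (N.-1 <= n.-1)%N = false by lia.
  by have -> : (n <= n.-1)%N = false by lia.
apply: (uniq_id (fun x => sg (sg x)) id); last by split=> //; split.
split=> [|i iN||i iN].
- by split=> [c x y||x y]; case: sgh => sl s1 sM; rewrite ?sl ?s1 ?sM.
- by rewrite !sge.
- by rewrite sgeps (alg_homN sgh) sgeps opprK.
by have [h1 h2] := sga i iN; rewrite !h1 !h2.
Qed.

End Structure.

(** * The periodic coresolution *)

Section LinearCombinators.
Variables (K : fieldType) (V : vectType K) (A : falgType K).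

Lemma linD (f g : V -> A) : linear f -> linear g -> linear (fun x => f x + g x).
Proof. by move=> lf lg c x y; rewrite lf lg scalerDr addrACA. Qed.
Lemma linN (f : V -> A) : linear f -> linear (fun x => - f x).
Proof. by move=> lf c x y; rewrite lf opprD scalerN. Qed.
Lemma linB (f g : V -> A) : linear f -> linear g -> linear (fun x => f x - g x).
Proof. by move=> lf lg; apply: linD => //; apply: linN. Qed.
Lemma linMr (f : V -> A) b : linear f -> linear (fun x => f x * b).
Proof. by move=> lf c x y; rewrite lf mulrDl scalerAl. Qed.
Lemma linMl (f : V -> A) b : linear f -> linear (fun x => b * f x).
Proof. by move=> lf c x y; rewrite lf mulrDr scalerAr. Qed.
Lemma linL (h : 'End(A)) (f : V -> A) : linear f -> linear (fun x => h (f x)).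
Proof. by move=> lf c x y; rewrite lf linearP. Qed.
Lemma linC (h : A -> A) (f : V -> A) : linear h -> linear f -> linear (fun x => h (f x)).
Proof. by move=> lh lf c x y; rewrite lf lh. Qed.
Lemma lin0 : linear (fun _ : V => 0 : A).
Proof. by move=> c x y; rewrite scaler0 addr0. Qed.
Lemma lin_sum I (r : seq I) (F : I -> V -> A) : (forall i, linear (F i)) ->
  linear (fun x => \sum_(i <- r) F i x).
Proof.
move=> lF c x y; rewrite scaler_sumr -big_split; apply: eq_bigr => i _.
by rewrite lF.
Qed.
End LinearCombinators.

Lemma lin_id (K : fieldType) (A : falgType K) : linear (fun x : A => x).
Proof. by []. Qed.

Ltac lin_tac := repeat first
  [ assumption | apply: lin_id | apply: linB | apply: linD | apply: linN | apply: linMr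
  | apply: linMl | apply: linL | apply: linC | apply: lin0 | apply: lin_sum => ?].

Section Families.
Variables (K : fieldType) (A : falgType K) (n : nat).
Hypothesis n0 : (0 < n)%N.
Local Notation N := (n + n)%N.
(* The bound N.-1.+1 = N makes inord available in at_. *)
Definition fam : Type := {ffun 'I_N.-1.+1 -> 'End(A)}.
HB.instance Definition _ := Vector.copy fam {ffun 'I_N.-1.+1 -> 'End(A)}.

Definition at_ (g : fam) (c : nat) : 'End(A) := g (inord c).
Definition wfam (F : nat -> A -> A) : fam := [ffun c : 'I_N.-1.+1 => linfun (F c)].

Lemma wfamE F c x : (c < N)%N -> linear (F c) -> at_ (wfam F) c x = F c x.
Proof. by move=> cN lF; rewrite /at_ ffunE inordK ?(linfun_lin lF) // prednK // addn_gt0 n0. Qed.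

Lemma fam_ext g h : (forall c x, (c < N)%N -> at_ g c x = at_ h c x) -> g = h.
Proof.
move=> gh; apply/ffunP => c; apply/lfunP => x.
by have := gh c x; rewrite /at_ inord_val; apply; have := ltn_ord c; lia.
Qed.

Lemma atD c g h d x : at_ (c *: g + h) d x = c *: at_ g d x + at_ h d x.
Proof. by rewrite /at_ !ffunE lfunE /= lfunE. Qed.

Lemma lin_at c x : linear (fun g : fam => at_ g c x).
Proof. by move=> a g h; rewrite atD. Qed.

Lemma wfam_lin (F : fam -> nat -> A -> A) :
    (forall g c, (c < N)%N -> linear (F g c)) ->
    (forall c x, (c < N)%N -> linear (fun g => F g c x)) ->
  linear (fun g => wfam (F g)).
Proof.
by move=> lx lg a g h; apply: fam_ext => c x cN; rewrite atD !wfamE //; [apply: lg|apply: lx..].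
Qed.

End Families.
Arguments at_ {K A n} g c.
Arguments fam {K} A n.

Ltac lin_fam := repeat first
  [ assumption | apply: lin_at | apply: lin_id | apply: linB | apply: linD | apply: linN
  | apply: linMr | apply: linMl | apply: linL | apply: linC | apply: lin0 | apply: lin_sum => ?].

Lemma big_idx (R : Type) (one : R) (op : Monoid.com_law one) n (F : nat -> nat -> nat -> R) :
  \big[op/one]_(p : idx n) F (ja p) (ju p) (jv p) =
  \big[op/one]_(i < n) \big[op/one]_(u < n - i) \big[op/one]_(v < (n + i).+1) F (n + i)%N u v.
Proof.
pose P (x : 'I_n * 'I_(n + n) * 'I_(n + n)) :=
  (n + x.1.1 + x.1.2 < n + n)%N && (x.2 <= n + x.1.1)%N.
transitivity (\big[op/one]_(x | P x) F (n + x.1.1)%N x.1.2 x.2).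
  rewrite (reindex_omap (val : idx n -> _) insub) => [|x Px]; last by rewrite insubT.
  by apply: eq_bigl => p; rewrite valK eqxx andbT; apply/esym/(valP p).
rewrite -(pair_big_dep predT (fun x v => P (x, v))
  (fun x v => F (n + x.1)%N x.2 (nat_of_ord v))) /=.
rewrite -(pair_bigA _ (fun (i : 'I_n) (u : 'I_(n + n)) =>
  \big[op/one]_(v < n + n | P (i, u, v)) F (n + i)%N u v)) /=.
apply: eq_bigr => i _.
have ni : (n - i <= n + n)%N by lia.
have ni' : ((n + i).+1 <= n + n)%N by have := ltn_ord i; lia.
rewrite (big_ord_widen_cond (n + n) predT
  (fun u => \big[op/one]_(v < (n + i).+1) F (n + i)%N u v)) //=.
rewrite [RHS]big_mkcond /=; apply: eq_bigr => u _.
rewrite (big_ord_widen_cond (n + n) predT (fun v => F (n + i)%N u v)) //= /P /=.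
case: ifP => ui; first by apply: eq_bigl => v; have := ltn_ord i; lia.
by rewrite big_pred0 // => v; have := ltn_ord i; lia.
Qed.

(** The form in which dimensions are computed below: functionals jointly injective on [M], and
    vectors of [M] dual to them. *)
Lemma dim_dual_family (K : fieldType) (W : vectType K) (M : {vspace W}) (I : finType)
    (F : W -> {ffun I -> K^o}) (b : I -> W) :
    linear F -> (forall g, g \in M -> F g = 0 -> g = 0) -> (forall i, b i \in M) ->
    (forall i, F (b i) = [ffun j => (j == i)%:R]) ->
  \dim M = #|I|.
Proof.
move=> lF inj bM Fb; rewrite -(@limg_dim_eq _ _ _ (linfun F) M).
  have -> : (linfun F @: M)%VS = fullv.
    apply/eqP; rewrite eqEsubv subvf; apply/subvP => f _.
    have -> : f = linfun F (\sum_i f i *: b i).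
      rewrite linear_sum; apply/ffunP => j; rewrite sum_ffunE (bigD1 j) //=.
      rewrite linearZ /= (linfun_lin lF) Fb !ffunE eqxx [_ *: _]mulr1 big1 ?addr0 // => i ij.
      by rewrite linearZ /= (linfun_lin lF) Fb !ffunE eq_sym (negbTE ij) [_ *: _]mulr0.
    by apply: memv_img; apply: memv_suml => i _; apply: memvZ.
  by rewrite dim_ffun [X in (_ * X)%N]dimvf muln1.
apply/eqP; rewrite -subv0; apply/subvP => g /memv_capP[gM].
by rewrite memv_ker (linfun_lin lF) memv0 => /eqP/(inj g gM) ->.
Qed.

(** The centre n-1 of the strip is the loop, and n-2-i and n+i are the two opposite arrows over one
    edge of L_n. *)
Lemma sum_strip (V : zmodType) n (F : nat -> V) : (0 < n)%N ->
  \sum_(c < (n + n).-1) F c = F n.-1 + \sum_(i < n.-1) (F (n.-2 - i)%N + F (n + i)%N).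
Proof.
case: n => // m _ /=; rewrite addnC big_split_ord /= big_split /= addrA.
congr (_ + _).
rewrite big_ord_recr /= addrC; congr (_ + _).
by rewrite (reindex_inj rev_ord_inj) /=; apply: eq_bigr => i _; congr F; lia.
Qed.

Lemma sum_shift (V : zmodType) n (F G : nat -> V) : (0 < n)%N -> F n.-1 = 0 ->
  \sum_(i < n) (F i - G i) = - G 0%N + \sum_(i < n.-1) (F i - G i.+1).
Proof.
case: n => // m _ /= Fm; rewrite !sumrB big_ord_recr /= Fm addr0 big_ord_recl opprD /=.
by rewrite addrCA.
Qed.

(** * The symmetrizing form and its dual bases *)

Section StripAlgebra.
Variables (K : fieldType) (A : falgType K) (n : nat) (E U : nat -> A).
Variables (jc : idx n -> A -> K) (sg : A -> A).
Hypothesis n0 : (0 < n)%N.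
Hypothesis sa : strip_alg E U jc sg.
Local Notation N := (n + n)%N.
Local Notation Tc := (T n E U).
Local Notation W := (fam A n).
Local Notation V c := (U (N.-1 - c)%N).
Let sr := sa_rels sa.
Let sgL : linear sg := sa_sg_lin sa.

Definition bJ (p : idx n) : A := Tc (ja p) (ju p) (jv p).
(* The phi-dual basis, see phi_star. *)
Definition star (p : idx n) : A := Tc (jend p) (N.-1 - ja p - ju p) (ja p - jv p).

Lemma linear_bJ (V : vectType K) (f g : A -> V) : linear f -> linear g ->
  (forall p, f (bJ p) = g (bJ p)) -> f =1 g.
Proof.
move=> lf lg fg x; rewrite (sa_span sa x) (linear_suml lf) (linear_suml lg).
by apply: eq_bigr => p _; congr (_ *: _); apply: fg.
Qed.

Definition top_idx (p : idx n) := (ju p == N.-1 - ja p)%N && (jv p == ja p).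
Definition phi (x : A) : K := \sum_(p | top_idx p) jc p x.

Lemma phi_lin : scalar phi.
Proof.
move=> c x y; rewrite /phi mulr_sumr -big_split; apply: eq_bigr => p _ /=.
by rewrite (sa_jc_lin sa).
Qed.

Let phi_linear : linear (phi : A -> K^o). Proof. exact: phi_lin. Qed.

Lemma phi_sum I (r : seq I) (c : I -> K) (x : I -> A) :
  phi (\sum_(i <- r) c i *: x i) = \sum_(i <- r) c i * phi (x i).
Proof. exact: (linear_suml phi_linear). Qed.

Lemma phi0 : phi 0 = 0.
Proof. by have := phi_sum [::] (fun i : nat => 0) (fun=> 0); rewrite !big_nil. Qed.

Lemma phi_bJ p : phi (bJ p) = (top_idx p)%:R.
Proof.
rewrite /phi; case: (boolP (top_idx p)) => tp.
  rewrite (bigD1 p) //= (sa_jcT sa) eqxx big1 ?addr0 // => q /andP[_ /negbTE qp].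
  by rewrite (sa_jcT sa) qp.
rewrite big1 // => q tq; rewrite (sa_jcT sa); case: eqP => // qp.
by rewrite qp (negbTE tp) in tq.
Qed.

Lemma phi_T c u v : (c < N)%N -> phi (Tc c u v) = ((u == N.-1 - c)%N && (v == c))%:R.
Proof.
move=> cN; have [T0|/(T_nz_range sr cN)/andP[uN vc]] := eqVneq (Tc c u v) 0.
  case: (boolP (_ && _)) => [/andP[/eqP ue /eqP ve]|_]; last by rewrite T0 phi0.
  have [nc|nc] := leqP n c.
    have [p [pa pu pv]] := @idx_exists n c u v nc (ltac:(lia)) (ltac:(lia)).
    have := phi_bJ p; rewrite /bJ /top_idx pa pu pv T0 phi0 ue ve !eqxx => /esym/eqP.
    by rewrite oner_eq0.
  have [p [pa pu pv]] := @idx_exists n (N.-1 - c) v u (ltac:(lia)) (ltac:(lia)) (ltac:(lia)).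
  have := phi_bJ p; rewrite /bJ /top_idx pa pu pv (T_flip sr) ?T0 ?phi0 //; try lia.
  have -> : (v == N.-1 - (N.-1 - c))%N by lia.
  by rewrite ue eqxx /= => /esym/eqP; rewrite oner_eq0.
have [nc|nc] := leqP n c.
  have [p [pa pu pv]] := idx_exists nc uN vc.
  by rewrite -pa -pu -pv -/(bJ p) phi_bJ.
have [p [pa pu pv]] := @idx_exists n (N.-1 - c) v u (ltac:(lia)) (ltac:(lia)) (ltac:(lia)).
rewrite -(T_flip sr) //; try lia.
rewrite -pa -pu -pv -/(bJ p) phi_bJ /top_idx pa pu pv; congr (nat_of_bool _)%:R; lia.
Qed.

Lemma phi_TT c u v d u' v' : (c + u < N)%N -> (v <= c)%N -> (d < N)%N ->
  phi (Tc c u v * Tc d u' v') =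
  ([&& d == c + u - v, u + u' == N.-1 - c & v + v' == c]
   || [&& d == N.-1 - (c + u - v), u + v' == N.-1 - c & v + u' == c])%N%:R.
Proof.
move=> uN vc dN; have [de|de] := eqVneq d (c + u - v)%N.
  rewrite de (T_mul sr) // phi_T; last lia.
  have -> : (c + u - v == N.-1 - (c + u - v))%N = false by lia.
  by rewrite orbF.
have [de'|de'] := eqVneq d (N.-1 - (c + u - v))%N.
  by rewrite de' (T_mul_flip sr) // phi_T //; lia.
by rewrite (T_mul0 sr) // phi0.
Qed.

Lemma phi_mul_linl y : linear (fun x => phi (x * y) : K^o).
Proof. by move=> c x z; rewrite mulrDl -scalerAl phi_linear. Qed.
Lemma phi_mul_linr x : linear (fun y => phi (x * y) : K^o).
Proof. by move=> c y z; rewrite mulrDr -scalerAr phi_linear. Qed.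

(** A socle path runs from c to its twin 2n-1-c on the strip. Rotating a product therefore turns a
    direct match of endpoints into a flipped one, and conversely. *)
Lemma phi_TT_sym c u v d u' v' : (c + u < N)%N -> (v <= c)%N -> (d + u' < N)%N -> (v' <= d)%N ->
  ([&& d == c + u - v, u + u' == N.-1 - c & v + v' == c]
   || [&& d == N.-1 - (c + u - v), u + v' == N.-1 - c & v + u' == c])%N ->
  ([&& c == d + u' - v', u' + u == N.-1 - d & v' + v == d]
   || [&& c == N.-1 - (d + u' - v'), u' + v == N.-1 - d & v' + u == d])%N.
Proof.
move=> uN vc uN' vd /orP[/and3P[/eqP d1 /eqP u1 /eqP v1]|/and3P[/eqP d1 /eqP u1 /eqP v1]];
  apply/orP; [right|left]; apply/and3P; split; apply/eqP; lia.
Qed.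

Lemma phiC x y : phi (x * y) = phi (y * x).
Proof.
move: x; apply: (linear_bJ (phi_mul_linl y) (phi_mul_linr y)) => p.
move: y; apply: (linear_bJ (phi_mul_linr _) (phi_mul_linl _)) => q.
have [h1 h2 h3] := idxP p; have [k1 k2 k3] := idxP q.
have pN : (ja p < N)%N by lia.
have qN : (ja q < N)%N by lia.
rewrite /bJ !phi_TT //.
by congr (nat_of_bool _)%:R; apply/idP/idP; apply: phi_TT_sym.
Qed.

Lemma phi_star p q : phi (bJ p * star q) = (p == q)%:R.
Proof.
have [h1 h2 h3] := idxP p; have [k1 k2 k3] := idxP q.
rewrite /bJ /star phi_TT //; last by rewrite /jend; lia.
congr (nat_of_bool _)%:R; apply/idP/eqP => [|->]; last by rewrite /jend; lia.
by rewrite /jend => h; apply: idx_inj; lia.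
Qed.

Lemma jc_phi p x : jc p x = phi (x * star p).
Proof.
have lin : linear (jc p : A -> K^o) by exact: sa_jc_lin sa p.
apply: (linear_bJ lin (phi_mul_linl _)) => q.
by rewrite phi_star (sa_jcT sa) eq_sym.
Qed.

Lemma bJ_expand x : x = \sum_p phi (x * star p) *: bJ p.
Proof. by rewrite {1}(sa_span sa x); apply: eq_bigr => p _; rewrite jc_phi. Qed.

Lemma phi_nd x : (forall y, phi (x * y) = 0) -> x = 0.
Proof. by move=> x0; rewrite (bJ_expand x) big1 // => p _; rewrite x0 scale0r. Qed.

Lemma star_expand y : y = \sum_p phi (y * bJ p) *: star p.
Proof.
apply/eqP; rewrite -subr_eq0; apply/eqP/phi_nd => x.
rewrite phiC; move: x.
have l0 : linear (fun _ : A => 0 : K^o) by move=> c u v; rewrite scaler0 addr0.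
apply: (linear_bJ (phi_mul_linl _) l0) => q.
rewrite mulrBr -scaleN1r addrC phi_linear scaleN1r mulr_sumr.
rewrite (_ : phi _ = phi (bJ q * y)) ?addNr // (bigD1 q) //=.
rewrite -(linfun_lin phi_linear) linearD /= -scalerAr linearZ /= !(linfun_lin phi_linear).
rewrite phi_star eqxx [_ *: 1]mulr1 phiC -[RHS]addr0; congr (_ + _).
rewrite -(linfun_lin phi_linear) linear_sum big1 // => p /negbTE pq.
by rewrite -scalerAr linearZ /= (linfun_lin phi_linear) phi_star eq_sym pq scaler0.
Qed.

(** Expanding b bJ_p on the left and star_q b on the right in the dual bases gives the same double
    sum with coefficients phi(b bJ_p star_q). *)
Lemma casimir (h : A -> A) b : linear h ->
  \sum_p h (b * bJ p) * star p = \sum_p h (bJ p) * (star p * b).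
Proof.
move=> lh.
transitivity (\sum_p \sum_q phi (b * bJ p * star q) *: (h (bJ q) * star p)).
  apply: eq_bigr => p _; rewrite {1}(bJ_expand (b * bJ p)) (linear_suml lh) mulr_suml.
  by apply: eq_bigr => q _; rewrite -scalerAl.
rewrite exchange_big; apply: eq_bigr => q _ /=.
rewrite {1}(star_expand (star q * b)) mulr_sumr; apply: eq_bigr => p _.
by rewrite -scalerAr phiC mulrA.
Qed.

(** Starting in the upper half and going up first, a path meets the loop at most once, and does so
    exactly when it ends in the lower half. *)
Lemma sg_T a u v : (n <= a)%N -> (a + u < N)%N -> (v <= a)%N ->
  sg (Tc a u v) = if (a + u - v < n)%N then - Tc a u v else Tc a u v.
Proof.
move=> na uN; elim: v => [_|v IH va].
  have -> : (a + u - 0 < n)%N = false by lia.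
  elim: u uN => [|u IHu] uN; first by rewrite !T00 (sa_sgE sa) //; lia.
  rewrite TSu0 (sa_sgM sa) IHu ?(sa_sgU sa); try lia.
  by have -> : (a + u == n.-1)%N = false by lia.
rewrite TSv (sa_sgM sa) IH; last by lia.
rewrite (sa_sgU sa); last by lia.
have [dn|dn|dn] := ltngtP (a + u - v)%N n.
- have -> : (a + u - v.+1 < n)%N by lia.
  have -> : (N.-1 - (a + u - v) == n.-1)%N = false by lia.
  by rewrite mulNr.
- have -> : (a + u - v.+1 < n)%N = false by lia.
  by have -> : (N.-1 - (a + u - v) == n.-1)%N = false by lia.
have -> : (a + u - v.+1 < n)%N by lia.
have -> : (N.-1 - (a + u - v) == n.-1)%N by lia.
by rewrite mulrN.
Qed.

Lemma sg_bJ p : sg (bJ p) = if (jend p < n)%N then - bJ p else bJ p.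
Proof. by have [h1 h2 h3] := idxP p; apply: sg_T. Qed.

(* Index 2n-1-c denotes the same vertex as c, so a family g over the strip is
   also a family over the vertices of L_n once it is symmetric (Q0) or, to
   absorb the signs of the relations, antisymmetric (Q2); Q1 is indexed by
   the arrows U c. *)
Definition proj02 (b : bool) (g : W) : W := wfam n (fun c x =>
  (-1) ^+ (b && (c < n)%N) * (at_ g (maxn c (N.-1 - c)) (x * E c) * E c)).
Definition proj1 (g : W) : W := wfam n (fun c x =>
  if (c < N.-1)%N then at_ g c (x * E c) * E c.+1 else 0).

Definition Q02 b : {vspace W} := fixedSpace (linfun (proj02 b)).
Definition Q1 : {vspace W} := fixedSpace (linfun proj1).

Lemma proj02_lin b : linear (proj02 b).
Proof. by apply: wfam_lin => // [g c cN|c x cN]; lin_fam. Qed.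

Lemma proj1_lin : linear proj1.
Proof. by apply: wfam_lin => // [g c cN|c x cN]; case: (c < N.-1)%N; lin_fam. Qed.

(** The first two conditions say that [at_ g c] is a map A e_c -> A e_c extended by 0, so each
    [Q02 b] is a copy of the sum of the Hom_K(A e_i, A e_i) over the vertices of L_n. *)
Lemma mem_Q02 b g : g \in Q02 b <-> forall c, (c < N)%N ->
  [/\ forall x, at_ g c (x * E c) = at_ g c x, forall x, at_ g c x * E c = at_ g c x &
      forall x, at_ g (N.-1 - c)%N x = (-1) ^+ b * at_ g c x].
Proof.
split=> [/fixedSpaceP|gQ].
  rewrite (linfun_lin (proj02_lin b)) => gE.
  have gP c x : (c < N)%N -> at_ g c x = (-1) ^+ (b && (c < n)%N) *
      (at_ g (maxn c (N.-1 - c)) (x * E c) * E c).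
    by move=> cN; rewrite -{1}gE wfamE //; lin_fam.
  move=> c cN; have EE := E_idem sr cN; split=> x; rewrite !(gP c) //.
  - by rewrite -mulrA EE.
  - by rewrite -!mulrA EE.
  rewrite gP; last lia.
  rewrite (strip_flip sr) //; have -> : (N.-1 - (N.-1 - c) = c)%N by lia.
  rewrite maxnC mulrA -exprD; congr (_ * _); have [cn|cn] := ltnP c n.
    have -> : (N.-1 - c < n)%N = false by lia.
    by rewrite andbF andbT -[RHS]signr_odd oddD addbb.
  have -> : (N.-1 - c < n)%N by lia.
  by rewrite andbT andbF addn0.
apply/fixedSpaceP; rewrite (linfun_lin (proj02_lin b)); apply: fam_ext => // c x cN.
rewrite wfamE //; last by lin_fam.
have [g1 g2 g3] := gQ c cN; have [cn|cn] := ltnP c n.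
  have -> : maxn c (N.-1 - c) = (N.-1 - c)%N by lia.
  by rewrite andbT g3 -[(-1) ^+ b * _ * _]mulrA g2 g1 mulrA -expr2 sqrr_sign mul1r.
have -> : maxn c (N.-1 - c) = c by lia.
by rewrite andbF mul1r g1 g2.
Qed.

Lemma mem_Q1 g : g \in Q1 <-> (forall c, (c.+1 < N)%N ->
  (forall x, at_ g c (x * E c) = at_ g c x) /\ (forall x, at_ g c x * E c.+1 = at_ g c x)) /\
  (forall x, at_ g N.-1 x = 0).
Proof.
have lp c (h : W) : linear (fun x => if (c < N.-1)%N then at_ h c (x * E c) * E c.+1 else 0).
  by case: (c < N.-1)%N; lin_fam.
split=> [/fixedSpaceP|[gQ g0]].
  rewrite (linfun_lin proj1_lin) => gE.
  have gP c x : (c < N)%N -> at_ g c x =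
      if (c < N.-1)%N then at_ g c (x * E c) * E c.+1 else 0.
    by move=> cN; rewrite -{1}gE wfamE.
  split=> [c cN|x]; last by rewrite gP ?ltnn //; lia.
  have cN1 : (c < N.-1)%N by lia.
  have cN' := ltnW cN; split=> x.
    by rewrite [LHS]gP // [RHS]gP // cN1 -[x * _ * _]mulrA (E_idem sr).
  by rewrite gP // cN1 -mulrA (E_idem sr).
apply/fixedSpaceP; rewrite (linfun_lin proj1_lin); apply: fam_ext => // c x cN.
rewrite wfamE //; case: ifP => cN1; first by have [g1 g2] := gQ c (ltac:(lia)); rewrite g1 g2.
by have -> : c = N.-1 by lia.
Qed.

(** * The three differentials *)

Definition tau (g : W) : A := \sum_p at_ g (jend p) (bJ p) * star p.

(** [d0] is the commutator with right multiplication by each arrow; [d1] applies the Leibniz rule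
    for such commutators to the relations U V - V U; [d2] is the splice Q2 -> A^sg -> Q0, namely
    [tau] followed by left multiplication. *)
Definition d0 (g : W) : W := wfam n (fun c x =>
  at_ g c.+1 (x * U c) - at_ g c x * U c).
Definition d1 (g : W) : W := wfam n (fun c x =>
  at_ g (N.-1 - c.+1)%N (x * U c) + at_ g c x * V c.+1
  - at_ g c.-1 (x * V c) - at_ g (N.-1 - c)%N x * U c.-1).
Definition d2 (g : W) : W := wfam n (fun c x => tau g * x * E c).

Lemma lin_tau : linear tau.
Proof. by rewrite /tau; lin_fam. Qed.

Lemma d0E g c x : (c < N)%N -> at_ (d0 g) c x = at_ g c.+1 (x * U c) - at_ g c x * U c.
Proof. by move=> cN; rewrite wfamE //; lin_fam. Qed.
Lemma d1E g c x : (c < N)%N -> at_ (d1 g) c x =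
  at_ g (N.-1 - c.+1)%N (x * U c) + at_ g c x * V c.+1
  - at_ g c.-1 (x * V c) - at_ g (N.-1 - c)%N x * U c.-1.
Proof. by move=> cN; rewrite wfamE //; lin_fam. Qed.
Lemma d2E g c x : (c < N)%N -> at_ (d2 g) c x = tau g * x * E c.
Proof. by move=> cN; rewrite wfamE //; lin_fam. Qed.

Lemma d0_lin : linear d0.
Proof. by apply: wfam_lin => // [g c cN|c x cN]; lin_fam. Qed.
Lemma d1_lin : linear d1.
Proof. by apply: wfam_lin => // [g c cN|c x cN]; lin_fam. Qed.
Lemma d2_lin : linear d2.
Proof. by apply: wfam_lin => // [g c cN|c x cN]; lin_fam; apply: lin_tau. Qed.

Definition tw (s : bool) (x : A) := if s then sg x else x.
Lemma tw_lin s : linear (tw s). Proof. by case: s => //; apply: sgL. Qed.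
Lemma twK s : involutive (tw s). Proof. by case: s => // x; apply: (sa_sgK sa). Qed.
Lemma twM s x y : tw s (x * y) = tw s x * tw s y.
Proof. by case: s; rewrite /tw ?(sa_sgM sa). Qed.
Lemma twE s c : (c < N)%N -> tw s (E c) = E c.
Proof. by move=> cN; case: s; rewrite /tw ?(sa_sgE sa). Qed.

Definition lact (a : A) (g : W) : W := wfam n (fun c x => a * at_ g c x).
Definition ract s (a : A) (g : W) : W := wfam n (fun c x => at_ g c (tw s a * x)).

Lemma lactE a g c x : (c < N)%N -> at_ (lact a g) c x = a * at_ g c x.
Proof. by move=> cN; rewrite wfamE //; lin_fam. Qed.
Lemma ractE s a g c x : (c < N)%N -> at_ (ract s a g) c x = at_ g c (tw s a * x).
Proof. by move=> cN; rewrite wfamE //; lin_fam. Qed.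

Lemma bimod_fam s : bimod lact (ract s).
Proof.
split=> [a k g h|w k a b|a k g h|w k a b|a b w|a b w|a b w];
  apply: fam_ext => // c x cN; rewrite ?atD ?lactE ?ractE ?lactE ?ractE ?atD //.
- by rewrite mulrDr scalerAr.
- by rewrite mulrDl scalerAl.
- by rewrite tw_lin mulrDl -scalerAl linearP.
- by rewrite mulrA.
- by rewrite twM mulrA.
Qed.

Lemma Q02_lact b a g : g \in Q02 b -> lact a g \in Q02 b.
Proof.
move=> /mem_Q02 gQ; apply/mem_Q02 => c cN; have [g1 g2 g3] := gQ c cN.
split=> x; rewrite !lactE ?g1 //; try lia; first by rewrite -mulrA g2.
by rewrite g3 !mulrA commr_sign.
Qed.

Lemma Q02_ract b s a g : g \in Q02 b -> ract s a g \in Q02 b.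
Proof.
move=> /mem_Q02 gQ; apply/mem_Q02 => c cN; have [g1 g2 g3] := gQ c cN.
by split=> x; rewrite !ractE ?mulrA ?g1 ?g2 ?g3 //; lia.
Qed.

Lemma Q1_lact a g : g \in Q1 -> lact a g \in Q1.
Proof.
move=> /mem_Q1[gQ g0]; apply/mem_Q1; split=> [c cN|x].
  have [g1 g2] := gQ c cN.
  by split=> x; rewrite !lactE -?mulrA ?g1 ?g2 //; lia.
by rewrite lactE ?g0 ?mulr0 //; lia.
Qed.

Lemma Q1_ract s a g : g \in Q1 -> ract s a g \in Q1.
Proof.
move=> /mem_Q1[gQ g0]; apply/mem_Q1; split=> [c cN|x].
  have [g1 g2] := gQ c cN.
  by split=> x; rewrite !ractE ?mulrA ?g1 ?g2 //; lia.
by rewrite ractE ?g0 //; lia.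
Qed.

Lemma d0_lact a g : d0 (lact a g) = lact a (d0 g).
Proof.
apply: fam_ext => // c x cN; rewrite lactE // !d0E // (lactE _ _ _ cN).
have [cN1|cN1] := ltnP c.+1 N; first by rewrite lactE // mulrBr mulrA.
rewrite (strip_out sr); last lia.
by rewrite !mulr0 !linear0 !addr0 ?mulr0.
Qed.

Lemma d0_ract s a g : d0 (ract s a g) = ract s a (d0 g).
Proof.
apply: fam_ext => // c x cN; rewrite ractE // !d0E // (ractE _ _ _ _ cN).
have [cN1|cN1] := ltnP c.+1 N; first by rewrite ractE // mulrA.
rewrite (strip_out sr); last lia.
by rewrite !mulr0 !linear0 !addr0 ?mulr0.
Qed.

Lemma d1_lact a g : d1 (lact a g) = lact a (d1 g).
Proof.
apply: fam_ext => // c x cN; rewrite lactE // !d1E // !lactE //; try lia.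
by rewrite !mulrBr mulrDr !mulrA.
Qed.

Lemma d1_ract s a g : d1 (ract s a g) = ract s a (d1 g).
Proof.
by apply: fam_ext => // c x cN; rewrite ractE // !d1E // !ractE ?mulrA //; lia.
Qed.

Lemma jendN p : (@jend n p < N)%N.
Proof. by have [h1 h2 h3] := idxP p; rewrite /jend; lia. Qed.

Lemma d2_lact a g : d2 (lact a g) = lact a (d2 g).
Proof.
apply: fam_ext => // c x cN; rewrite lactE // !d2E // !mulrA; congr (_ * _ * _).
rewrite /tau mulr_sumr; apply: eq_bigr => p _.
by rewrite lactE ?mulrA //; apply: jendN.
Qed.

(* On an antisymmetric family, tau is the Casimir sum of a single map
   precomposed with sg. *)
Lemma tau_fold g : g \in Q02 true ->
  tau g = \sum_p (\sum_(i < n) at_ g (n + i) (sg (bJ p))) * star p.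
Proof.
move=> /mem_Q02 gQ; apply: eq_bigr => p _; congr (_ * _).
have [h1 h2 h3] := idxP p; have eN := jendN p.
have [i iE] : exists i : 'I_n, (n + i = maxn (jend p) (N.-1 - jend p))%N.
  exists (Ordinal (ltac:(lia) : maxn (jend p) (N.-1 - jend p) - n < n)%N) => /=; lia.
have pE : bJ p * E (jend p) = bJ p by rewrite /bJ (TE sr).
rewrite (bigD1 i) //= big1 ?addr0 => [|j ji].
  rewrite iE sg_bJ; case: ifP => en.
    have -> : maxn (jend p) (N.-1 - jend p) = (N.-1 - jend p)%N by lia.
    by have [_ _ ->] := gQ _ eN; rewrite linearN mulN1r opprK.
  by have -> : maxn (jend p) (N.-1 - jend p) = jend p by lia.
have [g1 _ _] := gQ (n + j)%N (ltac:(rewrite ltn_add2l; apply: ltn_ord)).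
rewrite -g1; suff -> : sg (bJ p) * E (n + j)%N = 0 by rewrite linear0.
have nij : (n + j)%N != (n + i)%N by rewrite eqn_add2l.
have jn := ltn_ord j.
have z : bJ p * E (n + j)%N = 0.
  rewrite -pE -mulrA (strip_mul sr) //; last lia.
  have -> : (n + j == jend p)%N = false by lia.
  have -> : (n + j == N.-1 - jend p)%N = false by lia.
  by rewrite mulr0.
by rewrite sg_bJ; case: ifP => _; rewrite ?mulNr z ?oppr0.
Qed.

(** [tau_fold] leaves one [sg] inside the Casimir sum, so a right action twisted by [s] comes out
    twisted by [~~ s]. This is where the second half of the period starts. *)
Lemma tau_ract s a g : g \in Q02 true -> tau (ract s a g) = tau g * tw (~~ s) a.
Proof.
move=> gQ; rewrite !tau_fold ?Q02_ract //.
pose h x := \sum_(i < n) at_ g (n + i) (sg x).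
have hl : linear h by rewrite /h; lin_fam.
have := casimir (tw (~~ s) a) hl.
rewrite /h mulr_suml => caseq; under [RHS]eq_bigr do rewrite -mulrA.
rewrite -[RHS]caseq; apply: eq_bigr => p _; congr (_ * _); apply: eq_bigr => i _.
rewrite ractE ?ltn_add2l //; congr (at_ _ _ _); rewrite (sa_sgM sa); congr (_ * _).
by case: (s) => //=; rewrite (sa_sgK sa).
Qed.

Lemma d2_ract s a g : g \in Q02 true -> d2 (ract s a g) = ract (~~ s) a (d2 g).
Proof.
move=> gQ; apply: fam_ext => // c x cN.
by rewrite ractE // !d2E // tau_ract // !mulrA.
Qed.

(** The retraction required by [contr]: [G] absorbs the argument x, up to the twist, and the family
    it returns is evaluated at the idempotent. *)
Definition rho s (G : A -> W) : W := wfam n (fun c x => at_ (G (tw s x * E c)) c (E c)).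

Lemma rho_lin_x s (G : A -> W) c : linear G -> linear (fun x => at_ (G (tw s x * E c)) c (E c)).
Proof. by move=> lG k x y; rewrite tw_lin mulrDl -scalerAl lG atD. Qed.

Lemma rhoE s (G : A -> W) c x : (c < N)%N -> linear G ->
  at_ (rho s G) c x = at_ (G (tw s x * E c)) c (E c).
Proof. by move=> cN lG; rewrite wfamE //; apply: rho_lin_x. Qed.

Lemma rho_lin s k (G1 G2 : A -> W) : linear G1 -> linear G2 ->
  rho s (fun z => k *: G1 z + G2 z) = k *: rho s G1 + rho s G2.
Proof.
move=> l1 l2; apply: fam_ext => // c x cN; rewrite atD !rhoE ?atD //.
by move=> a u v; rewrite l1 l2 !scalerDr !scalerA addrACA mulrC.
Qed.

Lemma rho_l s a (G : A -> W) : linear G -> rho s (fun z => lact a (G z)) = lact a (rho s G).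
Proof.
move=> lG; apply: fam_ext => // c x cN; rewrite lactE // !rhoE ?lactE //.
by move=> k u v; rewrite lG (bimod_l_lin (bimod_fam s)).
Qed.

Lemma rho_r s a (G : A -> W) : linear G -> rho s (fun z => G (a * z)) = ract s a (rho s G).
Proof.
move=> lG; apply: fam_ext => // c x cN; rewrite ractE // !rhoE //.
  by rewrite twM twK mulrA.
by move=> k u v; rewrite mulrDr -scalerAr lG.
Qed.

Lemma rho_id s (w : W) : (forall c x, (c < N)%N -> at_ w c (x * E c) = at_ w c x) ->
  rho s (fun z => ract s z w) = w.
Proof.
move=> wE; apply: fam_ext => // c x cN; rewrite rhoE //; last first.
  by move=> k u v; rewrite (bimod_r_linl (bimod_fam s)).
by rewrite ractE // twM twK twE // -mulrA (E_idem sr) // wE.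
Qed.

Lemma rho_Q02 b s (G : A -> W) : linear G -> (forall z, G z \in Q02 b) -> rho s G \in Q02 b.
Proof.
move=> lG GQ; apply/mem_Q02 => c cN; split=> x.
- by rewrite !rhoE // twM twE // -mulrA (E_idem sr).
- by rewrite rhoE //; have /mem_Q02/(_ c cN)[_ -> _] := GQ (tw s x * E c).
rewrite !rhoE //; last lia.
by rewrite (strip_flip sr) //; have /mem_Q02/(_ c cN)[_ _ ->] := GQ (tw s x * E c).
Qed.

Lemma rho_Q1 s (G : A -> W) : linear G -> (forall z, G z \in Q1) -> rho s G \in Q1.
Proof.
move=> lG GQ; apply/mem_Q1; split=> [c cN|x]; last first.
  rewrite rhoE //; last lia.
  by have /mem_Q1[_ ->] := GQ (tw s x * E N.-1).
have cN' := ltnW cN; split=> x.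
  by rewrite !rhoE // twM twE // -mulrA (E_idem sr).
by rewrite rhoE //; have /mem_Q1[/(_ c cN)[_ ->]] := GQ (tw s x * E c).
Qed.

Lemma bJ_E p d : (d < N)%N ->
  bJ p * E d = if (d == jend p) || (d == N.-1 - jend p)%N then bJ p else 0.
Proof. by move=> dN; have [h1 h2 h3] := idxP p; rewrite /bJ (TE_if sr). Qed.

Lemma bJ_U p : bJ p * U (jend p) = Tc (ja p) (ju p).+1 (jv p).
Proof. by have [h1 h2 h3] := idxP p; rewrite /bJ /jend (TU sr) //; lia. Qed.

Lemma bJ_V p : bJ p * V (jend p) = Tc (ja p) (ju p) (jv p).+1.
Proof. by rewrite /bJ /jend TSv. Qed.

Lemma fam_ext_bJ (g h : W) :
    (forall c x, (c < N)%N -> at_ g c (x * E c) = at_ g c x) ->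
    (forall c x, (c < N)%N -> at_ h c (x * E c) = at_ h c x) ->
    (forall p, at_ g (jend p) (bJ p) = at_ h (jend p) (bJ p)) ->
    (forall p, at_ g (N.-1 - jend p)%N (bJ p) = at_ h (N.-1 - jend p)%N (bJ p)) ->
  g = h.
Proof.
move=> gE hE gh gh'; apply: fam_ext => // c x cN.
apply: (linear_bJ (f := at_ g c) (g := at_ h c)) => [a u v|a u v|p].
- by rewrite linearP.
- by rewrite linearP.
rewrite -gE // -hE // bJ_E //; case: ifP => [/orP[/eqP ->|/eqP ->]|_] //.
by rewrite !linear0.
Qed.

Definition bmap (F : nat -> nat -> nat -> A) : 'End(A) :=
  linfun (fun x => \sum_p jc p x *: F (ja p) (ju p) (jv p)).

Lemma bmap_bJ F p : bmap F (bJ p) = F (ja p) (ju p) (jv p).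
Proof.
rewrite linfun_lin => [|c x y]; last first.
  rewrite scaler_sumr -big_split; apply: eq_bigr => q _ /=.
  by rewrite (sa_jc_lin sa) scalerDl scalerA.
rewrite (bigD1 p) //= (sa_jcT sa) eqxx scale1r big1 ?addr0 // => q /negbTE qp.
by rewrite (sa_jcT sa) qp scale0r.
Qed.

Lemma bmap_T F a u v : (n <= a)%N -> (a < N)%N ->
  bmap F (Tc a u v) = if (a + u < N)%N && (v <= a)%N then F a u v else 0.
Proof.
move=> na aN; case: ifP => [/andP[uN va]|/negbT out].
  by have [p [pa pu pv]] := idx_exists na uN va; rewrite -pa -pu -pv -/(bJ p) bmap_bJ.
have [->|/(T_nz_range sr aN)] := eqVneq (Tc a u v) 0; first by rewrite linear0.
by rewrite (negbTE out).
Qed.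

Lemma Q02_xE b g c x : g \in Q02 b -> (c < N)%N -> at_ g c (x * E c) = at_ g c x.
Proof. by move=> /mem_Q02 gQ cN; have [-> _ _] := gQ c cN. Qed.
Lemma Q02_Ex b g c x : g \in Q02 b -> (c < N)%N -> at_ g c x * E c = at_ g c x.
Proof. by move=> /mem_Q02 gQ cN; have [_ -> _] := gQ c cN. Qed.
Lemma Q02_flip b g c x : g \in Q02 b -> (c < N)%N ->
  at_ g (N.-1 - c)%N x = (-1) ^+ b * at_ g c x.
Proof. by move=> /mem_Q02 gQ cN; have [_ _ ->] := gQ c cN. Qed.
Lemma Q1_top g x : g \in Q1 -> at_ g N.-1 x = 0.
Proof. by move=> /mem_Q1[_ ->]. Qed.
Lemma Q1_xE g c x : g \in Q1 -> (c < N)%N -> at_ g c (x * E c) = at_ g c x.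
Proof.
move=> gQ cN; have [cN1|cN1] := ltnP c.+1 N; last first.
  have -> : c = N.-1 by lia.
  by rewrite !Q1_top.
by case/(mem_Q1): gQ => /(_ c cN1)[-> _].
Qed.
Lemma Q1_Ex g c x : g \in Q1 -> (c.+1 < N)%N -> at_ g c x * E c.+1 = at_ g c x.
Proof. by case/mem_Q1 => gQ _ cN; have [_ ->] := gQ c cN. Qed.

Lemma V_El c : (c < N)%N -> E c * V c = V c.
Proof. by move=> cN; rewrite -(strip_flip sr cN) (U_El sr) //; lia. Qed.

Lemma d0_Q g : g \in Q02 false -> d0 g \in Q1.
Proof.
move=> gQ; apply/mem_Q1; split=> [c cN|x].
  have cN' := ltnW cN; split=> x; rewrite !d0E //.
    by rewrite -mulrA (U_El sr) // (Q02_xE _ gQ).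
  by rewrite mulrBl (Q02_Ex _ gQ) // -mulrA (U_Er sr).
rewrite d0E; last lia.
by rewrite (strip_out sr (leqnn _)) !mulr0 linear0 subrr.
Qed.

(** Antisymmetry holds because the relation U V - V U changes sign under c |-> 2n-1-c. The end
    vertices 0 and 2n-1 are separate cases, since a neighbour is missing there. *)
Lemma d1_Q g : g \in Q1 -> d1 g \in Q02 true.
Proof.
move=> gQ; apply/mem_Q02 => c cN.
have VE : V c * E c.-1 = V c.
  have [->|c0] := posnP c; first by rewrite (strip_out sr) ?mul0r //; lia.
  by rewrite (V_Er sr) //; lia.
have UE : U c.-1 * E c = if c == 0%N then U c.-1 * E c else U c.-1.
  by case: eqP => // c0; rewrite -[c in E c]prednK ?(U_Er sr) //; lia.
split=> x; rewrite !d1E //; try lia.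
- have h : at_ g (N.-1 - c)%N (x * E c) = at_ g (N.-1 - c)%N x.
    by rewrite -(strip_flip sr cN) (Q1_xE _ gQ) //; lia.
  by rewrite -!mulrA (U_El sr) // (V_El cN) h (Q1_xE _ gQ).
- rewrite !mulrBl mulrDl -!mulrA.
  congr (_ + _ - _ - _).
  + have [cN1|cN1] := ltnP c.+1 N; last first.
      by rewrite (strip_out sr) ?mulr0 ?linear0 ?mul0r //; lia.
    rewrite -(strip_flip sr) //; have -> : (N.-1 - c = (N.-1 - c.+1).+1)%N by lia.
    by rewrite (Q1_Ex _ gQ) //; lia.
  + have [cN1|cN1] := ltnP c.+1 N; first by rewrite (V_Er sr (d := c.+1)).
    have -> : c = N.-1 by lia.
    by rewrite (Q1_top _ gQ) !mul0r.
  + have [->|c0] := posnP c.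
      by rewrite subn0 (strip_out sr) // !mulr0 !linear0 mul0r.
    rewrite -[c in E c]prednK // (Q1_Ex _ gQ) //; lia.
  have [->|c0] := posnP c; first by rewrite subn0 (Q1_top _ gQ) !mul0r.
  by rewrite -[c in E c]prednK // (U_Er sr) //; lia.
rewrite expr1 mulN1r.
have -> : (N.-1 - (N.-1 - c) = c)%N by lia.
have [c0|c0] := posnP c.
  rewrite c0 subn0.
  have -> : V (N.-1).+1 = U 0 by congr U; lia.
  have -> : (N.-1 - N.-1.+1 = 0)%N by lia.
  rewrite (strip_out sr (leqnn _)) !mulr0 !linear0 !(Q1_top _ gQ) !mul0r !subr0 !add0r.
  have -> : (N.-1.-1 = N.-1 - 1)%N by lia.
  by rewrite addr0 opprD.
have [cN1|cN1] := ltnP c.+1 N; last first.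
  have -> : c = N.-1 by lia.
  rewrite subnn (strip_out sr (leqnn _)) !mulr0 !linear0 !(Q1_top _ gQ) !mul0r !subr0 !add0r.
  rewrite addr0 opprD !opprK; congr (_ + _).
    by have -> : (N.-1 - 1 = N.-2)%N by lia.
  by congr (_ * U _); lia.
have -> : (N.-1 - (N.-1 - c).+1 = c.-1)%N by lia.
have -> : ((N.-1 - c).-1 = N.-1 - c.+1)%N by lia.
by rewrite !opprB addrA opprD addrA [in RHS](addrC (_ * _) (at_ _ _ _)).
Qed.

Lemma d2_Q g : d2 g \in Q02 false.
Proof.
apply/mem_Q02 => c cN; split=> x; rewrite !d2E //; try lia.
- by rewrite -!mulrA (E_idem sr).
- by rewrite -!mulrA (E_idem sr).
by rewrite (strip_flip sr) // mul1r.
Qed.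

Lemma at0 c x : at_ (0 : W) c x = 0.
Proof. by rewrite /at_ ffunE zero_lfunE. Qed.

Lemma UV_comm c : (c < N)%N -> U c * V c.+1 = V c * U c.-1.
Proof.
have [->|c0] := posnP c; last by move=> cN; apply: (strip_comm sr); rewrite c0.
by move=> _; rewrite (UV_zero sr) // (V_zero_out sr) ?mul0r.
Qed.

Lemma d0_d2 g : d0 (d2 g) = 0.
Proof.
apply: fam_ext => // c x cN; rewrite d0E // at0.
have [cN1|cN1] := ltnP c.+1 N; last first.
  rewrite (strip_out sr (c := c)); last lia.
  by rewrite !mulr0 !linear0 addr0.
by rewrite !d2E // -!mulrA (U_Er sr) // (U_El sr) // subrr.
Qed.

(** Applied to commutators, the Leibniz sum along a path w of length two telescopes to g(x w) - g(x)
    w, and both sides of a relation give the same w. *)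
Lemma d1_d0 g : g \in Q02 false -> d1 (d0 g) = 0.
Proof.
move=> gQ; apply: fam_ext => // c x cN; rewrite d1E // at0.
have flip d y : (d < N)%N -> at_ g (N.-1 - d)%N y = at_ g d y.
  by move=> dN; rewrite (Q02_flip _ gQ) // mul1r.
have -> : at_ (d0 g) (N.-1 - c.+1) (x * U c) + at_ (d0 g) c x * V c.+1 =
    at_ g c (x * U c * V c.+1) - at_ g c x * U c * V c.+1.
  have [cN1|cN1] := ltnP c.+1 N; last first.
    have e0 : U c = 0 by apply: (strip_out sr); lia.
    have z : at_ (d0 g) c x = 0 by rewrite d0E // e0 !mulr0 linear0 subrr.
    by rewrite z e0 !(mulr0, mul0r, linear0).
  rewrite !d0E //; last lia.
  have -> : ((N.-1 - c.+1).+1 = N.-1 - c)%N by lia.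
  by rewrite !flip // mulrBl addrA subrK.
rewrite -addrA -opprD; have -> : at_ (d0 g) c.-1 (x * V c) + at_ (d0 g) (N.-1 - c) x * U c.-1 =
    at_ g c (x * V c * U c.-1) - at_ g c x * V c * U c.-1.
  have [c0|c0] := posnP c.
    rewrite c0 (V_zero_out sr) !mulr0 !mul0r !linear0 add0r d0E; last lia.
    rewrite subn0 (strip_out sr (leqnn _)) !mulr0 !linear0.
    by rewrite !(addr0, mul0r, mulr0, linear0, oppr0).
  rewrite !d0E //; try lia.
  rewrite prednK //; have -> : ((N.-1 - c).+1 = N.-1 - c.-1)%N by lia.
  by rewrite !flip // ?mulrBl ?addrA ?subrK //; lia.
by rewrite -!mulrA UV_comm // subrr.
Qed.

Lemma d1_T g a u v : (n <= a)%N -> (a + u < N)%N -> (v <= a)%N ->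
  at_ (d1 g) (a + u - v) (Tc a u v) =
  at_ g (N.-1 - (a + u.+1 - v)) (Tc a u.+1 v) + at_ g (a + u - v) (Tc a u v) * V (a + u - v).+1
  - at_ g (a + u - v.+1) (Tc a u v.+1) - at_ g (N.-1 - (a + u - v)) (Tc a u v) * U (a + u - v).-1.
Proof.
move=> na uN va; rewrite d1E; last lia.
rewrite (TU sr); last lia.
rewrite -TSv; have -> : (a + u.+1 - v = (a + u - v).+1)%N by lia.
by have -> : (a + u - v.+1 = (a + u - v).-1)%N by lia.
Qed.

Lemma tauE g : tau g = \sum_(i < n) \sum_(u < n - i) \sum_(v < (n + i).+1)
  at_ g (n + i + u - v) (Tc (n + i) u v) *
    Tc (n + i + u - v) (N.-1 - (n + i) - u) (n + i - v).
Proof.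
exact: (big_idx _ _ (fun a u v => at_ g (a + u - v) (Tc a u v) *
  Tc (a + u - v) (N.-1 - a - u) (a - v))).
Qed.

(** Multiplication by the dual path absorbs the outer arrow of each term of [d1]. The four terms
    then become a difference in v of [X] and one in u of [Y], and both sums telescope. The boundary
    terms leave the strip or sit at index 2n-1, where members of [Q1] vanish. *)
Lemma tau_d1 g : g \in Q1 -> tau (d1 g) = 0.
Proof.
move=> gQ; rewrite tauE big1 // => i _.
set a := (n + i)%N; have na : (n <= a)%N by apply: leq_addr.
have aN : (a < N)%N by rewrite ltn_add2l.
have -> : (n - i = (N.-1 - a).+1)%N by lia.
clearbody a; set top := (N.-1 - a)%N.
pose X u v := at_ g (a + u - v) (Tc a u v) * Tc (a + u - v).+1 (top - u) (a - v).+1.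
pose Y u v := at_ g (N.-1 - (a + u - v)) (Tc a u v) * Tc (a + u - v).-1 (top - u).+1 (a - v).
have termE u v : (u < top.+1)%N -> (v < a.+1)%N ->
    at_ (d1 g) (a + u - v) (Tc a u v) * Tc (a + u - v) (N.-1 - a - u) (a - v) =
    (X u v - X u v.+1) + (Y u.+1 v - Y u v).
  move=> ut va; rewrite d1_T //; try lia.
  set d := (a + u - v)%N; set S := Tc d _ _.
  have -> : X u v = at_ g d (Tc a u v) * V d.+1 * S.
    rewrite /X -/d; have [dN|dN] := ltnP d.+1 N; last first.
      have -> : d = N.-1 by lia.
      by rewrite (Q1_top _ gQ) !mul0r.
    by rewrite -mulrA (VT sr).
  have -> : X u v.+1 = at_ g (a + u - v.+1) (Tc a u v.+1) * S.
    rewrite /X; have [va'|va'] := ltnP v a; last first.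
      by rewrite [Tc a u v.+1](T_oob_v sr) // linear0 !mul0r.
    by congr (_ * Tc _ _ _); lia.
  have -> : Y u.+1 v = at_ g (N.-1 - (a + u.+1 - v)) (Tc a u.+1 v) * S.
    rewrite /Y; have [ut'|ut'] := ltnP u top; last first.
      by rewrite [Tc a u.+1 v](T_oob_u sr) ?linear0 ?mul0r //; lia.
    by congr (_ * Tc _ _ _); lia.
  have -> : Y u v = at_ g (N.-1 - d) (Tc a u v) * U d.-1 * S.
    rewrite /Y -/d; have [d_eq0|dpos] := posnP d.
      by rewrite d_eq0 subn0 (Q1_top _ gQ) !mul0r.
    have -> : S = Tc d.-1.+1 (N.-1 - a - u) (a - v) by rewrite prednK.
    by rewrite -mulrA (UT sr) //; lia.
  rewrite !mulrBl mulrDl [X in X - _ - _]addrC -!addrA; congr (_ + _).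
  by rewrite addrCA.
under eq_bigr => u _ do under eq_bigr => v _ do rewrite termE //.
under eq_bigr => u _ do rewrite big_split.
rewrite big_split /= [X in _ + X]exchange_big /= !big1 ?addr0 // => [v _|u _].
  rewrite -(big_mkord predT (fun u => Y u.+1 v - Y u v)) telescope_sumr //.
  have -> : Y top.+1 v = 0.
    by rewrite /Y [Tc a _ v](T_oob_u sr) ?linear0 ?mul0r //; lia.
  have va := ltn_ord v; rewrite /Y addn0 subn0; have [va'|va'] := ltnP v a.
    by rewrite (@T_oob_v _ _ E U sr (a - v).-1) ?mulr0 ?subr0 //; lia.
  have -> : (a - v = 0)%N by lia.
  by rewrite subn0 (Q1_top _ gQ) mul0r subr0.
under eq_bigr => v _ do rewrite -opprB.
rewrite sumrN -(big_mkord predT (fun v => X u v.+1 - X u v)) telescope_sumr //.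
have -> : X u a.+1 = 0 by rewrite /X [Tc a u _](T_oob_v sr) // linear0 mul0r.
have ut := ltn_ord u; rewrite /X subn0; have [uN|uN] := ltnP (a + u).+1 N.
  by rewrite (@T_oob_u _ _ E U sr (a + u).+1) ?mulr0 ?subr0 ?oppr0 //; lia.
have -> : (a + u = N.-1)%N by lia.
by rewrite (Q1_top _ gQ) mul0r subr0 oppr0.
Qed.

Lemma d2_d1 g : g \in Q1 -> d2 (d1 g) = 0.
Proof.
move=> gQ; apply: fam_ext => // c x cN.
by rewrite d2E // tau_d1 // !mul0r at0.
Qed.

(** * Exactness of the coresolution *)

Definition iota_fam (lam : A) : W := wfam n (fun c x => lam * x * E c).

Lemma iota_famE lam c x : (c < N)%N -> at_ (iota_fam lam) c x = lam * x * E c.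
Proof. by move=> cN; rewrite wfamE //; lin_fam. Qed.

Lemma iota_fam_lin : linear iota_fam.
Proof.
move=> k x y; apply: fam_ext => // c z cN.
by rewrite atD !iota_famE // !mulrDl -!scalerAl.
Qed.

Lemma d2_iota g : d2 g = iota_fam (tau g).
Proof. by apply: fam_ext => // c x cN; rewrite d2E // iota_famE. Qed.

Lemma sum_E_mul (f : nat -> A) a : (n <= a < N)%N ->
  (forall c, (c < N)%N -> f c * E c = f c) -> (\sum_(i < n) f (n + i)%N) * E a = f a.
Proof.
move=> /andP[na aN] fE; have an : (a - n < n)%N by lia.
rewrite mulr_suml (bigD1 (Ordinal an)) //= subnKC // fE // big1 ?addr0 // => j ji.
have jn := ltn_ord j; rewrite -fE; last lia.
have ja' : (j : nat) != (a - n)%N by [].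
rewrite -mulrA (strip_mul sr) //; last lia.
have -> : (a == n + j)%N = false by lia.
have -> : (a == N.-1 - (n + j))%N = false by lia.
by rewrite mulr0.
Qed.

(** Commuting with all arrows means right A-linearity, so [g] is left multiplication by its value at
    1, here the sum of the values over the vertices. *)
Lemma exact_Q0 g : g \in Q02 false -> d0 g = 0 -> exists lam, g = iota_fam lam.
Proof.
move=> gQ dg; pose lam := \sum_(i < n) at_ g (n + i) 1; exists lam.
have d0g c x : (c < N)%N -> at_ g c.+1 (x * U c) = at_ g c x * U c.
  by move=> cN; apply/eqP; rewrite -subr_eq0 -d0E // dg at0.
have flip d y : (d < N)%N -> at_ g (N.-1 - d)%N y = at_ g d y.
  by move=> dN; rewrite (Q02_flip _ gQ) // mul1r.
have key a u v : (n <= a)%N -> (a + u < N)%N -> (v <= a)%N ->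
    at_ g (a + u - v) (Tc a u v) = lam * Tc a u v.
  move=> na uN; elim: v => [_|v IH va].
    rewrite subn0; elim: u uN => [|u IH] uN.
      rewrite T00 addn0 /lam (sum_E_mul (f := fun c => at_ g c 1)) ?na //; try lia.
        by rewrite -[E a]mul1r (Q02_xE _ gQ) //; lia.
      by move=> c cN; rewrite (Q02_Ex _ gQ).
    rewrite TSu0 addnS d0g; last lia.
    by rewrite IH ?mulrA //; lia.
  rewrite TSv -(flip (a + u - v.+1)%N); last lia.
  have -> : (N.-1 - (a + u - v.+1) = (N.-1 - (a + u - v)).+1)%N by lia.
  rewrite d0g; last lia.
  by rewrite flip ?IH ?mulrA //; lia.
apply: fam_ext_bJ => [c x cN|c x cN|p|p].
- by rewrite (Q02_xE _ gQ).
- by rewrite !iota_famE // -!mulrA (E_idem sr).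
- have [h1 h2 h3] := idxP p; rewrite iota_famE; last by rewrite /jend; lia.
  by rewrite -mulrA bJ_E ?eqxx ?orTb /jend; [rewrite /bJ key|lia].
have [h1 h2 h3] := idxP p.
have eN : (jend p < N)%N by rewrite /jend; lia.
rewrite iota_famE; last lia.
by rewrite flip // -mulrA bJ_E ?eqxx ?orbT; [rewrite /bJ /jend key|lia].
Qed.

(** The family sends each socle path from a to lam e_a and the other basis paths to 0. The dual of a
    socle path is an idempotent, so the Casimir sum is lam times the sum of the e_a. Socle paths end
    in the lower half, where the sign in [h] is +1. *)
Lemma tau_surj lam : exists2 h, h \in Q02 true & tau h = lam.
Proof.
pose F a u v := if (u == N.-1 - a)%N && (v == a) then lam * E a else 0.
pose h : W := wfam n (fun c x => (-1) ^+ (n <= c)%N * (bmap F (x * E c) * E c)).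
have hE c x : (c < N)%N -> at_ h c x = (-1) ^+ (n <= c)%N * (bmap F (x * E c) * E c).
  by move=> cN; rewrite wfamE //; lin_fam.
exists h.
  apply/mem_Q02 => c cN; split=> x; rewrite !hE //; try lia.
  - by rewrite -[x * _ * _]mulrA (E_idem sr).
  - by rewrite -!mulrA (E_idem sr).
  rewrite (strip_flip sr) // mulrA; congr (_ * _).
  have [nc|nc] := leqP n c.
    have -> : (n <= N.-1 - c)%N = false by lia.
    by rewrite expr0 expr1 mulrNN mulr1.
  have -> : (n <= N.-1 - c)%N by lia.
  by rewrite expr0 expr1 mulr1.
rewrite /tau.
have term p : at_ h (jend p) (bJ p) * star p = (if (ju p == N.-1 - ja p)%N && (jv p == ja p)
    then lam * E (ja p) else 0).
  have [h1 h2 h3] := idxP p; have eN : (jend p < N)%N by rewrite /jend; lia.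
  rewrite hE // bJ_E // eqxx /= bmap_bJ /F.
  case: ifP => [/andP[/eqP ue /eqP ve]|_]; last by rewrite mul0r mulr0 mul0r.
  have je : jend p = (N.-1 - ja p)%N by rewrite /jend; lia.
  rewrite je; have -> : (n <= N.-1 - ja p)%N = false by lia.
  rewrite mul1r /star je ue ve !subnn T00 (strip_flip sr); last lia.
  by rewrite -!mulrA !(E_idem sr) //; lia.
rewrite (eq_bigr _ (fun p _ => term p)).
rewrite (big_idx _ _ (fun a u v => if (u == N.-1 - a)%N && (v == a) then lam * E a else 0)).
rewrite -[RHS]mulr1 -(strip_sum sr) mulr_sumr; apply: eq_bigr => i _.
have iN := ltn_ord i; have tn : (n.-1 - i < n - i)%N by lia.
rewrite (bigD1 (Ordinal tn)) //= [X in _ + X]big1 => [|u ut]; last first.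
  have ut' : (u : nat) != (n.-1 - i)%N by [].
  have -> : (u == N.-1 - (n + i) :> nat)%N = false by lia.
  by rewrite big1.
rewrite addr0 (bigD1 ord_max) //= eqxx big1 => [|v vt]; last first.
  have vt' : (v : nat) != (n + i)%N by [].
  by rewrite (negbTE vt') andbF.
have -> : (n.-1 - i == N.-1 - (n + i))%N by lia.
by rewrite addr0.
Qed.

(* A solution of d0 h = g is obtained by integrating g along the basis paths;
   d1 g = 0 makes it consistent. *)
Section IntegrateQ1.
Variable g : W.
Hypotheses (gQ : g \in Q1) (dg : d1 g = 0).

Fixpoint prim_u a u : A := if u is u'.+1 then
  at_ g (a + u') (Tc a u' 0) + prim_u a u' * U (a + u')%N else 0.
Fixpoint prim a u v : A := if v is v'.+1 then
  at_ g (N.-1 - (a + u - v')) (Tc a u v') + prim a u v' * V (a + u - v') else prim_u a u.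

Let L := bmap prim.

Lemma prim_E a u v : (n <= a)%N -> (a + u < N)%N -> (v <= a)%N ->
  prim a u v * E (a + u - v)%N = prim a u v.
Proof.
move=> na uN; elim: v => [_|v IH va] /=.
  rewrite subn0; elim: u uN => [|u IH] uN /=; first by rewrite mul0r.
  by rewrite mulrDl addnS (Q1_Ex _ gQ) -?mulrA ?(U_Er sr) //; lia.
rewrite mulrDl; congr (_ + _).
  rewrite -(strip_flip sr); last lia.
  have -> : (N.-1 - (a + u - v.+1) = (N.-1 - (a + u - v)).+1)%N by lia.
  by rewrite (Q1_Ex _ gQ) //; lia.
rewrite -mulrA; have -> : (a + u - v.+1 = (a + u - v).-1)%N by lia.
by rewrite (V_Er sr) //; lia.
Qed.

Lemma L_T a u v : (n <= a)%N -> (a + u < N)%N -> (v <= a)%N -> L (Tc a u v) = prim a u v.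
Proof. by move=> na uN va; rewrite bmap_T // ?uN ?va //; lia. Qed.

Lemma L_E a u v : (n <= a < N)%N -> L (Tc a u v) * E (a + u - v)%N = L (Tc a u v).
Proof.
move=> /andP[na aN]; rewrite bmap_T //; case: ifP => [/andP[uN va]|_].
  by rewrite prim_E.
by rewrite mul0r.
Qed.

Let rel a u v : (n <= a)%N -> (a + u < N)%N -> (v <= a)%N ->
  at_ g (a + u - v.+1) (Tc a u v.+1) =
  at_ g (N.-1 - (a + u.+1 - v)) (Tc a u.+1 v) + at_ g (a + u - v) (Tc a u v) * V (a + u - v).+1
  - at_ g (N.-1 - (a + u - v)) (Tc a u v) * U (a + u - v).-1.
Proof.
move=> na uN va; have := d1_T g na uN va; rewrite dg at0 => /esym/eqP.
by rewrite addrAC subr_eq0 => /eqP <-.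
Qed.

Let stepV a u v : (n <= a)%N -> (a + u < N)%N -> (v < a)%N ->
  at_ g (N.-1 - (a + u - v)) (Tc a u v) = L (Tc a u v.+1) - L (Tc a u v) * V (a + u - v)%N.
Proof. by move=> na uN va; rewrite !L_T ?(ltnW va) //= addrK. Qed.

(** For v = 0 this is the definition of [prim_u]. An up step after down steps follows by induction
    on v, [rel] exchanging the last up and down steps. *)
Let stepU a u v : (n <= a)%N -> (a + u < N)%N -> (v <= a)%N ->
  at_ g (a + u - v) (Tc a u v) = L (Tc a u.+1 v) - L (Tc a u v) * U (a + u - v)%N.
Proof.
move=> na uN; elim: v => [_|v IH va].
  rewrite subn0; have [uN1|uN1] := ltnP (a + u).+1 N.
    by rewrite !L_T //= ?addrK // addnS.
  have -> : (a + u = N.-1)%N by lia.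
  rewrite (Q1_top _ gQ) (@T_oob_u _ _ E U sr a u.+1) ?linear0; try lia.
  by rewrite (strip_out sr) ?mulr0 ?subr0.
rewrite rel ?(ltnW va) // IH ?(ltnW va) // (@stepV a u v) //.
have -> : at_ g (N.-1 - (a + u.+1 - v)) (Tc a u.+1 v) =
    L (Tc a u.+1 v.+1) - L (Tc a u.+1 v) * V (a + u - v).+1.
  have [uN1|uN1] := ltnP (a + u.+1) N.
    by rewrite stepV //; congr (_ - _ * V _); lia.
  by rewrite !(@T_oob_u _ _ E U sr a u.+1) ?linear0 ?mul0r ?subr0 //; lia.
have -> : (a + u - v.+1 = (a + u - v).-1)%N by lia.
rewrite !mulrBl -!mulrA UV_comm //; last lia.
by rewrite [X in X - _]addrA subrK opprB addrA subrK.
Qed.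

(** For v = a the next down step leaves the strip, so [prim] does not enforce this equation; the
    relations yield it by induction on u. *)
Let stepV_top a u : (n <= a)%N -> (a + u < N)%N ->
  at_ g (N.-1 - u)%N (Tc a u a) = - (L (Tc a u a) * V u).
Proof.
move=> na; elim: u => [|u IH] uN.
  by rewrite (V_zero_out sr) mulr0 oppr0 subn0 (Q1_top _ gQ).
have uN' : (a + u < N)%N by lia.
have := rel na uN' (leqnn a); have -> : (a + u - a = u)%N by lia.
have -> : (a + u.+1 - a = u.+1)%N by lia.
rewrite (@T_oob_v _ _ E U sr a u a.+1) ?linear0 ?IH //; last lia.
have -> : at_ g u (Tc a u a) = L (Tc a u.+1 a) - L (Tc a u a) * U u.
  by have := stepU na uN' (leqnn a); rewrite addnC addnK.
rewrite !mulrBl !mulNr -!mulrA UV_comm; last lia.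
move=> /esym/eqP; rewrite opprK addrA subrK addr_eq0 => /eqP ->.
by [].
Qed.

Lemma exact_Q1 : exists2 h, h \in Q02 false & g = d0 h.
Proof.
pose h : W := wfam n (fun c x => L (x * E c) * E c).
have hE c x : (c < N)%N -> at_ h c x = L (x * E c) * E c.
  by move=> cN; rewrite wfamE //; lin_fam.
have hQ : h \in Q02 false.
  apply/mem_Q02 => c cN; split=> x; rewrite !hE //; try lia.
  - by rewrite -[x * _ * _]mulrA (E_idem sr).
  - by rewrite -!mulrA (E_idem sr).
  by rewrite (strip_flip sr) // mul1r.
exists h => //; have dhQ := d0_Q hQ.
apply: fam_ext_bJ => [c x cN|c x cN|p|p].
- by rewrite (Q1_xE _ gQ).
- by rewrite (Q1_xE _ dhQ).
- have [h1 h2 h3] := idxP p; have eN : (jend p < N)%N by rewrite /jend; lia.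
  have [eN1|eN1] := ltnP (jend p).+1 N; last first.
    have -> : jend p = N.-1 by lia.
    by rewrite (Q1_top _ gQ) (Q1_top _ dhQ).
  rewrite d0E // bJ_U !hE // bJ_E // eqxx /=.
  have eE : (jend p).+1 = (ja p + (ju p).+1 - jv p)%N by rewrite /jend; lia.
  have aN : (n <= ja p < N)%N by lia.
  rewrite {1}/bJ stepU // eE -mulrA (U_El sr) //; congr (_ - _).
  have -> : Tc (ja p) (ju p).+1 (jv p) * E (ja p + (ju p).+1 - jv p)%N =
      Tc (ja p) (ju p).+1 (jv p).
    have [uN1|uN1] := ltnP (ja p + (ju p).+1) N; first by rewrite (TE sr).
    by rewrite (T_oob_u sr) ?mul0r //; lia.
  by rewrite L_E.
have [h1 h2 h3] := idxP p; have eN : (jend p < N)%N by rewrite /jend; lia.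
have [e0|e0] := posnP (jend p).
  by rewrite e0 subn0 (Q1_top _ gQ) (Q1_top _ dhQ).
rewrite d0E ?bJ_V; last lia.
have aN : (n <= ja p < N)%N by lia.
have eE : (N.-1 - jend p).+1 = (N.-1 - (jend p).-1)%N by lia.
rewrite !hE; try lia.
rewrite eE !(strip_flip sr) // ?bJ_E ?eqxx //; try lia.
have ePv : (jend p).-1 = (ja p + ju p - (jv p).+1)%N by rewrite /jend; lia.
rewrite -[_ * E _ * U _]mulrA V_El //.
have [va|va] := ltnP (jv p) (ja p).
  rewrite ePv (TE sr) // L_E //.
  by rewrite {1}/bJ stepV.
have je : jv p = ja p by lia.
have eu : jend p = ju p by rewrite /jend; lia.
rewrite (T_oob_v sr) ?mul0r ?linear0 ?mul0r ?sub0r; try lia.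
by rewrite eu {1}/bJ je stepV_top // /bJ je.
Qed.

End IntegrateQ1.

(* A solution of d1 g = h, normalised so that its values on a path ending at c
   vanish at index 2n-1-c unless v = a; these remaining values are gV, and
   tau h = 0 makes them consistent. *)
Section IntegrateQ2.
Variable h : W.
Hypotheses (hQ : h \in Q02 true) (th : tau h = 0).

Fixpoint gU a u v : A := if v is v'.+1 then
  gU a u v' * V (a + u - v').+1 - at_ h (a + u - v') (Tc a u v') else 0.
Fixpoint gV a u : A := if u is u'.+1 then
  gV a u' * U u'.-1 + at_ h u' (Tc a u' a) - gU a u' a * V u'.+1 else 0.

Lemma gU_closed a u v : (n <= a)%N -> (a + u < N)%N -> (v <= a.+1)%N ->
  gU a u v = - \sum_(k < v) at_ h (a + u - k) (Tc a u k) * Tc (a + u - k) 0 (v.-1 - k).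
Proof.
move=> na uN; elim: v => [_|v IH va] /=; first by rewrite big_ord0 oppr0.
rewrite big_ord_recr /= subnn T00 (Q02_Ex _ hQ); last lia.
rewrite opprD IH ?(ltnW va) // mulNr mulr_suml; congr (- _ - _).
apply: eq_bigr => k _; have kv := ltn_ord k; rewrite -mulrA; congr (_ * _).
have -> : (v - k = (v.-1 - k).+1)%N by lia.
by rewrite TSv; congr (_ * U _); lia.
Qed.

Lemma gV_closed a u : (n <= a)%N -> (a + u <= N)%N ->
  gV a u = \sum_(l < u) \sum_(k < a.+1)
    at_ h (a + l - k) (Tc a l k) * Tc (a + l - k) (u.-1 - l) (a - k).
Proof.
move=> na; elim: u => [_|u IH uN] /=; first by rewrite big_ord0.
rewrite big_ord_recr /= subnn -addrA; congr (_ + _).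
  rewrite IH ?(ltnW uN) ?mulr_suml //; last by lia.
  apply: eq_bigr => l _; rewrite mulr_suml; apply: eq_bigr => k _.
  have lu := ltn_ord l; have ka := ltn_ord k; rewrite -mulrA; congr (_ * _).
  have -> : (u - l = (u.-1 - l).+1)%N by lia.
  by rewrite -(TU sr); [congr (_ * U _); lia|lia].
have := @gU_closed a u a.+1 na (ltac:(lia)) (leqnn _).
have ua : (a + u - a = u)%N by lia.
by rewrite /= ua => /(congr1 (fun x => - x)); rewrite opprK opprB => <-.
Qed.

(** The equations for [g] force the value 0 once the path leaves the strip at the top; by the closed
    form this value is the component [tau h * E a]. *)
Lemma gV_end a : (n <= a < N)%N -> gV a (N - a) = 0.
Proof.
move=> /andP[na aN]; rewrite gV_closed //; last lia.
transitivity (tau h * E a); last by rewrite th mul0r.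
pose F a' u v := at_ h (a' + u - v) (Tc a' u v) * Tc (a' + u - v) (N.-1 - a' - u) (a' - v).
have FE a' u v : (n <= a' < N)%N -> (a' + u < N)%N -> (v <= a')%N ->
    F a' u v * E a = if a' == a then F a' u v else 0.
  move=> /andP[na' aN'] uN va; rewrite /F -mulrA (TE_if sr); try lia.
  have -> : (a == a' + u - v + (N.-1 - a' - u) - (a' - v))%N = false by lia.
  have -> : (a == N.-1 - (a' + u - v + (N.-1 - a' - u) - (a' - v)))%N = (a' == a) by lia.
  by rewrite orFb; case: ifP; rewrite ?mulr0.
rewrite tauE mulr_suml; have an : (a - n < n)%N by lia.
rewrite (bigD1 (Ordinal an)) //= [X in _ + X]big1 ?addr0 => [|i ia]; last first.
  have ia' : (i : nat) != (a - n)%N by [].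
  have iN := ltn_ord i; rewrite mulr_suml big1 // => u _; rewrite mulr_suml big1 // => v _.
  have uN := ltn_ord u; have vN := ltn_ord v.
  rewrite -/(F (n + i)%N u v) FE; try lia.
  by have -> : (n + i == a)%N = false by lia.
have -> : (n + (a - n) = a)%N by lia.
have -> : (n - (a - n) = N - a)%N by lia.
rewrite mulr_suml; apply: eq_bigr => u _; rewrite mulr_suml; apply: eq_bigr => v _.
have uN := ltn_ord u; have vN := ltn_ord v.
rewrite -/(F a u v) FE ?eqxx /F; try lia.
by congr (_ * Tc _ _ _); lia.
Qed.

Lemma gU_E a u v : (n <= a)%N -> (a + u < N)%N -> (v <= a)%N -> ((a + u - v).+1 < N)%N ->
  gU a u v * E (a + u - v).+1 = gU a u v.
Proof.
move=> na uN; elim: v => [|v IH] va vN /=; first by rewrite mul0r.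
have dE : ((a + u - v.+1).+1 = a + u - v)%N by lia.
rewrite dE mulrBl (Q02_Ex _ hQ); last lia.
congr (_ - _); have [vN'|vN'] := ltnP (a + u - v).+1 N.
  by rewrite -mulrA -[X in E X]/((a + u - v).+1.-1) (V_Er sr).
have -> : v = 0%N by lia.
by rewrite !mul0r.
Qed.

Lemma gV_E a u : (n <= a)%N -> (a + u < N)%N -> gV a u * E u.-1 = gV a u.
Proof.
move=> na; case: u => [|u] uN /=; first by rewrite mul0r.
rewrite mulrBl mulrDl (Q02_Ex _ hQ); last lia.
congr (_ + _ - _).
  case: u uN => [|u] uN; first by rewrite /= !mul0r.
  by rewrite -mulrA (U_Er sr) //; lia.
by rewrite -mulrA -[X in E X]/(u.+1.-1) (V_Er sr) //; lia.
Qed.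

Lemma exact_Q2 : exists2 g, g \in Q1 & h = d1 g.
Proof.
pose F c a u v := if c == (a + u - v)%N then gU a u v
  else if (c == N.-1 - (a + u - v))%N && (v == a) then gV a u else 0.
pose g : W := wfam n (fun c x => bmap (F c) x).
have gE c x : (c < N)%N -> at_ g c x = bmap (F c) x.
  by move=> cN; rewrite wfamE //; lin_fam.
have gUE a u v : (n <= a)%N -> (a + u < N)%N -> (v <= a)%N ->
    at_ g (a + u - v) (Tc a u v) = gU a u v.
  move=> na uN va; rewrite gE; last lia.
  by rewrite bmap_T // ?uN ?va /F ?eqxx //; lia.
have gVE a u v : (n <= a)%N -> (a + u < N)%N -> (v <= a)%N ->
    at_ g (N.-1 - (a + u - v)) (Tc a u v) = if v == a then gV a u else 0.
  move=> na uN va; rewrite gE; last lia.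
  rewrite bmap_T // ?uN ?va /F ?eqxx //=; last lia.
  by have -> : (N.-1 - (a + u - v) == a + u - v)%N = false by lia.
have gQ : g \in Q1.
  have l1 c b : linear (fun x => at_ g c (x * b)) by lin_fam.
  have l2 c b : linear (fun x => at_ g c x * b) by lin_fam.
  have l3 c : linear (fun x => at_ g c x) by lin_fam.
  apply/mem_Q1; split=> [c cN|].
    have cN' := ltnW cN; split.
      apply: (linear_bJ (l1 c (E c)) (l3 c)) => p; rewrite bJ_E //.
      case: ifP => // /negbT; rewrite negb_or => /andP[c1 c2].
      rewrite linear0 gE // bmap_bJ /F.
      by rewrite -/(jend p) (negbTE c1) (negbTE c2).
    apply: (linear_bJ (l2 c (E c.+1)) (l3 c)) => p.
    have [h1 h2 h3] := idxP p; rewrite gE // bmap_bJ /F.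
    case: eqP => [c1|_]; first by rewrite c1 gU_E // -c1.
    case: ifP => [/andP[/eqP c1 /eqP va]|_]; last by rewrite mul0r.
    have c1' : c = (N.-1 - ju p)%N by lia.
    have -> : E c.+1 = E (ju p).-1.
      by rewrite -(strip_flip sr (c := (ju p).-1)); [congr E; lia|lia].
    by rewrite gV_E //; lia.
  have l0 : linear (fun _ : A => 0 : A) by exact: lin0.
  apply: (linear_bJ (l3 N.-1) l0) => p; have [h1 h2 h3] := idxP p.
  rewrite gE ?bmap_bJ /F; last lia.
  case: eqP => [c1|_]; first by have -> : jv p = 0%N by lia.
  case: ifP => [/andP[/eqP c1 /eqP va]|_] //.
  by have -> : ju p = 0%N by lia.
exists g => //; have dgQ := d1_Q gQ.
(* For v < a the recursion of [gU] solves the equation and for v = a that of [gV] does. At the twin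
   index 2n-1-c antisymmetry takes over. *)
have key a u v : (n <= a)%N -> (a + u < N)%N -> (v <= a)%N ->
    at_ h (a + u - v) (Tc a u v) = at_ (d1 g) (a + u - v) (Tc a u v).
  move=> na uN va; rewrite d1_T // (gUE a u v) // (gVE a u v) //.
  have [va'|va'] := ltnP v a.
    have -> : at_ g (N.-1 - (a + u.+1 - v)) (Tc a u.+1 v) = 0.
      have [uN1|uN1] := ltnP (a + u.+1) N; first by rewrite gVE // ltn_eqF.
      by rewrite (T_oob_u sr) ?linear0 //; lia.
    rewrite gUE // ltn_eqF // mul0r subr0 add0r /=.
    by rewrite opprB addrC subrK.
  have -> : v = a by lia.
  have ua : (a + u - a = u)%N by lia.
  rewrite (@T_oob_v _ _ E U sr a u a.+1) ?linear0 ?subr0 ?eqxx ?ua //; last lia.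
  have -> : at_ g (N.-1 - (a + u.+1 - a)) (Tc a u.+1 a) = gV a u.+1.
    have [uN1|uN1] := ltnP (a + u.+1) N; first by rewrite gVE // eqxx.
    rewrite (T_oob_u sr) ?linear0 //; last lia.
    have -> : u.+1 = (N - a)%N by lia.
    by rewrite gV_end //; lia.
  by rewrite /= subrK addr0 [X in X - _]addrC addrK.
apply: fam_ext_bJ => [c x cN|c x cN|p|p].
- by rewrite (Q02_xE _ hQ).
- by rewrite (Q02_xE _ dgQ).
- by have [h1 h2 h3] := idxP p; rewrite /bJ /jend key.
have [h1 h2 h3] := idxP p; have eN : (jend p < N)%N by rewrite /jend; lia.
by rewrite (Q02_flip _ hQ) // (Q02_flip _ dgQ) // /bJ /jend key.
Qed.

End IntegrateQ2.

(** * Invariants and ranks *)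

Lemma tw1 s : tw s 1 = 1.
Proof.
by rewrite -[LHS]mulr1 -{2}(twK s 1) -twM mul1r twK.
Qed.

Definition twfam s (lam : nat -> A) : W := wfam n (fun c x => tw s x * lam c).

Lemma twfamE s lam c x : (c < N)%N -> at_ (twfam s lam) c x = tw s x * lam c.
Proof. by move=> cN; rewrite wfamE //; apply: linMr; apply: tw_lin. Qed.

Lemma twfam1 s lam c : (c < N)%N -> at_ (twfam s lam) c 1 = lam c.
Proof. by move=> cN; rewrite twfamE // tw1 mul1r. Qed.

Definition at_one s (g : W) : W := twfam s (fun c => at_ g c 1).
(* The fixed points of at_one are the w with a w = w a for all a, see Inv_ract. *)
Definition Inv s (Q : {vspace W}) : {vspace W} :=
  (Q :&: fixedSpace (linfun (at_one s)))%VS.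

Lemma mem_Inv s (Q : {vspace W}) g : g \in Inv s Q <->
  g \in Q /\ forall c x, (c < N)%N -> at_ g c x = tw s x * at_ g c 1.
Proof.
have lin : linear (at_one s).
  apply: wfam_lin => // [g' c cN|c x cN]; last by lin_fam.
  by apply: linMr; apply: tw_lin.
split=> [/memv_capP[gQ /fixedSpaceP]|[gQ gE]].
  by rewrite (linfun_lin lin) => gE; split=> // c x cN; rewrite -{1}gE twfamE.
rewrite memv_cap gQ; apply/fixedSpaceP; rewrite (linfun_lin lin).
by apply: fam_ext => // c x cN; rewrite twfamE // -gE.
Qed.

Lemma Inv_ract s (Q : {vspace W}) g : g \in Inv s Q <-> g \in Q /\ forall a, lact a g = ract s a g.
Proof.
split=> [/mem_Inv[gQ gE]|[gQ gE]]; last first.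
  apply/mem_Inv; split=> // c x cN.
  have := congr1 (fun h => at_ h c 1) (gE (tw s x)).
  by rewrite lactE // ractE // twK mulr1 => ->.
split=> // a; apply: fam_ext => // c x cN; rewrite lactE // ractE //.
by rewrite (gE c (tw s a * x)) // (gE c x) // twM twK mulrA.
Qed.

Lemma Inv_eq0 s (Q : {vspace W}) g :
  g \in Inv s Q -> (forall c, (c < N)%N -> at_ g c 1 = 0) -> g = 0.
Proof.
move=> /mem_Inv[gQ gE] g0; apply: fam_ext => // c x cN.
by rewrite gE // g0 // mulr0 at0.
Qed.

Lemma Inv_twfam s (Q : {vspace W}) lam : twfam s lam \in Q -> twfam s lam \in Inv s Q.
Proof. by move=> fQ; apply/mem_Inv; split=> // c x cN; rewrite twfam1 // twfamE. Qed.

Lemma Inv_El s (Q : {vspace W}) g c : g \in Inv s Q -> (c < N)%N ->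
  (forall x, at_ g c (x * E c) = at_ g c x) -> E c * at_ g c 1 = at_ g c 1.
Proof.
move=> /mem_Inv[gQ gE] cN gx; rewrite -[RHS]gx mul1r [RHS]gE // twE //.
Qed.

Lemma twfam_Q02 (b s : bool) lam : (forall c, (c < N)%N -> E c * lam c = lam c) ->
    (forall c, (c < N)%N -> lam c * E c = lam c) ->
    (forall c, (c < N)%N -> lam (N.-1 - c)%N = (-1) ^+ b * lam c) ->
  twfam s lam \in Q02 b.
Proof.
move=> l1 l2 l3; apply/mem_Q02 => c cN; split=> x; rewrite !twfamE //; try lia.
- by rewrite twM twE // -mulrA l1.
- by rewrite -mulrA l2.
by rewrite l3 // !mulrA commr_sign.
Qed.

Lemma twfam_Q1 s lam : (forall c, (c.+1 < N)%N -> E c * lam c = lam c) ->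
    (forall c, (c.+1 < N)%N -> lam c * E c.+1 = lam c) -> lam N.-1 = 0 ->
  twfam s lam \in Q1.
Proof.
move=> l1 l2 l3; apply/mem_Q1; split=> [c cN|x]; last first.
  by rewrite twfamE ?l3 ?mulr0 //; lia.
have cN' := ltnW cN; split=> x; rewrite !twfamE //.
  by rewrite twM twE // -mulrA l1.
by rewrite -mulrA l2.
Qed.

Definition vsame a c := (a == c) || (a == N.-1 - c)%N.

Lemma E_bJ (p : idx n) c : (c < N)%N -> E c * bJ p = if vsame (ja p) c then bJ p else 0.
Proof.
move=> cN; have [h1 h2 h3] := idxP p; have pN : (ja p < N)%N by lia.
have Et : E (ja p) * bJ p = bJ p by apply: (ET sr).
rewrite -{1}Et mulrA (strip_mul sr) // /vsame.
case: ifP => [/orP[/eqP e|/eqP e]|_]; last by rewrite mul0r.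
  by rewrite -e Et.
by rewrite -(strip_flip sr cN) -e Et.
Qed.

Lemma bJ_E' p d : (d < N)%N -> bJ p * E d = if vsame (jend p) d then bJ p else 0.
Proof.
move=> dN; rewrite bJ_E //; congr (if _ then _ else _).
by rewrite /vsame; have [h1 h2 h3] := idxP p; rewrite /jend; lia.
Qed.

Lemma jc_sandwich (p : idx n) x c d : (c < N)%N -> (d < N)%N ->
  jc p (E c * x * E d) = if vsame (ja p) c && vsame (jend p) d then jc p x else 0.
Proof.
move=> cN dN; rewrite {1}(sa_span sa x) mulr_sumr mulr_suml.
rewrite (eq_bigr (fun q => (if vsame (ja q) c && vsame (jend q) d then jc q x else 0)
  *: bJ q)); last first.
  move=> q _; rewrite -scalerAr -scalerAl -/(bJ q) E_bJ //.
  by case: (vsame (ja q) c); rewrite ?mul0r ?scale0r ?scaler0 // bJ_E' //;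
    case: ifP; rewrite ?scale0r ?scaler0.
have lj : linear (jc p : A -> K^o) by exact: sa_jc_lin sa p.
rewrite (linear_suml lj) (bigD1 p) //= (sa_jcT sa) eqxx [_ *: _]mulr1 big1 ?addr0 // => q.
by rewrite eq_sym => /negbTE qp; rewrite (sa_jcT sa) qp [_ *: _]mulr0.
Qed.

(** Basis labels for the values at 1 of invariant families: [I0] for the sum of the e_c A e_c over
    the vertices of L_n, [I1] for the sum of the e_s A e_t over the arrows s -> t. *)
Definition I0 := {p : idx n | vsame (jend p) (ja p)}.
Definition I1 := {cp : 'I_N.-1 * idx n | vsame (ja cp.2) cp.1 && vsame (jend cp.2) cp.1.+1}.

Lemma jc_eq0 x : (forall p, jc p x = 0) -> x = 0.
Proof. by move=> x0; rewrite (sa_span sa x) big1 // => p _; rewrite x0 scale0r. Qed.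

Lemma jaN (p : idx n) : (ja p < N)%N.
Proof. by have [h1 h2 h3] := idxP p; lia. Qed.

Lemma vsame_flip a c : (a < N)%N -> (c < N)%N -> vsame (N.-1 - c)%N a = vsame c a.
Proof. by rewrite /vsame; lia. Qed.

(** An invariant family is determined by its values at 1; those in the upper half are arbitrary
    elements of e_c A e_c, and the symmetry dictates the rest. *)
Lemma dim_Inv02 b s : \dim (Inv s (Q02 b)) = #|{: I0}|.
Proof.
pose F (g : W) : {ffun I0 -> K^o} := [ffun p : I0 => jc (val p) (at_ g (ja (val p)) 1)].
pose lam (p : I0) c := if vsame c (ja (val p)) then (-1) ^+ (b && (c < n)%N) * bJ (val p) else 0.
apply: (dim_dual_family (F := F) (b := fun p => twfam s (lam p))).
- by move=> k g h; apply/ffunP => p; rewrite !ffunE atD (sa_jc_lin sa).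
- move=> g gI /ffunP F0; have [gQ gE] := (mem_Inv s (Q02 b) g).1 gI.
  apply: (Inv_eq0 gI); have up c : (n <= c < N)%N -> at_ g c 1 = 0.
    move=> /andP[nc cN]; apply: jc_eq0 => p.
    have -> : at_ g c 1 = E c * at_ g c 1 * E c.
      rewrite (Inv_El gI) //; first by rewrite (Q02_Ex _ gQ).
      by move=> x; rewrite (Q02_xE _ gQ).
    rewrite jc_sandwich //; case: ifP => // /andP[c1 c2].
    have pc : ja p = c by have [h1 h2 h3] := idxP p; move: c1; rewrite /vsame; lia.
    have hp : vsame (jend p) (ja p) by rewrite pc.
    by have := F0 (Sub p hp); rewrite !ffunE /= pc.
  move=> c cN; have [nc|nc] := leqP n c; first by apply: up; rewrite nc.
  have := Q02_flip (c := (N.-1 - c)%N) 1 gQ.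
  have -> : (N.-1 - (N.-1 - c) = c)%N by lia.
  by move=> ->; [rewrite up ?mulr0 //; lia|lia].
- move=> p; have [h1 h2 h3] := idxP (val p); have hp := valP p.
  have vsE c : (c < N)%N -> vsame c (ja (val p)) -> E c = E (ja (val p)).
    by move=> cN /orP[/eqP -> //|/eqP ->]; rewrite (strip_flip sr) //; lia.
  apply/Inv_twfam/twfam_Q02 => c cN; rewrite /lam.
  + case: ifP => ec; last by rewrite mulr0.
    by rewrite mulrA commr_sign -mulrA (vsE c) // E_bJ ?jaN // /vsame eqxx.
  + case: ifP => ec; last by rewrite mul0r.
    by rewrite -mulrA (vsE c) // bJ_E' ?jaN // hp.
  have -> : vsame (N.-1 - c)%N (ja (val p)) = vsame c (ja (val p)).
    by rewrite vsame_flip // jaN.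
  case: ifP => ec; last by rewrite mulr0.
  rewrite mulrA -exprD; congr (_ * _); case: (b) => //=.
  have [nc|nc] := leqP n c.
    by have -> : (N.-1 - c < n)%N by lia.
  have -> : (N.-1 - c < n)%N = false by lia.
  by rewrite /= expr0 expr2 mulrNN mulr1.
move=> p; apply/ffunP => q; rewrite !ffunE twfam1 ?jaN // /lam.
have [h1 h2 h3] := idxP (val p); have [k1 k2 k3] := idxP (val q).
have -> : (ja (val q) < n)%N = false by lia.
have lj : linear (jc (val q) : A -> K^o) by exact: sa_jc_lin sa _.
rewrite andbF mul1r; case: ifP => ec; first by rewrite (sa_jcT sa) val_eqE.
rewrite -[jc _ _]/((jc (val q) : A -> K^o) 0) -(linfun_lin lj) linear0.
by case: eqP => // qp; rewrite qp /vsame eqxx in ec.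
Qed.

Lemma dim_Inv1 s : \dim (Inv s Q1) = #|{: I1}|.
Proof.
pose F (g : W) : {ffun I1 -> K^o} := [ffun p : I1 => jc (val p).2 (at_ g (val p).1 1)].
pose lam (p : I1) (c : nat) := if c == (val p).1 :> nat then bJ (val p).2 else 0.
apply: (dim_dual_family (F := F) (b := fun p => twfam s (lam p))).
- by move=> k g h; apply/ffunP => p; rewrite !ffunE atD (sa_jc_lin sa).
- move=> g gI /ffunP F0; have [gQ gE] := (mem_Inv s Q1 g).1 gI.
  apply: (Inv_eq0 gI) => c cN; have [cN1|cN1] := ltnP c N.-1; last first.
    have -> : c = N.-1 by lia.
    by rewrite (Q1_top _ gQ).
  have cN2 : (c.+1 < N)%N by lia.
  apply: jc_eq0 => p.
  have -> : at_ g c 1 = E c * at_ g c 1 * E c.+1.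
    rewrite (Inv_El gI) //; first by rewrite (Q1_Ex _ gQ).
    by move=> x; rewrite (Q1_xE _ gQ).
  rewrite jc_sandwich //; case: ifP => // hp.
  by have := F0 (Sub (Ordinal cN1, p) hp); rewrite !ffunE.
- move=> p; have /andP[hp1 hp2] := valP p; have cN := ltn_ord (val p).1.
  apply/Inv_twfam/twfam_Q1 => [c cN1|c cN1|]; rewrite /lam.
  + case: eqP => [ce|_]; last by rewrite mulr0.
    by rewrite E_bJ ?(ltnW cN1) // ce hp1.
  + case: eqP => [ce|_]; last by rewrite mul0r.
    by rewrite bJ_E' // ce hp2.
  by case: eqP => // h; rewrite -h ltnn in cN.
move=> p; apply/ffunP => q; rewrite !ffunE twfam1 /lam; last first.
  by apply: leq_trans (ltn_ord (val q).1) _; lia.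
have lj : linear (jc (val q).2 : A -> K^o) by exact: sa_jc_lin sa _.
case: eqP => qp1.
  rewrite (sa_jcT sa); congr (nat_of_bool _)%:R; apply/eqP/eqP => [qp2|-> //].
  apply: val_inj; rewrite (surjective_pairing (val q)) (surjective_pairing (val p)) qp2.
  by congr (_, _); apply: val_inj.
rewrite -[jc _ _]/((jc (val q).2 : A -> K^o) 0) -(linfun_lin lj) linear0.
by case: eqP => // qp; case: qp1; rewrite qp.
Qed.

Lemma sum_nat_pred1 m (P : nat -> bool) k : (forall i, (i < m)%N -> P i = (i == k)) ->
  (\sum_(i < m) P i = (k < m))%N.
Proof.
move=> PE; have [km|km] := ltnP k m.
  rewrite (bigD1 (Ordinal km)) //= PE // eqxx big1 // => i ik.
  by rewrite PE //; case: eqP => // ik'; case/eqP: ik; apply: val_inj.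
rewrite big1 // => i _; rewrite PE //; case: eqP => // ik.
by have := ltn_ord i; lia.
Qed.

Lemma sum_nat_geq m k : (\sum_(u < m) (k <= u) = m - k)%N.
Proof.
elim: m => [|m IH]; first by rewrite big_ord0.
by rewrite big_ord_recr /= IH; case: leqP; lia.
Qed.

Lemma sum_nat_leq m k : (\sum_(u < m) (u < k) = minn m k)%N.
Proof.
elim: m => [|m IH]; first by rewrite big_ord0 min0n.
by rewrite big_ord_recr /= IH; case: ltnP; lia.
Qed.

Definition mult a d := (\sum_(u < N - a) \sum_(v < a.+1) (a + u - v == d)%N)%N.

Lemma multE a b : (n <= a < N)%N -> (n <= b < N)%N -> mult a b = (N - maxn a b)%N.
Proof.
move=> /andP[na aN] /andP[nb bN].
rewrite /mult (eq_bigr (fun u : 'I_(N - a) => (b - a <= u)%N : nat)) => [|u _].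
  by rewrite sum_nat_geq; lia.
have uN := ltn_ord u; have [ub|ub] := leqP (b - a) u.
  rewrite (@sum_nat_pred1 _ (fun v => (a + u - v)%N == b) (a + u - b)%N) => [|v va].
    by rewrite ltnS; lia.
  by apply/eqP/eqP; lia.
by rewrite big1 // => v _; have va := ltn_ord v; case: eqP => //; lia.
Qed.

Lemma multE' a b : (n <= a < N)%N -> (n <= b < N)%N -> mult a (N.-1 - b)%N = (N - maxn a b)%N.
Proof.
move=> /andP[na aN] /andP[nb bN].
rewrite /mult (eq_bigr (fun u : 'I_(N - a) => (u < N - b)%N : nat)) => [|u _].
  by rewrite sum_nat_leq; lia.
have uN := ltn_ord u.
rewrite (@sum_nat_pred1 _ (fun v => (a + u - v)%N == (N.-1 - b)%N) (a + u - (N.-1 - b))%N)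
  => [|v va]; first by lia.
by apply/eqP/eqP; lia.
Qed.

(** This is dim e_a A e_b: 2n - max(a, b) basis paths from a end at b and equally many at its
    twin. *)
Lemma count_idx a b : (n <= a < N)%N -> (n <= b < N)%N ->
  (\sum_(p : idx n) (vsame (ja p) a && vsame (jend p) b) = 2 * (N - maxn a b))%N.
Proof.
move=> aN bN; rewrite (big_idx _ n (fun a' u v => vsame a' a && vsame (a' + u - v)%N b : nat)).
have an : (a - n < n)%N by lia.
rewrite (bigD1 (Ordinal an)) //= [X in (_ + X)%N]big1 ?addn0 => [|i ia]; last first.
  rewrite big1 // => u _; rewrite big1 // => v _.
  have ia' : (i : nat) != (a - n)%N by [].
  by have := ltn_ord i; rewrite {1}/vsame; lia.
have -> : (n + (a - n) = a)%N by lia.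
have -> : (n - (a - n) = N - a)%N by lia.
rewrite mulSn mul1n -{1}(multE aN bN) -(multE' aN bN) /mult -big_split.
apply: eq_bigr => u _; rewrite -big_split; apply: eq_bigr => v _ /=.
by rewrite /vsame eqxx /=; have uN := ltn_ord u; have vN := ltn_ord v; lia.
Qed.

Lemma vsame_top d c : (d < N)%N -> (c < N)%N -> vsame d c = vsame d (maxn c (N.-1 - c))%N.
Proof. by rewrite /vsame; lia. Qed.

Lemma sum_succ m : (\sum_(i < m) 2 * i.+1 = m * m.+1)%N.
Proof. by elim: m => [|m IH]; rewrite ?big_ord0 // big_ord_recr /= IH; lia. Qed.

Lemma sum_rev m : (\sum_(i < m) 2 * (m - i) = m * m.+1)%N.
Proof.
rewrite -sum_succ (reindex_inj rev_ord_inj) /=.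
by apply: eq_bigr => i _; have := ltn_ord i; lia.
Qed.

Lemma card_I0 : #|{: I0}| = (n * n.+1)%N.
Proof.
rewrite card_sig -sum1_card big_mkcond /=.
rewrite (eq_bigr (fun p => \sum_(i < n) (vsame (ja p) (n + i) && vsame (jend p) (n + i)))%N);
    last first.
  move=> p _; have [h1 h2 h3] := idxP p; have pn : (ja p - n < n)%N by lia.
  rewrite (bigD1 (Ordinal pn)) //= subnKC // big1 ?addn0 => [|i ip]; last first.
    have ip' : (i : nat) != (ja p - n)%N by [].
    by have := ltn_ord i; rewrite {1}/vsame; lia.
  by rewrite {2}/vsame eqxx /= unfold_in /=; case: vsame.
rewrite exchange_big /= -sum_rev; apply: eq_bigr => i _.
by have iN := ltn_ord i; rewrite count_idx; lia.
Qed.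

Lemma card_I1 : #|{: I1}| = (2 * n * n)%N.
Proof.
rewrite card_sig -sum1_card big_mkcond /=.
rewrite (eq_bigr (fun cp : 'I_N.-1 * idx n =>
  (vsame (ja cp.2) cp.1 && vsame (jend cp.2) cp.1.+1 : nat))); last first.
  by move=> cp _; rewrite unfold_in /=; case: (_ && _).
rewrite -(pair_bigA _ (fun (c : 'I_N.-1) p => (vsame (ja p) c && vsame (jend p) c.+1 : nat))) /=.
(* 2n minus the larger of the upper representatives of c and c+1, doubled. *)
pose f c := if (c < n)%N then (2 * c.+1)%N else (2 * (N.-1 - c))%N.
rewrite (eq_bigr (fun c : 'I_N.-1 => f c)) => [|c _]; last first.
  have cN := ltn_ord c.
  rewrite (eq_bigr (fun p => (vsame (ja p) (maxn c (N.-1 - c)) &&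
    vsame (jend p) (maxn c.+1 (N.-1 - c.+1)))%N : nat)); last first.
    move=> p _; have [h1 h2 h3] := idxP p.
    rewrite -!vsame_top //; try lia.
    by rewrite /jend; lia.
  rewrite count_idx /f; try lia.
  by case: ifP => cn; congr (2 * _)%N; lia.
have -> : N.-1 = (n + n.-1)%N by lia.
rewrite big_split_ord /= (eq_bigr (fun i : 'I_n => 2 * i.+1)%N); last first.
  by move=> i _; rewrite /f ltn_ord.
rewrite sum_succ (eq_bigr (fun i : 'I_n.-1 => 2 * (n.-1 - i))%N) => [|i _]; last first.
  by rewrite /f ltnNge leq_addr /=; congr (2 * _)%N; have := ltn_ord i; lia.
rewrite sum_rev; have [m ->] : exists m, n = m.+1 by exists n.-1; rewrite prednK.
by rewrite /=; nia.
Qed.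

(** * The kernel of [d0] on invariants *)

Lemma sgU_tw s c : (c < N)%N -> tw s (U c) = if s && (c == n.-1) then - U c else U c.
Proof. by move=> cN; case: s; rewrite /tw //= (sa_sgU sa). Qed.

Lemma Inv02_El b s g c : g \in Inv s (Q02 b) -> (c < N)%N -> E c * at_ g c 1 = at_ g c 1.
Proof.
move=> gI cN; have [gQ _] := (mem_Inv s _ g).1 gI.
by apply: (Inv_El gI cN) => x; rewrite (Q02_xE _ gQ).
Qed.

Lemma Inv02_Er b s g c : g \in Inv s (Q02 b) -> (c < N)%N -> at_ g c 1 * E c = at_ g c 1.
Proof.
by move=> gI cN; have [gQ _] := (mem_Inv s _ g).1 gI; rewrite (Q02_Ex _ gQ).
Qed.

Lemma Inv02_flip b s g c : g \in Inv s (Q02 b) -> (c < N)%N ->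
  at_ g (N.-1 - c)%N 1 = (-1) ^+ b * at_ g c 1.
Proof.
by move=> gI cN; have [gQ _] := (mem_Inv s _ g).1 gI; rewrite (Q02_flip _ gQ).
Qed.

Lemma InvE s (Q : {vspace W}) g c x : g \in Inv s Q -> (c < N)%N ->
  at_ g c x = tw s x * at_ g c 1.
Proof. by case/mem_Inv => _ gE cN; rewrite gE. Qed.

Lemma d0_one s (Q : {vspace W}) g c : g \in Inv s Q -> (c.+1 < N)%N ->
  at_ (d0 g) c 1 = tw s (U c) * at_ g c.+1 1 - at_ g c 1 * U c.
Proof. by move=> gI cN; rewrite d0E ?(ltnW cN) // mul1r (InvE _ gI). Qed.

Definition soc a : A := Tc a (N.-1 - a) a.

Lemma soc_flip a : (a < N)%N -> soc (N.-1 - a) = soc a.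
Proof.
move=> aN; rewrite /soc; have -> : (N.-1 - (N.-1 - a) = a)%N by lia.
by rewrite (T_flip sr) //; lia.
Qed.

Lemma U_soc c : (c.+1 < N)%N -> U c * soc c.+1 = 0.
Proof. by move=> cN; rewrite (UT sr) // (T_oob_v sr) //; lia. Qed.

Lemma soc_U c : (c.+1 < N)%N -> soc c * U c = 0.
Proof.
move=> cN; have := TSv n E U c (N.-1 - c) c.
have -> : (N.-1 - (c + (N.-1 - c) - c) = c)%N by lia.
by rewrite /soc => <-; rewrite (T_oob_v sr) //; lia.
Qed.

Lemma E_soc a : (a < N)%N -> E a * soc a = soc a. Proof. by move=> aN; rewrite (ET sr). Qed.

Lemma soc_E a : (a < N)%N -> soc a * E a = soc a.
Proof.
move=> aN; rewrite /soc (TE_if sr) //; try lia.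
have -> : (a == N.-1 - (a + (N.-1 - a) - a))%N by lia.
by rewrite orbT.
Qed.

Lemma phiN x : phi (- x) = - phi x.
Proof. by have := phi_lin (-1) x 0; rewrite addr0 scaleN1r phi0 addr0 mulN1r. Qed.

Section KernelElement.
Variables (s : bool) (g : W).
Hypotheses (gI : g \in Inv s (Q02 false)) (dg : d0 g = 0).
Let F c u v := phi (at_ g c 1 * Tc c u v).

(** Since [g] commutes with U_c up to the twist, the trace property moves the first up step to the
    end of the path. *)
Lemma ker_step c u v : (c.+1 < N)%N ->
  F c u.+1 v = phi (at_ g c.+1 1 * (Tc c.+1 u v * tw s (U c))).
Proof.
move=> cN; have := congr1 (fun h => at_ h c 1) dg; rewrite (d0_one gI cN) at0.
move=> /eqP; rewrite subr_eq0 => /eqP comm; rewrite /F -(UT sr) // mulrA -comm.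
by rewrite -mulrA phiC -mulrA.
Qed.

(** Rotating the first up step to the end moves the base point of a closed path up by one, until the
    path leaves the strip. Above n-1 no step is the loop, so the twist has no effect. *)
Lemma ker_even c k : (n <= c < N)%N -> (0 < k)%N -> F c k k = 0.
Proof.
move=> /andP[nc cN] k0; have [j jE] : exists j, j = (N.-1 - c)%N by exists (N.-1 - c)%N.
elim: j c nc cN jE => [|j IH] c nc cN jE.
  by rewrite /F (T_oob_u sr) ?mulr0 ?phi0 //; lia.
case: k k0 IH => // k _ IH; rewrite ker_step; last lia.
rewrite sgU_tw //; have -> : (c == n.-1) = false by lia.
rewrite andbF -[RHS](IH c.+1) //; try lia.
rewrite /F -(TU sr (c := c.+1)); last lia.
by congr (phi (_ * (_ * U _))); lia.
Qed.

(** Paths from a vertex to its twin are rotated down to the vertex n, the source of the loop. *)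
Lemma ker_odd i u v : (n + i < N)%N -> (v <= n + i)%N ->
    (n + i + u - v = N.-1 - (n + i))%N -> (forall w, (w < n)%N -> F n w w.+1 = 0) ->
  F (n + i)%N u v = 0.
Proof.
move=> iN vi close base; elim: i u v iN vi close => [|i IH] u v iN vi close.
  rewrite addn0 in vi close *; have -> : v = u.+1 by lia.
  have [un|un] := ltnP u n; first exact: base.
  by rewrite /F (T_oob_u sr) ?mulr0 ?phi0 //; lia.
case: v vi close => [|v] vi close; first lia.
rewrite -[RHS](IH u.+1 v); try lia.
rewrite ker_step; last lia.
rewrite sgU_tw; last lia.
have -> : (n + i == n.-1)%N = false by lia.
rewrite andbF addnS /F TSv; congr (phi (_ * (_ * U _))); lia.
Qed.

(** n and n-1 are twins, so rotation through the loop returns to the same coefficient, with the sign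
    of the twist. *)
Lemma ker_odd_twisted w : s -> F n w w.+1 = - F n w w.+1.
Proof.
move=> st; have [wn|wn] := ltnP w n; last first.
  by rewrite /F (T_oob_u sr) ?mulr0 ?phi0 ?oppr0 //; lia.
have nN : (n < N)%N by lia.
have nn : n.-1.+1 = n by apply: prednK.
have := ker_step (c := n.-1) w w; rewrite nn => /(_ nN).
rewrite sgU_tw; last lia.
rewrite st eqxx /= mulrN mulrN.
have -> : Tc n w w * U n.-1 = Tc n w w.+1.
  by rewrite TSv; congr (_ * U _); lia.
have -> : F n.-1 w.+1 w = F n w w.+1.
  rewrite /F -(T_flip sr (c := n)); try lia.
  have -> : (N.-1 - n = n.-1)%N by lia.
  have := Inv02_flip gI nN; have -> : (N.-1 - n = n.-1)%N by lia.
  by rewrite expr0 mul1r => ->.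
by move=> h; rewrite {1}h phiN.
Qed.

Lemma ker_eq0 : (forall i : 'I_n, phi (at_ g (n + i)%N 1) = 0) ->
  (forall w, (w < n)%N -> F n w w.+1 = 0) -> g = 0.
Proof.
move=> base0 base1; apply: (Inv_eq0 gI) => c cN.
have up d : (n <= d < N)%N -> at_ g d 1 = 0.
  move=> /andP[nd dN]; apply: phi_nd => x.
  have l1 : linear (fun x => phi (at_ g d 1 * x) : K^o) by exact: phi_mul_linr.
  have l0 : linear (fun _ : A => 0 : K^o) by move=> ? ? ?; rewrite scaler0 addr0.
  move: x; apply: (linear_bJ l1 l0) => p; have [h1 h2 h3] := idxP p.
  rewrite -(Inv02_Er gI dN) -mulrA E_bJ // /vsame.
  have [pd|pd] := eqVneq (ja p) d; last first.
    have -> : (ja p == N.-1 - d)%N = false by lia.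
    by rewrite mulr0 phi0.
  rewrite /= -/(bJ p) /bJ pd -[phi _]/(F d (ju p) (jv p)).
  have [ev|ev] := eqVneq (jend p) d.
    have -> : jv p = ju p by move: ev; rewrite /jend pd; lia.
    have [u0|u0] := posnP (ju p); last by apply: ker_even => //; rewrite nd.
    have dn : (d - n < n)%N by lia.
    have := base0 (Ordinal dn); rewrite /= subnKC // => b0.
    by rewrite /F u0 T00 (Inv02_Er gI).
  have [od|od] := eqVneq (jend p) (N.-1 - d)%N.
    rewrite -(subnKC nd); apply: ker_odd => //; try lia.
    by move: od; rewrite /jend pd subnKC //; lia.
  rewrite /F -(Inv02_El gI dN) -mulrA phiC -mulrA.
  rewrite (TE_if sr); try lia.
  move: ev od; rewrite /jend pd => ev od.
  have -> : (d == d + ju p - jv p)%N = false by lia.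
  have -> : (d == N.-1 - (d + ju p - jv p))%N = false by lia.
  by rewrite mulr0 phi0.
have [nc|nc] := leqP n c; first by apply: up; rewrite nc.
have := Inv02_flip gI (c := (N.-1 - c)%N); have -> : (N.-1 - (N.-1 - c) = c)%N by lia.
by move=> ->; [rewrite up ?mulr0 //; lia|lia].
Qed.
End KernelElement.

Definition soc_fam a c := if vsame c a then soc a else 0.
(** The components of a central element: k steps up and k steps down at every vertex. With the
    socles these account for the 2n dimensions of the centre. *)
Definition diag_fam k c := Tc c k k.

Lemma soc_fam_ker s a : (a < N)%N ->
  twfam s (soc_fam a) \in (Inv s (Q02 false) :&: lker (linfun d0))%VS.
Proof.
move=> aN; have vs c : (c < N)%N -> soc_fam a c = if vsame c a then soc c else 0.
  move=> cN; rewrite /soc_fam; case: ifP => // /orP[/eqP -> //|/eqP ->].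
  by rewrite soc_flip.
rewrite memv_cap; apply/andP; split.
  apply: Inv_twfam; apply: twfam_Q02 => c cN; rewrite !vs //; try lia.
  - by case: ifP; rewrite ?mulr0 // E_soc.
  - by case: ifP; rewrite ?mul0r // soc_E.
  rewrite mul1r soc_flip // vsame_flip //.
rewrite memv_ker (linfun_lin d0_lin); apply/eqP/fam_ext => // c x cN; rewrite at0 d0E //.
have [cN1|cN1] := ltnP c.+1 N; last first.
  by rewrite (strip_out sr (c := c)) ?mulr0 ?linear0 ?addr0 //; lia.
rewrite !twfamE // twM sgU_tw // !vs //.
have -> : tw s x * (if s && (c == n.-1) then - U c else U c) *
    (if vsame c.+1 a then soc c.+1 else 0) = 0.
  case: (vsame c.+1 a); last by rewrite mulr0.
  by rewrite -mulrA; case: (s && _); rewrite ?mulNr U_soc // ?oppr0 mulr0.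
by case: ifP => _; rewrite -[_ * _ * U c]mulrA ?soc_U ?mul0r ?mulr0 ?subr0.
Qed.

Lemma diag_fam_ker k :
  twfam false (diag_fam k) \in (Inv false (Q02 false) :&: lker (linfun d0))%VS.
Proof.
rewrite memv_cap; apply/andP; split.
  apply: Inv_twfam; apply: twfam_Q02 => c cN; rewrite /diag_fam.
  - by rewrite (ET sr).
  - have [T0|/(T_nz_range sr cN)/andP[uN vc]] := eqVneq (Tc c k k) 0.
      by rewrite T0 mul0r.
    by rewrite -[X in E X](addnK k c) (TE sr).
  rewrite mul1r; have [kc|kc] := leqP k c; last first.
    by rewrite (T_oob_v sr _ cN kc) (T_oob_u sr) //; lia.
  have [kc'|kc'] := leqP k (N.-1 - c); first by rewrite (T_flip sr).
  by rewrite (@T_oob_v _ _ E U sr (N.-1 - c) k k) ?(T_oob_u sr) //; lia.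
rewrite memv_ker (linfun_lin d0_lin); apply/eqP/fam_ext => // c x cN; rewrite at0 d0E //.
have [cN1|cN1] := ltnP c.+1 N; last first.
  by rewrite (strip_out sr (c := c)) ?mulr0 ?linear0 ?addr0 //; lia.
rewrite !twfamE // /tw /diag_fam -[x * _ * _]mulrA (UT sr) //.
by rewrite -[x * _ * _]mulrA -(TU sr) // addnK subrr.
Qed.

Lemma phi_soc a : (a < N)%N -> phi (soc a) = 1.
Proof. by move=> aN; rewrite /soc phi_T // !eqxx. Qed.

Lemma dim_ker_d0_tw : (2%:R != 0 :> K) ->
  \dim (Inv true (Q02 false) :&: lker (linfun d0)) = n.
Proof.
move=> two; pose F (g : W) : {ffun 'I_n -> K^o} := [ffun i : 'I_n => phi (at_ g (n + i)%N 1)].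
rewrite -[RHS]card_ord.
apply: (dim_dual_family (F := F) (b := fun i : 'I_n => twfam true (soc_fam (n + i)%N))).
- by move=> k g h; apply/ffunP => i; rewrite !ffunE atD phi_lin.
- move=> g /memv_capP[gI]; rewrite memv_ker (linfun_lin d0_lin) => /eqP dg /ffunP F0.
  apply: (ker_eq0 gI dg) => [i|w wn]; first by have := F0 i; rewrite !ffunE.
  have /eqP := ker_odd_twisted gI dg w (isT : true); rewrite -addr_eq0 -mulr2n -mulr_natl.
  by rewrite mulf_eq0 (negbTE two) => /eqP.
- by move=> i; apply: soc_fam_ker; rewrite ltn_add2l.
move=> i; apply/ffunP => j; rewrite !ffunE twfam1 ?ltn_add2l //.
have iN := ltn_ord i; have jN := ltn_ord j.
have -> : soc_fam (n + i)%N (n + j)%N = if j == i then soc (n + i)%N else 0.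
  by rewrite /soc_fam /vsame -val_eqE /= eqn_add2l; congr (if _ then _ else _); lia.
by case: eqP => _; rewrite ?phi0 // phi_soc // ltn_add2l.
Qed.

Lemma dim_ker_d0 : \dim (Inv false (Q02 false) :&: lker (linfun d0)) = (2 * n)%N.
Proof.
pose F (g : W) : {ffun 'I_n + 'I_n -> K^o} := [ffun i : 'I_n + 'I_n => match i with
  | inl i => phi (at_ g (n + i)%N 1) | inr w => phi (at_ g n 1 * Tc n w w.+1) end].
pose b (i : 'I_n + 'I_n) := match i with
  | inl i => twfam false (soc_fam (n + i)%N)
  (* n-1-w is the exponent that completes [Tc n w w.+1] to the socle path at n. *)
  | inr w => twfam false (diag_fam (n.-1 - w)%N) end.
have -> : (2 * n)%N = #|{: 'I_n + 'I_n}| by rewrite card_sum card_ord addnn mul2n.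
have nN : (n < N)%N by lia.
apply: (dim_dual_family (F := F) (b := b)).
- move=> k g h; apply/ffunP => i; rewrite !ffunE; case: i => i; rewrite atD ?phi_lin //.
  by rewrite mulrDl -scalerAl phi_lin.
- move=> g /memv_capP[gI]; rewrite memv_ker (linfun_lin d0_lin) => /eqP dg /ffunP F0.
  apply: (ker_eq0 gI dg) => [i|w wn]; first by have := F0 (inl i); rewrite !ffunE.
  by have := F0 (inr (Ordinal wn)); rewrite !ffunE.
- by case=> i; [apply: soc_fam_ker; rewrite ltn_add2l|apply: diag_fam_ker].
move=> i; apply/ffunP => j; rewrite !ffunE.
case: i => i; case: j => j; have iN := ltn_ord i; have jN := ltn_ord j;
  rewrite /b twfam1 ?ltn_add2l //.
- have -> : soc_fam (n + i)%N (n + j)%N = if j == i then soc (n + i)%N else 0.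
    by rewrite /soc_fam /vsame -val_eqE /= eqn_add2l; congr (if _ then _ else _); lia.
  have -> : (inl j == inl i :> 'I_n + 'I_n) = (j == i) by [].
  by case: eqP => _; rewrite ?phi0 // phi_soc // ltn_add2l.
- rewrite /soc_fam; case: ifP => _; last by rewrite mul0r phi0.
  rewrite phiC /soc phi_TT; try lia.
  have -> : (inr j == inl i :> 'I_n + 'I_n) = false by [].
  by congr (nat_of_bool _)%:R; lia.
- have -> : (inl j == inr i :> 'I_n + 'I_n) = false by [].
  rewrite /diag_fam phi_T ?ltn_add2l //; congr (nat_of_bool _)%:R; lia.
rewrite /diag_fam phi_TT; try lia.
have -> : (inr j == inr i :> 'I_n + 'I_n) = (j == i) by [].
by rewrite -val_eqE /=; congr (nat_of_bool _)%:R; lia.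
Qed.

(** * Adjointness of [d0] and [d1] on invariants *)

Definition pair02 (x y : W) : K :=
  \sum_(i < n) phi (at_ x (n + i)%N 1 * at_ y (n + i)%N 1).

(* The signs are those that make d0 and d1 adjoint. *)
Definition pair1 s (x z : W) : K := \sum_(c < N.-1)
  (if c == n.-1 :> nat then (-1) ^+ (s : bool) else if (c < n)%N then 1 else -1) *
  phi (at_ x (N.-2 - c)%N 1 * at_ z c 1).

Lemma pair02_linl y : scalar (pair02^~ y).
Proof.
move=> k u v; rewrite /pair02 mulr_sumr -big_split; apply: eq_bigr => i _ /=.
by rewrite atD mulrDl -scalerAl phi_lin.
Qed.

Lemma pair02_linr x : scalar (pair02 x).
Proof.
move=> k u v; rewrite /pair02 mulr_sumr -big_split; apply: eq_bigr => i _ /=.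
by rewrite atD mulrDr -scalerAr phi_lin.
Qed.

Lemma pair1_linl s y : scalar ((pair1 s)^~ y).
Proof.
move=> k u v; rewrite /pair1 mulr_sumr -big_split; apply: eq_bigr => i _ /=.
by rewrite atD mulrDl -scalerAl phi_lin mulrDr mulrCA.
Qed.

Lemma pair1_linr s x : scalar (pair1 s x).
Proof.
move=> k u v; rewrite /pair1 mulr_sumr -big_split; apply: eq_bigr => i _ /=.
by rewrite atD mulrDr -scalerAr phi_lin mulrDr mulrCA.
Qed.

Lemma phiD x y : phi (x + y) = phi x + phi y.
Proof. by have := phi_lin 1 x y; rewrite scale1r mul1r. Qed.

Lemma phiB x y : phi (x - y) = phi x - phi y.
Proof. by rewrite phiD phiN. Qed.

(** The loop occurs twice in its relation, so its part of [d1] is an anticommutator, up to sign,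
    where [d0] has a commutator. On invariants passing to the opposite twist makes up for this. *)
Lemma pair_adjoint s x y : x \in Inv s Q1 -> y \in Inv (~~ s) (Q02 false) ->
  pair02 (d1 x) y = pair1 s x (d0 y).
Proof.
move=> xI yI; have [xQ _] := (mem_Inv s _ x).1 xI.
pose X c := at_ x c 1; pose Y c := at_ y c 1.
have Yflip c : (c < N)%N -> Y (N.-1 - c)%N = Y c.
  by move=> cN; rewrite /Y (Inv02_flip yI) // mul1r.
(* [P], [Q], [R], [S] are the four terms of [d1] at n+i after cyclic rotation. Summation by parts
   pairs [P], [Q] at i with [R], [S] at i+1; the leftover term at 0 is the loop. *)
pose P i := phi (X (n.-2 - i)%N * (Y (n + i)%N * U (n + i)%N)).
pose Q i := phi (X (n + i)%N * (U (n.-2 - i)%N * Y (n + i)%N)).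
pose R i := phi (X (n + i).-1 * (Y (n + i)%N * tw s (U (n.-1 - i)%N))).
pose S i := phi (X (n.-1 - i)%N * (U (n + i).-1 * Y (n + i)%N)).
pose F i := if (i < n.-1)%N then P i + Q i else 0.
transitivity (\sum_(i < n) (F i - (R i + S i))).
  apply: eq_bigr => i _; have iN := ltn_ord i.
  have cN : (n + i < N)%N by rewrite ltn_add2l.
  rewrite d1E // mul1r mul1r !mulrBl mulrDl !phiB phiD.
  have -> : F i = phi (at_ x (N.-1 - (n + i).+1) (U (n + i)) * Y (n + i)%N) +
      phi (at_ x (n + i) 1 * V (n + i).+1 * Y (n + i)%N).
    rewrite /F; case: ifP => im; last first.
      have -> : (n + i = N.-1)%N by lia.
      by rewrite (strip_out sr (leqnn _)) linear0 (Q1_top _ xQ) !mul0r phi0 addr0.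
    rewrite (InvE _ xI); last lia.
    rewrite sgU_tw //; have -> : (n + i == n.-1)%N = false by lia.
    rewrite andbF -[U _ * _ * _]mulrA phiC -!mulrA /P /Q /X.
    by congr (phi (at_ x _ 1 * _) + phi (_ * (U _ * _))); lia.
  rewrite opprD addrA; congr (_ + _ - _ - _).
    rewrite (InvE _ xI); last lia.
    rewrite -[tw s _ * _ * _]mulrA phiC -mulrA /R.
    by congr (phi (_ * (_ * tw s (U _)))); lia.
  by rewrite -mulrA /S; congr (phi (at_ x _ 1 * _)); lia.
rewrite (@sum_shift _ n F (fun i => R i + S i)) //; last by rewrite /F ltnn.
rewrite /pair1 (sum_strip (fun c => (if c == n.-1 :> nat then (-1) ^+ (s : bool)
  else if (c < n)%N then 1 else -1) * phi (at_ x (N.-2 - c)%N 1 * at_ (d0 y) c 1))) //.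
have dy c : (c.+1 < N)%N -> at_ (d0 y) c 1 = tw (~~ s) (U c) * Y c.+1 - Y c * U c.
  by move=> cN; rewrite (d0_one yI).
have dy' c : (c.+1 < N)%N -> c != n.-1 -> at_ (d0 y) c 1 = U c * Y c.+1 - Y c * U c.
  by move=> cN cn; rewrite dy // sgU_tw ?(ltnW cN) // (negbTE cn) andbF.
congr (_ + _).
  rewrite eqxx dy; last lia.
  have -> : (N.-2 - n.-1 = n.-1)%N by lia.
  rewrite /R /S addn0 subn0 -/(X n.-1) prednK // !sgU_tw; try lia.
  have -> : Y n.-1 = Y n by rewrite -[RHS]Yflip; [congr Y; lia|lia].
  rewrite eqxx !andbT mulrBr phiB.
  by case: (s) => /=; rewrite ?mulNr ?mulrN ?phiN ?expr1 ?mulN1r ?mul1r;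
    rewrite ?opprD ?opprB ?opprK // addrC.
apply: eq_bigr => i _; have im := ltn_ord i.
have -> : (n.-2 - i == n.-1)%N = false by lia.
have -> : (n + i == n.-1)%N = false by lia.
have -> : (n.-2 - i < n)%N by lia.
have -> : (n + i < n)%N = false by lia.
rewrite mul1r mulN1r !dy'; try lia.
have -> : (N.-2 - (n.-2 - i) = n + i)%N by lia.
have -> : (N.-2 - (n + i) = n.-2 - i)%N by lia.
have -> : Y (n.-2 - i)%N = Y (n + i).+1 by rewrite -[RHS]Yflip; [congr Y; lia|lia].
have -> : Y (n.-2 - i).+1 = Y (n + i)%N by rewrite -[RHS]Yflip; [congr Y; lia|lia].
rewrite /F im /P /Q /R /S !mulrBr !phiB addnS /=.
have -> : (n.-1 - i.+1 = n.-2 - i)%N by lia.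
rewrite sgU_tw; last lia.
have -> : (n.-2 - i == n.-1)%N = false by lia.
by rewrite andbF; ring.
Qed.

Lemma pair02_nondeg s s' b z : z \in Inv s (Q02 b) ->
  (forall y, y \in Inv s' (Q02 false) -> pair02 z y = 0) -> z = 0.
Proof.
move=> zI z0; apply: (Inv_eq0 zI) => c cN.
have up d : (n <= d < N)%N -> at_ z d 1 = 0.
  move=> /andP[nd dN]; apply: phi_nd => a.
  have dn : (d - n < n)%N by lia.
  have EE : E d * E d = E d by exact: (E_idem sr dN).
  pose lam c := if vsame c d then E d * a * E d else 0.
  have yI : twfam s' lam \in Inv s' (Q02 false).
    apply: Inv_twfam; apply: twfam_Q02 => c' c'N; rewrite /lam.
    - case: ifP => [/orP[/eqP ->|/eqP ->]|_]; rewrite ?mulr0 ?(strip_flip sr) //;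
        by rewrite !mulrA EE.
    - case: ifP => [/orP[/eqP ->|/eqP ->]|_]; rewrite ?mul0r ?(strip_flip sr) //;
        by rewrite -!mulrA EE.
    by rewrite mul1r vsame_flip.
  have := z0 _ yI; rewrite /pair02 (bigD1 (Ordinal dn)) //= subnKC // big1 => [|i id].
    rewrite addr0 twfam1 // /lam /vsame eqxx /= !mulrA (Inv02_Er zI) //.
    by rewrite [phi (_ * E d)]phiC !mulrA (Inv02_El zI) // => <-.
  have id' : (i : nat) != (d - n)%N by [].
  have iN := ltn_ord i; rewrite twfam1 ?ltn_add2l // /lam /vsame.
  have -> : (n + i == d)%N = false by lia.
  have -> : (n + i == N.-1 - d)%N = false by lia.
  by rewrite mulr0 phi0.
have [nc|nc] := leqP n c; first by apply: up; rewrite nc.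
have := Inv02_flip zI (c := (N.-1 - c)%N); have -> : (N.-1 - (N.-1 - c) = c)%N by lia.
by move=> ->; [rewrite up ?mulr0 //; lia|lia].
Qed.

Lemma pair1_nondeg s s' z : z \in Inv s' Q1 ->
  (forall x, x \in Inv s Q1 -> pair1 s x z = 0) -> z = 0.
Proof.
move=> zI z0; have [zQ _] := (mem_Inv s' _ z).1 zI.
apply: (Inv_eq0 zI) => c cN; have [cN1|cN1] := ltnP c N.-1; last first.
  have -> : c = N.-1 by lia.
  by rewrite (Q1_top _ zQ).
apply: phi_nd => a; pose d := (N.-2 - c)%N.
have dN : (d.+1 < N)%N by rewrite /d; lia.
pose lam c := if c == d then E d * a * E d.+1 else 0.
have xI : twfam s lam \in Inv s Q1.
  apply: Inv_twfam; apply: twfam_Q1 => [c' c'N|c' c'N|]; rewrite /lam.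
  - by case: eqP => [->|_]; rewrite ?mulr0 // !mulrA (E_idem sr) // ltnW.
  - by case: eqP => [->|_]; rewrite ?mul0r // -!mulrA (E_idem sr).
  by have -> : (N.-1 == d) = false by lia.
have := z0 _ xI; rewrite /pair1 (bigD1 (Ordinal cN1)) //= big1 => [|i ic].
  rewrite addr0 twfam1 /lam -/d ?eqxx ?(ltnW dN) //.
  have -> : E d.+1 = E c by rewrite -(strip_flip sr cN); congr E; rewrite /d; lia.
  have -> : E d = E c.+1.
    by rewrite -(strip_flip sr (c := c.+1)); [congr E; rewrite /d; lia|lia].
  rewrite -[_ * E c * _]mulrA (Inv_El zI) //; last first.
    by move=> x; rewrite (Q1_xE _ zQ).
  rewrite -mulrA phiC -mulrA (Q1_Ex _ zQ); last lia.
  rewrite phiC => /eqP; rewrite mulf_eq0 => /orP[|/eqP //].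
  by case: ifP => _; [rewrite signr_eq0|case: ifP => _; rewrite ?oppr_eq0 oner_eq0].
have iN := ltn_ord i; have ic' : (i : nat) != c by [].
rewrite twfam1 /lam; last lia.
have -> : (N.-2 - i == d)%N = false by rewrite /d; lia.
by rewrite mul0r phi0 mulr0.
Qed.

Lemma d0_Inv s g : g \in Inv s (Q02 false) -> d0 g \in Inv s Q1.
Proof.
move=> /Inv_ract[gQ gE]; apply/Inv_ract; split; first exact: d0_Q.
by move=> a; rewrite -d0_lact gE d0_ract.
Qed.

Lemma d1_Inv s g : g \in Inv s Q1 -> d1 g \in Inv s (Q02 true).
Proof.
move=> /Inv_ract[gQ gE]; apply/Inv_ract; split; first exact: d1_Q.
by move=> a; rewrite -d1_lact gE d1_ract.
Qed.

Lemma rank_d1_d0 s :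
  \dim (linfun d1 @: Inv s Q1) = \dim (linfun d0 @: Inv (~~ s) (Q02 false)).
Proof.
have L0 g : linfun d0 g = d0 g by rewrite (linfun_lin d0_lin).
have L1 g : linfun d1 g = d1 g by rewrite (linfun_lin d1_lin).
apply/eqP; rewrite eqn_leq; apply/andP; split.
  apply: (rank_adj_le (B := pair02) (B' := pair1 s)) => [y|x y xI yI|x|x xI nd].
  - exact: pair1_linl.
  - by rewrite L0 L1 (pair_adjoint xI yI).
  - exact: pair1_linr.
  by move: nd; rewrite (L1 x); apply: (pair02_nondeg (d1_Inv xI)).
apply: (rank_adj_le (B := fun z x => pair1 s x z) (B' := fun y w => pair02 w y))
  => [y|x y xI yI|x|x xI nd].
- exact: pair02_linr.
- by rewrite L0 L1 (pair_adjoint yI xI).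
- exact: pair02_linl.
by move: nd; rewrite (L0 x); apply: (pair1_nondeg (d0_Inv xI)).
Qed.

(** * The Casimir differential on invariants *)

Lemma phiZ k x : phi (k *: x) = k * phi x.
Proof. by have := phi_lin k x 0; rewrite phi0 !addr0. Qed.

(** A path times its dual is already a socle path, so a proper extension of it is killed by that
    dual. *)
Lemma T_star0 a u v u' v' : (a + u < N)%N -> (v <= a)%N -> (0 < u' + v')%N ->
  Tc a (u + u') (v + v') * Tc (a + u - v) (N.-1 - a - u) (a - v) = 0.
Proof.
move=> uN va pos; have aN : (a < N)%N by lia.
have [->|/(T_nz_range sr aN)/andP[uN' va']] := eqVneq (Tc a (u + u') (v + v')) 0.
  by rewrite mul0r.
set e := (a + (u + u') - (v + v'))%N; have [de|de] := eqVneq (a + u - v)%N e.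
  rewrite de (T_mul sr) //; apply: (T_oob_u sr) => //; rewrite /e in de; lia.
have [de'|de'] := eqVneq (a + u - v)%N (N.-1 - e)%N; last first.
  by apply: (T_mul0 sr) => //; lia.
rewrite de' (T_mul_flip sr) //.
have [h|h] := leqP N (a + (u + u' + (a - v)))%N; first exact: (T_oob_u sr).
by apply: (T_oob_v sr) => //; lia.
Qed.

Lemma bJ_star p : bJ p * star p = soc (ja p).
Proof.
have [h1 h2 h3] := idxP p; rewrite /bJ /star (T_mul sr) // /soc.
by congr (Tc _ _ _); lia.
Qed.

(** By [T_star0] only the coefficient of x on the idempotent at the end of p survives, and pairing
    with the socle there reads it off. *)
Lemma sandwich p x : bJ p * x * star p = phi (x * soc (jend p)) *: soc (ja p).
Proof.
have lf : linear (fun x => bJ p * x * star p) by lin_tac.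
have lg : linear (fun x => phi (x * soc (jend p)) *: soc (ja p)).
  by move=> k y z; rewrite mulrDl -scalerAl phi_lin scalerDl scalerA.
move: x; apply: (linear_bJ lf lg) => q.
have [h1 h2 h3] := idxP p; have [k1 k2 k3] := idxP q.
have eN : (jend p < N)%N by exact: jendN.
rewrite [in RHS]/bJ /soc phi_TT //.
have [/eqP z|pos] := posnP (ju q + jv q)%N.
  have -> : bJ q = E (ja q).
    have [u0 v0] : ju q = 0%N /\ jv q = 0%N by lia.
    by rewrite /bJ u0 v0 T00.
  rewrite bJ_E' //; last lia.
  rewrite /vsame; case: (boolP (_ || _)) => c; last first.
    rewrite mul0r -[LHS](scale0r (soc (ja p))); congr (_ *: _).
    by case: (boolP (_ || _)) => // h; lia.
  rewrite bJ_star -[LHS]scale1r; congr (_ *: _).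
  by case: (boolP (_ || _)) => // h; lia.
have -> : ([&& jend p == ja q + ju q - jv q, ju q + (N.-1 - jend p) == N.-1 - ja q
      & jv q + jend p == ja q]
   || [&& jend p == N.-1 - (ja q + ju q - jv q), ju q + jend p == N.-1 - ja q
      & jv q + (N.-1 - jend p) == ja q])%N = false by lia.
rewrite scale0r /bJ /star /jend; set d := (ja p + ju p - jv p)%N.
have [qd|qd] := eqVneq (ja q) d; first by rewrite qd (T_mul sr) // T_star0.
have [qd'|qd'] := eqVneq (ja q) (N.-1 - d)%N.
  by rewrite qd' (T_mul_flip sr) // T_star0 // addnC.
by rewrite (T_mul0 sr) ?mul0r //; lia.
Qed.

Definition soc_coef (g : W) c : K := phi (at_ g c 1 * soc c).

Lemma tau_soc s g : g \in Inv s (Q02 true) ->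
  tau g = \sum_(p : idx n) (if s && (jend p < n)%N then - soc_coef g (jend p)
                  else soc_coef g (jend p)) *: soc (ja p).
Proof.
move=> gI; apply: eq_bigr => p _; rewrite (InvE _ gI); last exact: jendN.
have -> : tw s (bJ p) = if s && (jend p < n)%N then - bJ p else bJ p.
  by case: s {gI} => //=; rewrite /tw sg_bJ.
by case: ifP => _; rewrite ?mulNr sandwich ?scaleNr.
Qed.

Lemma soc_coef_flip s g c : g \in Inv s (Q02 true) -> (c < N)%N ->
  soc_coef g (N.-1 - c)%N = - soc_coef g c.
Proof.
move=> gI cN; rewrite /soc_coef (Inv02_flip gI) // soc_flip //.
by rewrite expr1 mulN1r mulNr phiN.
Qed.

(** Reversing both ranges, u |-> 2n-1-a-u and v |-> a-v, replaces the endpoint by its twin, where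
    the coefficient is opposite. Each inner sum therefore equals its own negative. *)
Lemma tau_Inv0 g : 2%:R != 0 :> K -> g \in Inv false (Q02 true) -> tau g = 0.
Proof.
move=> two gI; rewrite (tau_soc gI) /=.
rewrite (big_idx _ n (fun a u v => soc_coef g (a + u - v)%N *: soc a)) big1 // => i _.
pose S := \sum_(u < n - i) \sum_(v < (n + i).+1) soc_coef g (n + i + u - v)%N.
suff S0 : S = 0.
  rewrite -[RHS](scale0r (soc (n + i)%N)) -S0 scaler_suml; apply: eq_bigr => u _.
  by rewrite scaler_suml.
have iN := ltn_ord i; have : S = - S.
  rewrite {1}/S (reindex_inj rev_ord_inj) -sumrN; apply: eq_bigr => u _ /=.
  rewrite (reindex_inj rev_ord_inj) -sumrN; apply: eq_bigr => v _ /=.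
  have uN := ltn_ord u; have vN := ltn_ord v.
  by rewrite -(soc_coef_flip gI); [congr soc_coef; lia|lia].
move=> /eqP; rewrite -addr_eq0 -mulr2n -mulr_natl mulf_eq0 (negbTE two).
by move=> /eqP.
Qed.

Lemma soc_mul_E i a : (i < n)%N -> (n <= a < N)%N ->
  soc a * E (n + i)%N = if a == (n + i)%N then soc a else 0.
Proof.
move=> iN /andP[na aN]; rewrite -soc_E // -mulrA (strip_mul sr) ?ltn_add2l //.
have -> : (n + i == N.-1 - a)%N = false by lia.
by rewrite orbF eq_sym; case: ifP => _; rewrite ?mulr0.
Qed.

(** With the twist the sign of [sg] cancels the antisymmetry, so both lifts of an endpoint
    contribute equally and the coefficients are the entries dim e_i A e_j of the Cartan matrix. *)
Lemma tau_Inv1 g i : g \in Inv true (Q02 true) -> (i < n)%N ->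
  tau g * E (n + i)%N =
  (\sum_(j < n) (2 * (n - maxn i j))%:R * soc_coef g (n + j)%N) *: soc (n + i)%N.
Proof.
move=> gI iN; rewrite (tau_soc gI) mulr_suml.
rewrite (eq_bigr (fun p : idx n => \sum_(j < n)
    ((vsame (ja p) (n + i)%N && vsame (jend p) (n + j)%N : nat)%:R * soc_coef g (n + j)%N)
    *: soc (n + i)%N)); last first.
  move=> p _; have [h1 h2 h3] := idxP p; have eN : (jend p < N)%N by exact: jendN.
  rewrite -scalerAl soc_mul_E //; last lia.
  have -> : vsame (ja p) (n + i)%N = (ja p == n + i)%N by rewrite /vsame; lia.
  case: eqP => [->|_]; last by rewrite scaler0 big1 // => j _; rewrite mul0r scale0r.
  have jn : (maxn (jend p) (N.-1 - jend p) - n < n)%N by lia.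
  rewrite (bigD1 (Ordinal jn)) //= big1 ?addr0 => [|j jj].
    rewrite subnKC; last lia.
    have -> : vsame (jend p) (maxn (jend p) (N.-1 - jend p)) by rewrite /vsame; lia.
    rewrite mul1r; case: ifP => en.
      have -> : maxn (jend p) (N.-1 - jend p) = (N.-1 - jend p)%N by lia.
      by rewrite (soc_coef_flip gI).
    by have -> : maxn (jend p) (N.-1 - jend p) = jend p by lia.
  have jj' : (j : nat) != (maxn (jend p) (N.-1 - jend p) - n)%N by [].
  have jN := ltn_ord j.
  have -> : vsame (jend p) (n + j)%N = false by rewrite /vsame; lia.
  by rewrite mul0r scale0r.
rewrite exchange_big /= scaler_suml; apply: eq_bigr => j _.
rewrite -scaler_suml -mulr_suml -natr_sum count_idx; have jN := ltn_ord j; try lia.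
by congr ((_%:R * _) *: _); lia.
Qed.

Lemma rank_d2_Inv0 : 2%:R != 0 :> K -> \dim (linfun d2 @: Inv false (Q02 true)) = 0%N.
Proof.
move=> two; apply/eqP; rewrite dimv_eq0 -subv0; apply/subvP => h /memv_imgP[g gI ->].
rewrite (linfun_lin d2_lin) d2_iota tau_Inv0 //.
by rewrite memv0; apply/eqP/(fam_ext n0) => c x cN; rewrite iota_famE // at0 !mul0r.
Qed.

(** The antisymmetric family of idempotents with coefficient 1 at vertex k and -1 at k+1, chosen to
    be dual to the differences taken in [rank_d2_Inv1]. *)
Definition step_fam k c : A :=
  ((-1) ^+ (c < n)%N * (((maxn c (N.-1 - c) == n + k)%N : nat)%:R -
    ((maxn c (N.-1 - c) == n + k.+1)%N : nat)%:R)) *: E c.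

Lemma step_fam_Inv k : twfam true (step_fam k) \in Inv true (Q02 true).
Proof.
apply: Inv_twfam; apply: twfam_Q02 => c cN; rewrite /step_fam.
- by rewrite -scalerAr (E_idem sr).
- by rewrite -scalerAl (E_idem sr).
rewrite (strip_flip sr) // mulN1r -scaleNr; congr (_ *: _).
have -> : (N.-1 - (N.-1 - c) = c)%N by lia.
rewrite maxnC -mulNr; congr (_ * _).
have [cn|cn] := ltnP c n.
  have -> : (N.-1 - c < n)%N = false by lia.
  by rewrite expr1 opprK.
by have -> : (N.-1 - c < n)%N by lia.
Qed.

Lemma step_fam_coef k j : (j < n)%N ->
  soc_coef (twfam true (step_fam k)) (n + j)%N = (j == k)%:R - (j == k.+1)%:R.
Proof.
move=> jn; rewrite /soc_coef twfam1 ?ltn_add2l // /step_fam -scalerAl.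
rewrite E_soc ?ltn_add2l //.
rewrite phiZ phi_soc ?ltn_add2l // mulr1.
have -> : (n + j < n)%N = false by lia.
have -> : maxn (n + j) (N.-1 - (n + j)) = (n + j)%N by lia.
by rewrite expr0 mul1r !eqn_add2l.
Qed.

Lemma rank_d2_Inv1 : 2%:R != 0 :> K -> \dim (linfun d2 @: Inv true (Q02 true)) = n.
Proof.
move=> two; have L2 g : linfun d2 g = d2 g by rewrite (linfun_lin d2_lin).
pose r (h : W) i := if (i < n)%N then phi (at_ h (n + i)%N 1) else 0.
have r_lin i : scalar (r^~ i).
  move=> k x y; rewrite /r; case: ifP => _; last by rewrite mulr0 addr0.
  by rewrite atD phi_lin.
have rE g i : g \in Inv true (Q02 true) -> (i <= n)%N ->
    r (d2 g) i = \sum_(j < n) (2 * (n - maxn i j))%:R * soc_coef g (n + j)%N.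
  move=> gI; rewrite leq_eqVlt /r => /orP[/eqP ->|iN].
    rewrite ltnn big1 // => j _; have jN := ltn_ord j.
    have -> : (n - maxn n j = 0)%N by lia.
    by rewrite muln0 mul0r.
  by rewrite iN d2E ?ltn_add2l // mulr1 tau_Inv1 // phiZ phi_soc ?ltn_add2l // mulr1.
(* Differences of consecutive rows of the matrix 2(n - max(i, j)) are 2 [j <= i]. After halving, the
   family with values 1 at k and -1 at k+1 gives [k <= i] - [k+1 <= i] = [i = k]. The convention
   [r h n] = 0 supplies the row below the last. *)
pose F (h : W) : {ffun 'I_n -> K^o} := [ffun i : 'I_n => 2%:R^-1 * (r h i - r h i.+1)].
rewrite -[RHS]card_ord; apply: (dim_dual_family (F := F)
  (b := fun k : 'I_n => d2 (twfam true (step_fam k)))).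
- move=> k x y; apply/ffunP => i; rewrite !ffunE !r_lin.
  have e (h a b c d : K) : h * (k * a + b - (k * c + d)) = k * (h * (a - c)) + h * (b - d).
    by ring.
  exact: e.
- move=> h /memv_imgP[g gI ->]; rewrite L2 => /ffunP F0.
  have r0 m : (m <= n)%N -> r (d2 g) (n - m)%N = 0.
    elim: m => [_|m IH mn]; first by rewrite subn0 /r ltnn.
    have im : (n - m.+1 < n)%N by lia.
    have /eqP := F0 (Ordinal im); rewrite !ffunE mulf_eq0 invr_eq0 (negbTE two) /=.
    have -> : (n - m.+1).+1 = (n - m)%N by lia.
    by rewrite IH ?subr0 => [/eqP //|]; lia.
  have t0 : tau g = 0.
    rewrite -[tau g]mulr1 -(strip_sum sr) mulr_sumr big1 // => i _.
    have iN := ltn_ord i; have := r0 (n - i)%N (leq_subr _ _).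
    have -> : (n - (n - i) = i)%N by lia.
    by rewrite rE ?(ltnW iN) // (tau_Inv1 gI iN) => ->; rewrite scale0r.
  by rewrite d2_iota t0; apply/(fam_ext n0) => c x cN; rewrite iota_famE // at0 !mul0r.
- by move=> k; rewrite -L2 memv_img // step_fam_Inv.
move=> k; apply/ffunP => i; rewrite !ffunE; have iN := ltn_ord i; have kN := ltn_ord k.
rewrite !rE ?step_fam_Inv //; last by rewrite ltnW.
rewrite -sumrB (eq_bigr (fun j : 'I_n =>
  2%:R * ((j <= i)%N%:R * ((j == k)%:R - (j == k.+1 :> nat)%:R)))); last first.
  move=> j _; have jN := ltn_ord j; rewrite step_fam_coef // -mulrBl mulrA; congr (_ * _).
  rewrite -natrB; last lia.
  by rewrite -natrM; congr (_%:R); lia.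
have pick m : \sum_(j < n) (j <= i)%N%:R * (j == m :> nat)%:R = (m <= i)%N%:R :> K.
  rewrite (eq_bigr (fun j : 'I_n => ((j <= i) && (j == m :> nat))%N%:R)) => [|j _]; last first.
    by rewrite -natrM mulnb.
  rewrite -natr_sum (@sum_nat_pred1 n (fun j => (j <= i) && (j == m))%N
    (if (m <= i)%N then m else n)).
    by case: (leqP m i) => h; congr (nat_of_bool _)%:R; lia.
  by move=> j jN; case: (leqP m i) => h; lia.
rewrite -mulr_sumr mulKf //; under eq_bigr do rewrite mulrBr.
rewrite sumrB (pick k) (pick k.+1) -natrB; last lia.
by congr (_%:R); rewrite -val_eqE /=; lia.
Qed.

(** * Assembling the dimensions *)

Let L0 g : linfun d0 g = d0 g. Proof. by rewrite (linfun_lin d0_lin). Qed.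
Let L1 g : linfun d1 g = d1 g. Proof. by rewrite (linfun_lin d1_lin). Qed.
Let L2 g : linfun d2 g = d2 g. Proof. by rewrite (linfun_lin d2_lin). Qed.
Let LI x : linfun iota_fam x = iota_fam x.
Proof. by rewrite (linfun_lin iota_fam_lin). Qed.

Lemma iota_fam_inj : injective iota_fam.
Proof.
move=> x y xy; rewrite -[x]mulr1 -[y]mulr1 -(strip_sum sr) !mulr_sumr.
apply: eq_bigr => i _; have := congr1 (fun h => at_ h (n + i)%N 1) xy.
by rewrite !iota_famE ?ltn_add2l // !mulr1.
Qed.

Lemma cap_ker_img (Q Q' : {vspace W}) (f f' : 'End(W)) :
    (forall g, g \in Q -> f g \in Q' /\ f' (f g) = 0) ->
    (forall g, g \in Q' -> f' g = 0 -> exists2 h, h \in Q & g = f h) ->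
  (Q' :&: lker f' = f @: Q)%VS.
Proof.
move=> fQ ex; apply/vspaceP => g; rewrite memv_cap memv_ker.
apply/andP/memv_imgP => [[gQ /eqP f0]|[h hQ ->]]; first exact: ex.
by have [-> ->] := fQ h hQ.
Qed.

Lemma exact_phase0 : (Q1 :&: lker (linfun d1) = linfun d0 @: Q02 false)%VS.
Proof.
apply: cap_ker_img => g gQ; rewrite !(L0, L1).
  by split; [apply: d0_Q|apply: d1_d0].
by case/(exact_Q1 gQ) => h hQ ->; exists h; rewrite ?L0.
Qed.

Lemma exact_phase1 : (Q02 true :&: lker (linfun d2) = linfun d1 @: Q1)%VS.
Proof.
apply: cap_ker_img => g gQ; rewrite !(L1, L2).
  by split; [apply: d1_Q|apply: d2_d1].
rewrite d2_iota => t0; have tg : tau g = 0.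
  by apply: iota_fam_inj; rewrite t0 -LI linear0.
by case/(exact_Q2 gQ): tg => h hQ ->; exists h; rewrite ?L1.
Qed.

Lemma exact_phase2 : (Q02 false :&: lker (linfun d0) = linfun d2 @: Q02 true)%VS.
Proof.
apply: cap_ker_img => g gQ; rewrite !(L0, L2).
  by split; [apply: d2_Q|apply: d0_d2].
case/(exact_Q0 gQ) => lam ->; have [h hQ <-] := tau_surj lam.
by exists h; rewrite ?L2 // d2_iota.
Qed.

Lemma exact_phase_iota : (Q02 false :&: lker (linfun d0) = limg (linfun iota_fam))%VS.
Proof.
rewrite exact_phase2; apply/vspaceP => g; apply/memv_imgP/memv_imgP => [[h hQ ->]|[lam _ ->]].
  by exists (tau h); rewrite ?memvf // LI L2 d2_iota.
have [h hQ <-] := tau_surj lam.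
by exists h; rewrite ?LI ?L2 ?d2_iota.
Qed.

(* The coresolution has period 3 up to the automorphism sg, hence period 6. *)
Definition phase r : {vspace W} :=
  match r with 0 => Q02 false | 1 => Q1 | _ => Q02 true end.
Definition phase_map r : 'End(W) :=
  match r with 0 => linfun d0 | 1 => linfun d1 | _ => linfun d2 end.
Definition twist k := odd (k %/ 3).

Lemma phase_succ k :
  [\/ [/\ k %% 3 = 0, k.+1 %% 3 = 1 & twist k.+1 = twist k],
      [/\ k %% 3 = 1, k.+1 %% 3 = 2 & twist k.+1 = twist k] |
      [/\ k %% 3 = 2, k.+1 %% 3 = 0 & twist k.+1 = ~~ twist k]]%N.
Proof.
rewrite /twist; have : (k %% 3 < 3)%N by rewrite ltn_mod.
case e : (k %% 3)%N => [|[|[|]]] // _; [apply: Or31|apply: Or32|apply: Or33]; split; lia.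
Qed.

Lemma dimHH_coh_phase :
  dimHH_coh A 0 = \dim (Inv false (Q02 false) :&: lker (linfun d0)) /\
  forall i, dimHH_coh A i.+1 =
    (\dim (Inv (twist i.+1) (phase (i.+1 %% 3)) :&: lker (phase_map (i.+1 %% 3))) -
     \dim (phase_map (i %% 3) @: Inv (twist i) (phase (i %% 3))))%N.
Proof.
apply: (dimHH_coh_coresolution (W := W) (l := lact) (r := fun k => ract (twist k))
  (Q := fun k => phase (k %% 3)) (Inv := fun k => Inv (twist k) (phase (k %% 3)))
  (phi := fun k => phase_map (k %% 3)) (iota := linfun iota_fam)
  (rho := fun k => rho (twist k))).
- by move=> k; apply: bimod_fam.
- move=> k a w; case: (k %% 3)%N => [|[|r]] /=; [apply: Q02_lact|apply: Q1_lact|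
    apply: Q02_lact].
- move=> k a w; case: (k %% 3)%N => [|[|r]] /=; [apply: Q02_ract|apply: Q1_ract|
    apply: Q02_ract].
- move=> k a w _; case: (k %% 3)%N => [|[|r]] /=.
  + by rewrite !L0 d0_lact.
  + by rewrite !L1 d1_lact.
  by rewrite !L2 d2_lact.
- move=> k a w; case: (phase_succ k) => -[-> _ ->] /= wQ.
  + by rewrite !L0 d0_ract.
  + by rewrite !L1 d1_ract.
  by rewrite !L2 d2_ract.
- move=> k; case: (phase_succ k) => -[-> -> _] /=.
  + exact: exact_phase0.
  + exact: exact_phase1.
  exact: exact_phase2.
- by move=> x y; rewrite !LI; apply: iota_fam_inj.
- move=> a x; rewrite !LI; apply: (fam_ext n0) => c y cN.
  by rewrite lactE // !iota_famE // !mulrA.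
- move=> a x; rewrite !LI; apply: (fam_ext n0) => c y cN.
  by rewrite ractE // !iota_famE // !mulrA.
- exact: exact_phase_iota.
- by move=> k c G1 G2 l1 l2; apply: rho_lin.
- by move=> k a G lG; rewrite rho_l.
- by move=> k a G lG; rewrite rho_r.
- move=> k w wQ; apply: rho_id => c x cN; move: wQ.
  by case: (k %% 3)%N => [|[|r]] /= wQ; [rewrite (Q02_xE _ wQ)|rewrite (Q1_xE _ wQ)|
    rewrite (Q02_xE _ wQ)].
- move=> k G lG; case: (k %% 3)%N => [|[|r]] /=; [apply: rho_Q02|apply: rho_Q1|
    apply: rho_Q02] => //.
by move=> k w; apply: (iffP idP) => /Inv_ract.
Qed.

Lemma ker_dim (f : 'End(W)) (Q : {vspace W}) d : \dim Q = d ->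
  \dim (Q :&: lker f) = (d - \dim (f @: Q))%N.
Proof. by move=> <-; rewrite -(limg_ker_dim f Q) addnK. Qed.

Lemma img_dim (f : 'End(W)) (Q : {vspace W}) d k : \dim Q = d ->
  \dim (Q :&: lker f) = k -> \dim (f @: Q) = (d - k)%N.
Proof. by move=> <- <-; rewrite -(limg_ker_dim f Q) addKn. Qed.

(** On invariants, untwisted value first, [d0] has rank n^2 - n or n^2, [d1] has rank n^2 or n^2 -
    n, and [d2] has rank 0 or n. Kernel minus incoming rank is n at each of the six positions of the
    period; in degree 0 nothing comes in and the 2n remain. *)
Lemma dimHH_coh_strip : 2%:R != 0 :> K ->
  dimHH_coh A 0 = (2 * n)%N /\ forall i, dimHH_coh A i.+1 = n.
Proof.
move=> two; have [H0 HS] := dimHH_coh_phase.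
split=> [|i]; first by rewrite H0 dim_ker_d0.
have D02 b s : \dim (Inv s (Q02 b)) = (n * n + n)%N.
  by rewrite dim_Inv02 card_I0 mulnS addnC.
have D1 s : \dim (Inv s Q1) = (n * n + n * n)%N.
  by rewrite dim_Inv1 card_I1 -mulnA mul2n addnn.
have r0 := img_dim (D02 false false) dim_ker_d0.
have r0' := img_dim (D02 false true) (dim_ker_d0_tw two).
have nn : (n <= n * n)%N by rewrite leq_pmull.
have r1 s : \dim (linfun d1 @: Inv s Q1) = (if s then n * n - n else n * n)%N.
  by rewrite rank_d1_d0; case: s => /=; [rewrite r0|rewrite r0']; lia.
have r2 s : \dim (linfun d2 @: Inv s (Q02 true)) = (if s then n else 0)%N.
  by case: s; [apply: (rank_d2_Inv1 two)|apply: (rank_d2_Inv0 two)].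
have k1 s : \dim (Inv s Q1 :&: lker (linfun d1)) = (if s then n * n + n else n * n)%N.
  by rewrite (ker_dim _ (D1 s)) r1; move: nn; clear; case: s; lia.
have k2 s : \dim (Inv s (Q02 true) :&: lker (linfun d2)) = (if s then n * n else n * n + n)%N.
  by rewrite (ker_dim _ (D02 true s)) r2; move: nn; clear; case: s; lia.
(* The wrap-around is treated first: there the target is Q0, with the twist opposite to that of the
   incoming [d2]. *)
rewrite HS; case: (phase_succ i) => -[-> -> ->] /=; last first.
- rewrite r2; case: (twist i) => /=.
    by rewrite dim_ker_d0; lia.
  by rewrite (dim_ker_d0_tw two); lia.
- by rewrite k2 r1; move: nn; clear; case: (twist i); lia.
by rewrite k1; case: (twist i); [rewrite r0'|rewrite r0]; move: nn; clear; lia.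
Qed.

End StripAlgebra.

Theorem theorem4p4 (K : closedFieldType) (hK : 2%N \notin [pchar K])
    (n : nat) (hn : (0 < n)%N)
    (A : falgType K) (e : nat -> A) (eps : A) (a ab : nat -> A)
    (hA : is_PLn n e eps a ab) :
  [/\ dimHH_coh A 0 = (2 * n)%N, dimHH_hom A 0 = (2 * n)%N &
      forall i : nat, (0 < i)%N -> dimHH_coh A i = n /\ dimHH_hom A i = n].
Proof.
have two : 2%:R != 0 :> K by move: hK; rewrite inE.
have [jc [sg sa]] := PLn_structure hn hA.
have homE := dimHH_hom_coh (phi_lin sa) (phiC hn sa) (phi_nd hn sa).
have [H0 HS] := dimHH_coh_strip hn sa two.
by split=> [||[//|i] _]; rewrite ?homE ?H0 ?HS.
Qed.
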